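(* Let $\lambda>0$. For all $\mu,\nu\in\mathcal{M}(\Omega;V)$, $$\mathcal{T}_{1,1}^\lambda(\mu,\nu)=\min_{\sigma\in\mathcal{M}(\Omega;V^d),\,\delta\in\mathcal{M}(\Omega;V)}\left\{\int_\Omega|\sigma|_{V^d}+\lambda\int_\Omega|\delta|_V,\ \operatorname{div}(\sigma)=\mu-\nu+\delta\right\}$$ (in particular the minimum is attained).
   Context: $\Omega\subset\mathbb{R}^d$ is compact and convex with non-empty interior $\mathrm{int}(\Omega)$. $V$ is a real vector space of finite dimension $n$ with scalar product $\langle\cdot,\cdot\rangle_V$ and norm $|\cdot|_V$. $V^d$ carries the scalar product $\langle w,z\rangle_{V^d}=\sum_{l=1}^d\langle w_l,z_l\rangle_V$ and the associated norm $|\cdot|_{V^d}$. $C(\Omega;V)$, $C(\Omega;V^d)$ are spaces of continuous functions with sup norms. $\mathcal{M}(\Omega;V)$, $\mathcal{M}(\Omega;V^d)$ are the spaces of finite vector-valued measures on $\Omega$, dual to these via $\int_\Omega\langle\phi,\mu\rangle_V$ and $\int_\Omega\langle\psi,\sigma\rangle_{V^d}$. $\int_\Omega|\delta|_V$ and $\int_\Omega|\sigma|_{V^d}$ denote the total variation norms, i.e. the suprema of these pairings over continuous functions of sup norm at most $1$. Gradient and divergence act componentwise in an orthonormal basis of $V$. For $\phi\in C(\Omega;V)$, $$|\nabla\phi|_{V^d,\infty}:=\sup\Big\{\int_\Omega\langle\phi,\operatorname{div}\psi\rangle_V:\ \psi\in C_c^\infty(\mathrm{int}(\Omega);V^d),\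 \int_\Omega|\psi|_{V^d}\le1\Big\}\in[0,+\infty].$$ For $\sigma\in\mathcal{M}(\Omega;V^d)$ and $\rho\in\mathcal{M}(\Omega;V)$, $\operatorname{div}(\sigma)=\rho$ is meant in the weak sense with zero flux boundary conditions: $-\int_\Omega\langle\nabla\phi,\sigma\rangle_{V^d}=\int_\Omega\langle\phi,\rho\rangle_V$ for all $\phi\in C^1(\Omega;V)$. For $\mu,\nu\in\mathcal{M}(\Omega;V)$, $$W_1^V(\mu,\nu):=\sup_{\phi\in C(\Omega;V)}\Big\{\int_\Omega\langle\phi,\nu-\mu\rangle_V,\ |\nabla\phi|_{V^d,\infty}\le1\Big\}\in[0,+\infty],$$ which is $+\infty$ if $\int_\Omega\mu\ne\int_\Omega\nu$ (as vectors of $V$), and $$\mathcal{T}_{1,1}^\lambda(\mu,\nu):=\inf_{\delta\in\mathcal{M}(\Omega;V)}W_1^V(\mu+\delta,\nu)+\lambda\int_\Omega|\delta|_V.$$ *)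

(* Defs.v *)
From HB Require Import structures.
From mathcomp Require Import all_boot all_order all_algebra.
From mathcomp Require Import sesquilinear.
From mathcomp Require Import all_classical all_reals all_analysis.
From mathcomp Require Import measurable_realfun.
From mathcomp Require Import ring lra.

Set Implicit Arguments.
Unset Strict Implicit.
Unset Printing Implicit Defensive.

Import Order.TTheory GRing.Theory Num.Theory.
Import numFieldTopology.Exports numFieldNormedType.Exports.

Local Open Scope classical_set_scope.
Local Open Scope ring_scope.

(* Borel sigma-algebra of R^d. *)
HB.instance Definition _ (R : realType) (d : nat) :=
  Measurable.copy 'rV[R]_d (g_sigma_algebraType (@open 'rV[R]_d)).

Section lebesgue_step.
Context {R : realType} (n : nat).
Local Notation mR := (measurableTypeR R).
Context (m : {sigma_finite_measure set (n.-tuple mR) -> \bar R}).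

Definition pcons (x : mR * n.-tuple mR) : n.+1.-tuple mR :=
  [tuple of x.1 :: x.2].

Lemma measurable_pcons : measurable_fun [set: mR * n.-tuple mR] pcons.
Proof. by apply: measurable_cons; [exact: measurable_fst|exact: measurable_snd]. Qed.

Definition lebesgue_cons : set (n.+1.-tuple mR) -> \bar R :=
  pushforward ((@lebesgue_measure R) \x m)%E pcons.

Let lebesgue_cons0 : lebesgue_cons set0 = 0%E.
Proof. by rewrite /lebesgue_cons /pushforward preimage_set0 measure0. Qed.

Let lebesgue_cons_ge0 A : (0 <= lebesgue_cons A)%E.
Proof. by rewrite /lebesgue_cons /pushforward; exact: measure_ge0. Qed.

Let lebesgue_cons_sigma_additive : semi_sigma_additive lebesgue_cons.
Proof.
move=> F mF tF mUF; rewrite /lebesgue_cons /pushforward preimage_bigcup.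
have mpre A : measurable A -> measurable (pcons @^-1` A).
  by move=> mA; rewrite -[X in measurable X]setTI; exact: measurable_pcons.
apply: measure_semi_sigma_additive => [i||]; first exact: mpre.
- apply/trivIsetP => i j _ _ ij; rewrite -preimage_setI.
  by move/trivIsetP : tF => /(_ _ _ _ _ ij) -> //; rewrite preimage_set0.
- by rewrite -preimage_bigcup; exact: mpre.
Qed.

HB.instance Definition _ := isMeasure.Build _ _ _ lebesgue_cons
  lebesgue_cons0 lebesgue_cons_ge0 lebesgue_cons_sigma_additive.

Lemma lebesgue_cons_sigma_finite : sigma_finite setT lebesgue_cons.
Proof.
have /sigma_finiteP[F [TF ndF Foo]] := sigma_finiteT (@lebesgue_measure R).
have /sigma_finiteP[G [TG ndG Goo]] := sigma_finiteT m.
pose g (t : n.+1.-tuple mR) : mR * n.-tuple mR := (thead t, [tuple of behead t]).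
have mg : measurable_fun setT g.
  apply/measurable_fun_pairP; split.
    exact: (@measurable_tnth _ mR n.+1 ord0).
  exact: measurable_behead.
have gK x : g (pcons x) = x.
  by case: x => a t; rewrite /g /pcons/=; congr pair; apply/val_inj.
exists (fun i => g @^-1` (F i `*` G i)).
  rewrite -preimage_bigcup (_ : \bigcup_i _ = setT) ?preimage_setT//.
  apply/seteqP; split => // -[x y] _.
  have [a _ Fx] : (\bigcup_i F i) x by rewrite -TF.
  have [b _ Gy] : (\bigcup_i G i) y by rewrite -TG.
  exists (maxn a b) => //; split.
    by move: x Fx; exact/subsetPset/ndF/leq_maxl.
  by move: y Gy; exact/subsetPset/ndG/leq_maxr.
move=> i; have [mF Fi] := Foo i; have [mG Gi] := Goo i; split.
  by rewrite -[X in measurable X]setTI; apply: mg => //; exact: measurableX.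
rewrite /lebesgue_cons /pushforward -comp_preimage.
rewrite (_ : g \o pcons = id) ?preimage_id; last first.
  by apply/funext => x; exact: gK.
by rewrite product_measure1E// lte_mul_pinfty// ge0_fin_numE.
Qed.

HB.instance Definition _ :=
  Measure_isSigmaFinite.Build _ _ _ lebesgue_cons lebesgue_cons_sigma_finite.

End lebesgue_step.

(* Iterated product of the one-dimensional Lebesgue measure; a point mass when
   d = 0. *)
Fixpoint lebesgue_tuple (R : realType) (d : nat) :
    {sigma_finite_measure set (d.-tuple (measurableTypeR R)) -> \bar R} :=
  match d with
  | 0%N => \d_ [tuple]
  | n.+1 => lebesgue_cons (lebesgue_tuple R n)
  end.

Section lebesgue_rV.
Context {R : realType} (d : nat).
Local Notation mR := (measurableTypeR R).

Definition rV_of_tuple (t : d.-tuple mR) : 'rV[R]_d := \row_i tnth t i.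

Lemma measurable_rV_of_tuple : measurable_fun [set: d.-tuple mR] rV_of_tuple.
Proof.
apply: (@measurability _ _ _ _ _ _ (@open 'rV[R]_d)) => //.
move=> _ [U oU <-]; rewrite setTI.
pose B (q : 'rV[rat]_d * nat) : set 'rV[R]_d :=
  ball (map_mx (@ratr R) q.1) q.2.+1%:R^-1.
have -> : U = \bigcup_(q : 'rV[rat]_d * nat)
    (if pselect (B q `<=` U) then B q else set0).
  apply/seteqP; split => [x Ux|x [q _]]; last by case: pselect => // BU /BU.
  have /nbhs_ballP[e /= e0 xe] : nbhs x U by exact: open_nbhs_nbhs.
  have [k ke] : exists k : nat, k.+1%:R^-1 < e / 2.
    have [k _ kP] := near_infty_natSinv_lt (PosNum (divr_gt0 e0 (ltr0n _ 2))).
    by exists k; exact: (kP k (leqnn k)).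
  have k0 : 0 < k.+1%:R^-1 :> R by rewrite invr_gt0.
  have /choice[f fP] : forall i : 'I_d, exists q : rat,
      `|ratr q - x ord0 i| < k.+1%:R^-1 :> R.
    move=> i; have /rat_in_itvoo[q] :
        x ord0 i - k.+1%:R^-1 < x ord0 i + k.+1%:R^-1.
      by rewrite ltrD2l gtrN.
    by rewrite in_itv/= -ltr_distl; exists q.
  have Bx : B (\row_i f i, k) x.
    split => // i j; rewrite !mxE (ord1 i) /ball/=; exact: fP.
  exists (\row_i f i, k) => //; case: pselect => // -[].
  move=> y By; apply: xe; rewrite (splitr e).
  apply: (@ball_triangle _ _ (map_mx (@ratr R) (\row_i f i))).
    by apply: ball_sym; apply: le_ball Bx; exact: ltW.
  by apply: le_ball By; exact: ltW.
rewrite preimage_bigcup; apply: countable_bigcupT_measurable.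
  exact: countableP.
move=> q; have [-> | ->] : (if pselect (B q `<=` U) then B q else set0) = B q \/
    (if pselect (B q `<=` U) then B q else set0) = set0.
- by case: pselect; [left|right].
rewrite (_ : _ @^-1` _ = \bigcap_(i : 'I_d)
    ((fun t : d.-tuple mR => tnth t i) @^-1`
       ball (ratr (q.1 ord0 i) : R) q.2.+1%:R^-1)).
  apply: fin_bigcap_measurable; first exact: finite_finset.
  move=> i _; rewrite -[X in measurable X]setTI; apply: measurable_tnth => //.
  by apply: (@open_measurable R); apply: ball_open; rewrite invr_gt0.
apply/seteqP; split => t /=.
  by move=> [_ tq] i _; have := tq ord0 i; rewrite !mxE.
move=> tq; split; first by rewrite invr_gt0.
by move=> i j; rewrite !mxE (ord1 i); exact: tq.
- by rewrite preimage_set0.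
Qed.

(* Lebesgue measure on the Borel sets of R^d. *)
Definition lebesgue_rV : set 'rV[R]_d -> \bar R :=
  pushforward (lebesgue_tuple R d) rV_of_tuple.

Let lebesgue_rV0 : lebesgue_rV set0 = 0%E.
Proof. by rewrite /lebesgue_rV /pushforward preimage_set0 measure0. Qed.

Let lebesgue_rV_ge0 A : (0 <= lebesgue_rV A)%E.
Proof. by rewrite /lebesgue_rV /pushforward; exact: measure_ge0. Qed.

Let lebesgue_rV_sigma_additive : semi_sigma_additive lebesgue_rV.
Proof.
move=> F mF tF mUF; rewrite /lebesgue_rV /pushforward preimage_bigcup.
have mpre A : measurable A -> measurable (rV_of_tuple @^-1` A).
  by move=> mA; rewrite -[X in measurable X]setTI; exact: measurable_rV_of_tuple.
apply: measure_semi_sigma_additive => [i||]; first exact: mpre.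
- apply/trivIsetP => i j _ _ ij; rewrite -preimage_setI.
  by move/trivIsetP : tF => /(_ _ _ _ _ ij) -> //; rewrite preimage_set0.
- by rewrite -preimage_bigcup; exact: mpre.
Qed.

HB.instance Definition _ := isMeasure.Build _ _ _ lebesgue_rV
  lebesgue_rV0 lebesgue_rV_ge0 lebesgue_rV_sigma_additive.

End lebesgue_rV.
Arguments lebesgue_rV : clear implicits.

Section dot_norm.
Context {R : realType} {W : lmodType R} (form : {dot W for idfun}).

Definition dnorm (v : W) : R := Num.sqrt (form v v).

Lemma dotC u v : form u v = form v u.
Proof. by rewrite hermC expr0 mul1r. Qed.

Lemma dot_ge0 v : 0 <= form v v.
Proof.
have [->|v0] := eqVneq v 0; first by rewrite linear0l.
exact/ltW/neq0_dnorm_gt0.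
Qed.

Lemma dot_CauchySchwarz u v : `|form u v| <= dnorm u * dnorm v.
Proof.
have [->|v0] := eqVneq v 0; first by rewrite linear0r normr0 mulr_ge0 ?sqrtr_ge0.
have fv : 0 < form v v by exact: neq0_dnorm_gt0.
rewrite -sqrtrM ?dot_ge0// -sqrtr_sqr ler_sqrt ?mulr_ge0 ?dot_ge0//.
have := dot_ge0 (form v v *: u - form u v *: v).
rewrite linearBl linearBr/= linearBr/= !linearZl_LR !linearZr_LR/= (dotC v u).
have -> : form v v * (form v v * form u u) - form u v * (form v v * form u v)
    - (form v v * (form u v * form u v) - form u v * (form u v * form v v)) =
  form v v * (form u u * form v v - form u v ^+ 2) by ring.
by rewrite pmulr_rge0// subr_ge0.
Qed.

Lemma dnormD u v : dnorm (u + v) <= dnorm u + dnorm v.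
Proof.
have n0 w : 0 <= dnorm w by exact: sqrtr_ge0.
rewrite -(@ler_pXn2r _ 2) ?nnegrE ?addr_ge0// sqrrD !sqr_sqrtr ?dot_ge0//.
rewrite linearDl !linearDr/= (dotC v u).
have := le_trans (ler_norm _) (dot_CauchySchwarz u v).
rewrite mulr2n; lra.
Qed.

Lemma dnormN u : dnorm (- u) = dnorm u.
Proof. by rewrite /dnorm linearNl linearNr opprK. Qed.

End dot_norm.

Section dot_ffun.
Context {R : realType} {W : lmodType R} (form : {dot W for idfun}) (d : nat).
Local Notation Wd := {ffun 'I_d -> W}.

Definition dot_ffun (w z : Wd) : R := \sum_(l < d) form (w l) (z l).

Let zmodl z : zmod_morphism (dot_ffun^~ z).
Proof.
move=> x y; rewrite /dot_ffun -sumrB; apply: eq_bigr => l _.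
by rewrite !ffunE linearBl.
Qed.

Let zmodr w : zmod_morphism (dot_ffun w).
Proof.
move=> x y; rewrite /dot_ffun -sumrB; apply: eq_bigr => l _.
by rewrite !ffunE linearBr.
Qed.

Let scall z : scalable_for *%R (dot_ffun^~ z).
Proof.
move=> a x; rewrite /dot_ffun mulr_sumr; apply: eq_bigr => l _.
by rewrite !ffunE linearZl_LR.
Qed.

Let scalr w : scalable_for (idfun \; *%R) (dot_ffun w).
Proof.
move=> a x; rewrite /dot_ffun /= mulr_sumr; apply: eq_bigr => l _.
by rewrite !ffunE linearZr_LR.
Qed.

HB.instance Definition _ := isBilinear.Build R Wd Wd R *%R (idfun \; *%R)
  dot_ffun zmodl zmodr scall scalr.

Let herm x y : dot_ffun x y = (-1) ^+ false * idfun (dot_ffun y x).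
Proof.
by rewrite expr0 mul1r; apply: eq_bigr => l _; rewrite dotC.
Qed.

HB.instance Definition _ :=
  isHermitianSesquilinear.Build R Wd false idfun dot_ffun herm.

Let pos u : u != 0 -> 0 < dot_ffun u u.
Proof.
move=> u0; rewrite lt0r sumr_ge0 ?andbT; last by move=> l _; exact: dot_ge0.
apply: contra u0; rewrite psumr_eq0; last by move=> l _; exact: dot_ge0.
move=> /allP ul; apply/eqP/ffunP => l; rewrite ffunE; apply/eqP.
have := ul l (mem_index_enum _); apply: contraLR => l0.
by rewrite gt_eqF// neq0_dnorm_gt0.
Qed.

HB.instance Definition _ := isDotProduct.Build R Wd dot_ffun pos.

End dot_ffun.

(* A measure on Omega is a Borel measure on R^d vanishing on the Borel sets that
   do not meet Omega. Finiteness is automatic, as the values lie in W; values on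
   non-Borel sets are irrelevant. *)
Record vmeasure (R : realType) (d : nat) (Omega : set 'rV[R]_d) (W : lmodType R)
    (form : {dot W for idfun}) := VMeasure {
  vm_fun :> set 'rV[R]_d -> W ;
  vm_sigma_additive : forall F : (set 'rV[R]_d)^nat,
    (forall i, measurable (F i)) -> trivIset setT F ->
    dnorm form (vm_fun (\bigcup_i F i) - \sum_(i < n) vm_fun (F i))
      @[n --> \oo] --> (0 : R) ;
  vm_support : forall A, measurable A -> A `&` Omega = set0 -> vm_fun A = 0 }.

Section vmeasure_operations.
Context {R : realType} {d : nat} {Omega : set 'rV[R]_d} {W : lmodType R}
  {form : {dot W for idfun}}.
Implicit Types mu nu : vmeasure Omega form.

Lemma vm_add_sigma_additive mu nu (F : (set 'rV[R]_d)^nat) :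
  (forall i, measurable (F i)) -> trivIset setT F ->
  dnorm form ((mu (\bigcup_i F i) + nu (\bigcup_i F i))
    - \sum_(i < n) (mu (F i) + nu (F i))) @[n --> \oo] --> (0 : R).
Proof.
move=> mF tF.
have := cvgD (vm_sigma_additive mu mF tF) (vm_sigma_additive nu mF tF).
rewrite addr0 => ub; apply: (squeeze_cvgr _ (cvg_cst 0) (ub _)).
apply: nearW => n; rewrite sqrtr_ge0/= big_split/= opprD addrACA.
exact: dnormD.
Qed.

Lemma vm_opp_sigma_additive mu (F : (set 'rV[R]_d)^nat) :
  (forall i, measurable (F i)) -> trivIset setT F ->
  dnorm form (- mu (\bigcup_i F i) - \sum_(i < n) - mu (F i))
    @[n --> \oo] --> (0 : R).
Proof.
move=> mF tF; under eq_fun do rewrite sumrN -dnormN opprD !opprK.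
exact: vm_sigma_additive.
Qed.

Lemma vm_add_support mu nu A : measurable A -> A `&` Omega = set0 ->
  mu A + nu A = 0.
Proof. by move=> mA A0; rewrite !vm_support// addr0. Qed.

Lemma vm_opp_support mu A : measurable A -> A `&` Omega = set0 -> - mu A = 0.
Proof. by move=> mA A0; rewrite vm_support// oppr0. Qed.

Definition vm_add mu nu : vmeasure Omega form :=
  VMeasure (@vm_add_sigma_additive mu nu) (@vm_add_support mu nu).

Definition vm_opp mu : vmeasure Omega form :=
  VMeasure (@vm_opp_sigma_additive mu) (@vm_opp_support mu).

Definition vm_sub mu nu := vm_add mu (vm_opp nu).

(* The signed measure <mu, u>. *)
Section component.
Context (mu : vmeasure Omega form) (u : W).

Definition vm_comp (A : set 'rV[R]_d) : \bar R := (form (mu A) u)%:E.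

Let vm_comp0 : vm_comp set0 = 0%E.
Proof. by rewrite /vm_comp vm_support ?set0I// linear0l. Qed.

Let vm_comp_fin A : measurable A -> vm_comp A \is a fin_num.
Proof. by []. Qed.

Let vm_comp_sigma_additive : semi_sigma_additive vm_comp.
Proof.
move=> F mF tF _.
set U := \bigcup_n F n.
have small : form (mu U - \sum_(i < n) mu (F i)) u @[n --> \oo] --> (0 : R).
  pose h n := dnorm form (mu U - \sum_(i < n) mu (F i)) * dnorm form u.
  have ub : h n @[n --> \oo] --> (0 : R).
    rewrite -(mul0r (dnorm form u)).
    by apply: cvgM; [exact: vm_sigma_additive|exact: cvg_cst].
  have lb : (- h n) @[n --> \oo] --> (0 : R) by rewrite -oppr0; exact: cvgN.
  apply: (squeeze_cvgr _ lb ub); apply: nearW => n.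
  by rewrite -ler_norml; exact: dot_CauchySchwarz.
have cvgr : (\sum_(0 <= i < n) form (mu (F i)) u) @[n --> \oo]
    --> form (mu U) u.
  rewrite -[X in _ --> X]subr0.
  have -> : (fun n => \sum_(0 <= i < n) form (mu (F i)) u) =
      (fun n => form (mu U) u - form (mu U - \sum_(i < n) mu (F i)) u).
    by apply/funext => n; rewrite linearBl opprB addrC subrK linear_sumlz big_mkord.
  by apply: cvgB => //; exact: cvg_cst.
rewrite /vm_comp (_ : (fun n => _) =
    EFin \o (fun n => \sum_(0 <= i < n) form (mu (F i)) u)).
  by apply: cvg_EFin => //; exact: nearW.
by apply/funext => n /=; rewrite sumEFin.
Qed.

HB.instance Definition _ :=
  isCharge.Build _ _ _ vm_comp vm_comp0 vm_comp_fin vm_comp_sigma_additive.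

End component.
End vmeasure_operations.


Section charge_integral.
Context {disp : measure_display} {T : measurableType disp} {R : realType}
  (nu : {charge set T -> \bar R}).

Let P := sval (cid (Hahn_decomposition nu)).
Let N := sval (cid (svalP (cid (Hahn_decomposition nu)))).

Let nuPN : hahn_decomposition nu P N :=
  svalP (cid (svalP (cid (Hahn_decomposition nu)))).

(* Jordan decomposition; the value does not depend on the chosen Hahn
   decomposition (P, N). *)
Definition charge_integral (D : set T) (f : T -> R) : R :=
  \int[jordan_pos nuPN]_(x in D) f x - \int[jordan_neg nuPN]_(x in D) f x.

End charge_integral.

Section continuous_functions_and_measures.
Context {R : realType} {d : nat} (Omega : set 'rV[R]_d) {W : lmodType R}
  (form : {dot W for idfun}).

(* Functions on Omega are functions on R^d whose values outside Omega are never
   used. *)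
Definition continuous_on (phi : 'rV[R]_d -> W) :=
  forall x, Omega x ->
    dnorm form (phi y - phi x) @[y --> within Omega (nbhs x)] --> (0 : R).

(* The pairing of phi with mu. Here and below e is meant to be an orthonormal
   basis; the value does not depend on which one. *)
Definition vintegral (e : seq W) (phi : 'rV[R]_d -> W)
    (mu : vmeasure Omega form) : R :=
  \sum_(b <- e)
    charge_integral (vm_comp mu b) Omega (fun x => form (phi x) b).

(* Total variation norm, by duality with the unit ball of C(Omega; W). *)
Definition tv_norm (e : seq W) (mu : vmeasure Omega form) : \bar R :=
  ereal_sup [set (vintegral e phi mu)%:E | phi in
    [set phi | continuous_on phi /\
               forall x, Omega x -> dnorm form (phi x) <= 1]].

End continuous_functions_and_measures.

Section calculus.
Context {R : realType} {d : nat}.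

Definition axis (l : 'I_d) : 'rV[R]_d := delta_mx 0 l.

Fixpoint Ck (k : nat) (f : 'rV[R]_d -> R) : Prop :=
  match k with
  | 0%N => continuous f
  | k'.+1 => continuous f /\
      forall l, (forall x, derivable f x (axis l)) /\ Ck k' ('D_(axis l) f)
  end.

Definition smooth (f : 'rV[R]_d -> R) := forall k, Ck k f.

Context (Omega : set 'rV[R]_d) {V : vectType R} (form : {dot V for idfun})
  (e : seq V).

Definition dot_pow : {dot {ffun 'I_d -> V} for idfun} := dot_ffun form (d := d).

(* The orthonormal basis of V^d induced by e. *)
Definition basis_pow : seq {ffun 'I_d -> V} :=
  [seq [ffun k => if k == l then b else 0] | l <- enum 'I_d, b <- e].

(* phi is in C^1(Omega; V) and g is its gradient: phi has partial derivatives in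
   the interior of Omega, and these extend continuously to g on Omega, which is
   the closure of its interior when it is convex with non-empty interior. *)
Definition C1_with_gradient (phi : 'rV[R]_d -> V)
    (g : 'rV[R]_d -> {ffun 'I_d -> V}) :=
  [/\ continuous_on Omega form phi, continuous_on Omega dot_pow g &
      forall x l b, Omega° x -> b \in e ->
        is_derive x (axis l) (fun y => form (phi y) b) (form (g x l) b)].

Definition vdiv (psi : 'rV[R]_d -> {ffun 'I_d -> V}) (x : 'rV[R]_d) : V :=
  \sum_(b <- e) (\sum_(l < d) 'D_(axis l) (fun y => form (psi y l) b) x) *: b.

(* C_c^oo(int Omega; V^d), the fields being extended by 0 to R^d. *)
Definition test_field (psi : 'rV[R]_d -> {ffun 'I_d -> V}) :=
  let supp := closure [set x | psi x != 0] in
  [/\ forall l b, b \in e -> smooth (fun x => form (psi x l) b),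
      compact supp & supp `<=` Omega°].

Definition gradient_norm (phi : 'rV[R]_d -> V) : \bar R :=
  ereal_sup [set (\int[lebesgue_rV R d]_(x in Omega)
                    (form (phi x) (vdiv psi x))%:E)%E | psi in
    [set psi | test_field psi /\
      (\int[lebesgue_rV R d]_(x in Omega) (dnorm dot_pow (psi x))%:E <= 1)%E]].

Local Notation M := (vmeasure Omega form).
Local Notation Md := (vmeasure Omega dot_pow).

(* div sigma = rho, weakly, with zero flux through the boundary of Omega. *)
Definition div_eq (sigma : Md) (rho : M) :=
  forall phi g, C1_with_gradient phi g ->
    - vintegral basis_pow g sigma = vintegral e phi rho.

Definition W1 (mu nu : M) : \bar R :=
  ereal_sup [set (vintegral e phi (vm_sub nu mu))%:E | phi in
    [set phi | continuous_on Omega form phi /\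
               (gradient_norm phi <= 1)%E]].

Definition T11 (lambda : R) (mu nu : M) : \bar R :=
  ereal_inf [set (W1 (vm_add mu delta) nu
                  + lambda%:E * tv_norm e delta)%E | delta in [set: M]].

End calculus.

Arguments vintegral {R d Omega W form} e phi mu.
Arguments tv_norm {R d Omega W form} e mu.
Arguments div_eq {R d Omega V form} e sigma rho.
Arguments W1 {R d Omega V form} e mu nu.
Arguments T11 {R d Omega V form} e lambda mu nu.
Arguments dot_pow {R} d {V} form.
Arguments basis_pow {R} d {V} e.

(* Main.v *)
(* Both sides are compared with the dual value
     D = sup { <phi, nu - mu> : phi in C^1, |grad phi| <= 1, |phi| <= lambda }.
   D <= T11: by the divergence theorem a C^1 function with |grad phi| <= 1
   is admissible in W1, and <phi, delta> <= lambda |delta| when |phi| <= lambda.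
   Attainment: on the pairs (grad phi, phi) in C(Omega; V^d) x C(Omega; V) the
   functional <phi, nu - mu> is dominated by D max(|grad phi|, |phi| / lambda).
   A Hahn-Banach extension splits, by the Riesz representation theorem, into
   measures sigma and delta with div sigma = mu - nu + delta and
   |sigma| + lambda |delta| <= D.
   T11 <= |sigma| + lambda |delta| for every competitor: testing the divergence
   constraint gives W1 (mu + delta) nu <= |sigma|, because a continuous phi with
   weak gradient bound 1 is a uniform limit of C^1 functions with the same bound;
   they are obtained by contracting Omega towards an interior ball and then
   convolving with a smooth kernel, which never leaves Omega. *)
Require Import Defs.
From HB Require Import structures.
From mathcomp Require Import all_boot all_order all_algebra.
From mathcomp Require Import sesquilinear.
From mathcomp Require Import all_classical all_reals all_analysis.
From mathcomp Require Import measurable_realfun ring lra.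

Set Implicit Arguments.
Unset Strict Implicit.
Unset Printing Implicit Defensive.

Import Order.TTheory GRing.Theory Num.Theory.
Import numFieldTopology.Exports numFieldNormedType.Exports.

Local Open Scope classical_set_scope.
Local Open Scope ring_scope.

(** The inequalities close a circle: the pair produced by Hahn-Banach is itself a competitor, so D,
    [T11] and the cost of this pair coincide. The norm max(|g|, |phi| / lambda) on pairs is chosen
    because its unit ball meets the gradient pairs exactly in the feasible set of D, while its dual
    norm is |sigma| + lambda |delta|: g and phi range over their balls independently. D involves
    only C^1 functions, the only ones that the divergence constraint sees, so approximation is
    confined to the bound of [T11] by a competitor. The obstacle there is the boundary: the gradient
    bound is tested only with fields compactly supported in the interior, yet the gradient of the
    approximation has to be bounded at every point of Omega. If Omega contains the ball of radius
    rho about x0, convexity puts the ball of radius eps rho about x0 + (1 - eps)(x - x0) into Omega,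
    even for x on the boundary. A kernel of smaller radius centred there, times any vector w, is a
    legitimate test field, and it reads off the component along w of the mollified gradient at x.
    The chain rule contributes the factor 1 - eps, so the bound 1 survives. *)

(** * Continuous real functions on a subset: algebra, measurability, integrability *)

Section within_continuous_real.
Context {R : realType} {T : topologicalType} (A : set T).
Implicit Types f g : T -> R.

Lemma within_cst (c : R) : {within A, continuous (fun=> c)}.
Proof. by move=> x; exact: cvg_cst. Qed.

Lemma within_add f g : {within A, continuous f} -> {within A, continuous g} ->
  {within A, continuous (fun x => f x + g x)}.
Proof. by move=> cf cg x; apply: (@cvgD _ _ _ (nbhs (x : subspace A))); [exact: cf|exact: cg]. Qed.

Lemma within_opp f : {within A, continuous f} -> {within A, continuous (fun x => - f x)}.
Proof. by move=> cf x; apply: (@cvgN _ _ _ (nbhs (x : subspace A))); exact: cf. Qed.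

Lemma within_sub f g : {within A, continuous f} -> {within A, continuous g} ->
  {within A, continuous (fun x => f x - g x)}.
Proof. by move=> cf cg; apply: within_add => //; exact: within_opp. Qed.

Lemma within_mul f g : {within A, continuous f} -> {within A, continuous g} ->
  {within A, continuous (fun x => f x * g x)}.
Proof. by move=> cf cg x; apply: (@cvgM _ _ (nbhs (x : subspace A))); [exact: cf|exact: cg]. Qed.

Lemma within_norm f : {within A, continuous f} -> {within A, continuous (fun x => `|f x|)}.
Proof. by move=> cf x; apply: (@cvg_norm _ _ _ (nbhs (x : subspace A))); exact: cf. Qed.

Lemma within_max f g : {within A, continuous f} -> {within A, continuous g} ->
  {within A, continuous (fun x => Num.max (f x) (g x))}.
Proof.
move=> cf cg x.
by apply: (@continuous_max R (subspace A) f g x); [exact: cf|exact: cg].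
Qed.

Lemma within_min f g : {within A, continuous f} -> {within A, continuous g} ->
  {within A, continuous (fun x => Num.min (f x) (g x))}.
Proof.
move=> cf cg x.
by apply: (@continuous_min R (subspace A) f g x); [exact: cf|exact: cg].
Qed.

Lemma within_sum (I : Type) (r : seq I) (f : I -> T -> R) :
  (forall i, {within A, continuous (f i)}) ->
  {within A, continuous (fun x => \sum_(i <- r) f i x)}.
Proof.
move=> cf; elim: r => [|i r ih].
  by under eq_fun do rewrite big_nil; exact: within_cst.
by under eq_fun do rewrite big_cons; exact: within_add.
Qed.

Lemma within_eq f g : (forall x, A x -> f x = g x) ->
  {within A, continuous f} -> {within A, continuous g}.
Proof. by move=> fg; apply: subspace_eq_continuous => x /set_mem; exact: fg. Qed.

Lemma compact_within_bounded f : compact A -> {within A, continuous f} ->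
  exists M : R, 0 <= M /\ forall x, A x -> `|f x| <= M.
Proof.
move=> cA cf; have [M [_ Mf]] := compact_bounded (continuous_compact cf cA).
exists (`|M| + 1); split => [|x Ax]; first by rewrite addr_ge0.
by apply: Mf; [rewrite ltr_pwDr// ler_norm|exists x].
Qed.

End within_continuous_real.

Section borel_rV.
Context {R : realType} {d : nat}.

Lemma open_measurable_rV (U : set 'rV[R]_d) : open U -> measurable U.
Proof. by move=> oU; apply: sub_sigma_algebra. Qed.

Lemma closed_measurable_rV (U : set 'rV[R]_d) : closed U -> measurable U.
Proof.
by move=> cU; rewrite -(setCK U); apply: measurableC; apply: open_measurable_rV; exact: closed_openC.
Qed.

Lemma compact_closed_rV (U : set 'rV[R]_d) : compact U -> closed U.
Proof. by apply: compact_closed; exact: norm_hausdorff. Qed.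

Lemma compact_measurable_rV (U : set 'rV[R]_d) : compact U -> measurable U.
Proof. by move=> /compact_closed_rV; exact: closed_measurable_rV. Qed.

Lemma measurable_within_continuous (A : set 'rV[R]_d) (f : 'rV[R]_d -> R) :
  measurable A -> {within A, continuous f} -> measurable_fun A f.
Proof.
move=> mA /continuousP cf; apply: (measurability _ (RGenOpens.measurableE R)).
move=> _ [_ [a [b ->] <-]].
have /cf/open_subspaceP[V oV VA] : open (`]a, b[%classic : set R) by exact: interval_open.
by rewrite setIC -VA; apply: measurableI => //; exact: open_measurable_rV.
Qed.

Lemma measurable_continuous_rV (A : set 'rV[R]_d) (f : 'rV[R]_d -> R) :
  continuous f -> measurable_fun A f.
Proof.
move=> cf; apply: measurable_funTS; apply: measurable_within_continuous => //.
exact: continuous_subspaceT.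
Qed.

Lemma continuous_coord (l : 'I_d) : continuous (fun x : 'rV[R]_d => x ord0 l).
Proof. by move=> x; exact: coord_continuous. Qed.

Lemma integrable_within_continuous (m : {measure set 'rV[R]_d -> \bar R})
    (A : set 'rV[R]_d) (f : 'rV[R]_d -> R) :
  (m A < +oo)%E -> compact A -> {within A, continuous f} ->
  m.-integrable A (EFin \o f).
Proof.
move=> mA cA cf; apply: measurable_bounded_integrable => //.
- exact: compact_measurable_rV.
- by apply: measurable_within_continuous => //; exact: compact_measurable_rV.
have [M [M0 fM]] := compact_within_bounded cA cf.
exists M; split => [|x Mx y Ay]; first exact: num_real.
by apply: le_trans (ltW Mx); exact: fM.
Qed.

End borel_rV.

(** * Hahn-Banach extension *)

Section hahn_banach.
Context {R : realType} {E : lmodType R}.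

Definition subspace_set (S : set E) :=
  S 0 /\ forall (a : R) x y, S x -> S y -> S (a *: x + y).

Definition linear_in (S : set E) (f : E -> R) :=
  forall (a : R) x y, S x -> S y -> f (a *: x + y) = a * f x + f y.

Context (S F : set E) (p f : E -> R).
Hypotheses (subS : subspace_set S) (subF : subspace_set F) (FS : F `<=` S).
Hypothesis flin : linear_in F f.
Hypothesis psub : forall x y, S x -> S y -> p (x + y) <= p x + p y.
Hypothesis ppos : forall (a : R) x, 0 <= a -> S x -> p (a *: x) = a * p x.
Hypothesis fp : forall x, F x -> f x <= p x.

(** Partial linear functionals are encoded by their graphs, so that the upper bound of a chain is a
    plain union. Single-valuedness is not among the clauses: it follows from the domination by
    [p]. *)
Definition dominated_graph (G : set (E * R)) :=
  [/\ (forall (a : R) x r y s, G (x, r) -> G (y, s) -> G (a *: x + y, a * r + s)),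
      (forall x r, G (x, r) -> S x /\ r <= p x) &
      (forall x, F x -> G (x, f x))].

Lemma linear_in0 (g : E -> R) (T : set E) : subspace_set T -> linear_in T g -> g 0 = 0.
Proof.
move=> [T0 _] /(_ (-1) 0 0 T0 T0); rewrite scaler0 addr0 mulN1r addrC subrr.
by move=> ->.
Qed.

(** Linearity puts (0, r - s) into the graph, and [p 0 = 0] then gives r <= s; the roles of r and s
    are symmetric. *)
Lemma dominated_graph_fun G x r s : dominated_graph G -> G (x, r) -> G (x, s) -> r = s.
Proof.
move=> [Glin Gp _].
wlog suff h : r s / G (x, r) -> G (x, s) -> r <= s.
  by move=> Gr Gs; apply/eqP; rewrite eq_le; apply/andP; split; apply: h.
move=> Gr Gs; have := Glin (-1) _ _ _ _ Gs Gr.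
rewrite scaleN1r addNr => /Gp[S0].
have := ppos (lexx 0) S0; rewrite scale0r mul0r => ->; lra.
Qed.

Lemma dominated_graph_extend G v : dominated_graph G -> S v ->
  exists G', [/\ dominated_graph G', G `<=` G' & exists r, G' (v, r)].
Proof.
move=> [Glin Gp Gf] Sv.
have Gscale (a : R) x r : G (x, r) -> G (a *: x, a * r).
  move=> Gx; have := Glin (a - 1) _ _ _ _ Gx Gx.
  by rewrite scalerBl scale1r subrK mulrBl mul1r subrK.
have [S0 Slin] := subS.
have SN x y : S x -> S y -> S (x - y).
  by move=> Sx Sy; rewrite addrC -scaleN1r; exact: Slin.
have SD x y : S x -> S y -> S (x + y).
  by move=> Sx Sy; rewrite -(scale1r x); exact: Slin.
have SZ (a : R) x : S x -> S (a *: x).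
  by move=> Sx; rewrite -(addr0 (a *: x)); exact: Slin.
have G0 : G (0, 0).
  have := Gf _ (proj1 subF); by rewrite (linear_in0 subF flin).
pose A := [set z | exists x r, G (x, r) /\ z = r - p (x - v)].
have AU x r y s : G (x, r) -> G (y, s) -> r - p (x - v) <= p (y + v) - s.
  move=> Gx Gy.
  have [_ rs] : S (x + y) /\ r + s <= p (x + y).
    by apply: Gp; have := Glin 1 _ _ _ _ Gx Gy; rewrite scale1r mul1r.
  have := psub (SN _ _ (Gp _ _ Gx).1 Sv) (SD _ _ (Gp _ _ Gy).1 Sv).
  rewrite addrACA addNr addr0; lra.
have A0 : A !=set0 by exists (0 - p (0 - v)), 0, 0.
have Aub : has_ubound A.
  by exists (p (0 + v) - 0) => _ [x [r [Gx ->]]]; exact: AU.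
(* The value at [v] may be any number between the lower bounds [r - p (x - v)] and the upper bounds
   [p (y + v) - s]; [AU] says that these never cross. The first kind serves the negative multiples
   of [v], the second the positive ones. *)
pose c := sup A.
have c_lb x r : G (x, r) -> r - p (x - v) <= c.
  by move=> Gx; apply: ub_le_sup => //; exists x, r.
have c_ub y s : G (y, s) -> c <= p (y + v) - s.
  by move=> Gy; apply: ge_sup => // _ [x [r [Gx ->]]]; exact: AU.
exists [set z | exists x r (t : R), G (x, r) /\ z = (x + t *: v, r + t * c)].
split; last 2 first.
- by move=> [x r] Gx; exists x, r, 0; rewrite scale0r mul0r !addr0.
- by exists (0 + 1 * c); exists 0, 0, 1; split; rewrite ?scale1r ?[0 + v]add0r.
split.
- move=> a _ _ _ _ [x [r [t [Gx [-> ->]]]]] [y [s [u [Gy [-> ->]]]]].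
  exists (a *: x + y), (a * r + s), (a * t + u); split; first exact: Glin.
  congr pair; last by ring.
  by rewrite scalerDr scalerDl scalerA addrACA.
- move=> _ _ [x [r [t [Gx [-> ->]]]]]; split.
    by rewrite addrC; apply: Slin => //; exact: (Gp _ _ Gx).1.
  have Sx := (Gp _ _ Gx).1.
  have [t0|t0|->] := ltgtP t 0.
  + have u0 : 0 < - t by lra.
    have := c_lb _ _ (Gscale (- t)^-1 _ _ Gx).
    have -> : x + t *: v = (- t) *: ((- t)^-1 *: x - v).
      by rewrite scalerBr scalerA divff ?gt_eqF// scale1r scaleNr opprK.
    rewrite (ppos (ltW u0)); last by apply: SN => //; exact: SZ.
    move=> /(ler_wpM2l (ltW u0)); rewrite mulrBr mulrA divff ?gt_eqF// mul1r; lra.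
  + have := c_ub _ _ (Gscale t^-1 _ _ Gx).
    have -> : x + t *: v = t *: (t^-1 *: x + v).
      by rewrite scalerDr scalerA divff ?gt_eqF// scale1r.
    rewrite (ppos (ltW t0)); last by apply: SD => //; exact: SZ.
    move=> /(ler_wpM2l (ltW t0)); rewrite mulrBr mulrA divff ?gt_eqF// mul1r; lra.
  + by rewrite scale0r mul0r !addr0; exact: (Gp _ _ Gx).2.
- by move=> x Fx; exists x, (f x), 0; rewrite scale0r mul0r !addr0; split => //; exact: Gf.
Qed.

Theorem hahn_banach : exists g : E -> R,
  [/\ linear_in S g, (forall x, F x -> g x = f x) & forall x, S x -> g x <= p x].
Proof.
pose P G := G = set0 \/ dominated_graph G.
have [C CP Ctot|A [PA Amax]] := @Zorn_bigcup _ P.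
  have [[G0 [CG0 dG0]]|noG] := pselect (exists G, C G /\ dominated_graph G); last first.
    left; apply/seteqP; split => // z [G CG Gz].
    case: (CP _ CG) => [G0|dG]; first by rewrite G0 in Gz.
    by apply: noG; exists G.
  have dG G z : C G -> G z -> dominated_graph G.
    by move=> /CP[->|].
  right; split.
  - move=> a x r y s [G CG Gx] [H CH Hy].
    have [GH|HG] := Ctot _ _ CG CH.
      exists H => //; have [Hl _ _] := dG _ _ CH Hy.
      by apply: Hl => //; exact: GH.
    exists G => //; have [Hl _ _] := dG _ _ CG Gx.
    by apply: Hl => //; exact: HG.
  - by move=> x r [G CG Gx]; have [_ + _] := dG _ _ CG Gx; exact.
  - by move=> x Fx; exists G0 => //; have [_ _] := dG0; exact.
have dF : dominated_graph [set z | F z.1 /\ z.2 = f z.1].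
  split => //= [a x r y s [Fx ->] [Fy ->]|x r [Fx ->]].
    by split; [exact: (proj2 subF)|rewrite flin].
  by split; [exact: FS|exact: fp].
have dA : dominated_graph A.
  case: PA => [A0|//]; exfalso; apply: (Amax _ _ (or_intror dF)); rewrite A0.
  split => //; move=> /(_ (0, f 0)); apply; split => //=; exact: (proj1 subF).
have [Alin Ap Af] := dA.
have Atot v : S v -> exists r, A (v, r).
  move=> Sv; have [G' [dG' AG' [r G'v]]] := dominated_graph_extend dA Sv.
  have [G'A|nG'A] := pselect (G' `<=` A); first by exists r; exact: G'A.
  by exfalso; apply: (Amax G'); [split|right].
have /choice[g gP] : forall v, exists r, S v -> A (v, r).
  move=> v; have [Sv|nSv] := pselect (S v); last by exists 0.
  by have [r Ar] := Atot _ Sv; exists r.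
exists g; split.
- move=> a x y Sx Sy; apply: (dominated_graph_fun dA (gP _ (proj2 subS _ _ _ Sx Sy))).
  by apply: Alin; exact: gP.
- by move=> x Fx; apply: (dominated_graph_fun dA (gP _ (FS Fx))); exact: Af.
- by move=> x Sx; exact: (Ap _ _ (gP _ Sx)).2.
Qed.

End hahn_banach.

(** * Riesz representation of positive functionals *)

Section positive_functional.
Context {R : realType} {d : nat} (Omega : set 'rV[R]_d).
Local Notation T := 'rV[R]_d.
Hypothesis cptO : compact Omega.

Definition nonneg_within (f : T -> R) :=
  {within Omega, continuous f} /\ forall x, Omega x -> 0 <= f x.

Context (P : (T -> R) -> R).
Hypothesis Padd : forall f g, nonneg_within f -> nonneg_within g ->
  P (fun x => f x + g x) = P f + P g.
Hypothesis Phom : forall (c : R) f, 0 <= c -> nonneg_within f ->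
  P (fun x => c * f x) = c * P f.
Hypothesis Pmon : forall f g, nonneg_within f -> nonneg_within g ->
  (forall x, Omega x -> f x <= g x) -> P f <= P g.

(* Daniell's upper measure: increasing sequences of continuous functions whose
   limit is at least 1 on A play the role of coverings of A. *)
Definition majorized (A : set T) (S : R) := exists F : nat -> T -> R,
  [/\ forall n, nonneg_within (F n),
      forall n x, Omega x -> F n x <= F n.+1 x,
      forall n, P (F n) <= S &
      forall x, A x -> Omega x -> forall c, c < 1 -> exists n, c < F n x].

Definition upper_measure (A : set T) : \bar R :=
  ereal_inf [set S%:E | S in majorized A].

Lemma nonneg_within_cst (c : R) : 0 <= c -> nonneg_within (fun=> c).
Proof. by move=> c0; split => //; exact: within_cst. Qed.

Lemma nonneg_within_add f g : nonneg_within f -> nonneg_within g ->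
  nonneg_within (fun x => f x + g x).
Proof.
move=> [cf f0] [cg g0]; split; first exact: within_add.
by move=> x Ox; rewrite addr_ge0 ?f0 ?g0.
Qed.

Lemma nonneg_within_mul f g : nonneg_within f -> nonneg_within g ->
  nonneg_within (fun x => f x * g x).
Proof.
move=> [cf f0] [cg g0]; split; first exact: within_mul.
by move=> x Ox; rewrite mulr_ge0 ?f0 ?g0.
Qed.

Lemma nonneg_within_sum (I : Type) (r : seq I) (f : I -> T -> R) :
  (forall i, nonneg_within (f i)) -> nonneg_within (fun x => \sum_(i <- r) f i x).
Proof.
move=> f0; split; first by apply: within_sum => i; exact: (f0 i).1.
by move=> x Ox; apply: sumr_ge0 => i _; exact: (f0 i).2.
Qed.

Lemma positive0 : P (fun=> 0) = 0.
Proof.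
have c0 := nonneg_within_cst (lexx 0).
by have := Phom (lexx 0) c0; under eq_fun do rewrite mulr0; rewrite [RHS]mul0r.
Qed.

Lemma positive_ge0 f : nonneg_within f -> 0 <= P f.
Proof.
move=> f0; rewrite -positive0; apply: Pmon => //; last exact: (proj2 f0).
exact: nonneg_within_cst.
Qed.

Lemma positive_sum (I : Type) (r : seq I) (f : I -> T -> R) :
  (forall i, nonneg_within (f i)) ->
  P (fun x => \sum_(i <- r) f i x) = \sum_(i <- r) P (f i).
Proof.
move=> f0; elim: r => [|i r ih].
  by under eq_fun do rewrite big_nil; rewrite big_nil positive0.
under eq_fun do rewrite big_cons.
by rewrite big_cons Padd ?ih//; exact: nonneg_within_sum.
Qed.

Lemma majorized_mono (F : nat -> T -> R) : (forall n x, Omega x -> F n x <= F n.+1 x) ->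
  forall m n x, (m <= n)%N -> Omega x -> F m x <= F n x.
Proof.
move=> ndF m n x /subnK <- Ox; elim: (n - m)%N => [//|k ih].
by rewrite addSn; exact: le_trans ih (ndF _ _ Ox).
Qed.

Lemma upper_measure_ge0 A : (0 <= upper_measure A)%E.
Proof.
apply: le_ereal_inf_tmp => _ [S [F [F0 _ FS _]] <-]; rewrite lee_fin.
exact: le_trans (positive_ge0 (F0 0%N)) (FS 0%N).
Qed.

Lemma upper_measure_le A f : nonneg_within f ->
  (forall x, A x -> Omega x -> 1 <= f x) -> (upper_measure A <= (P f)%:E)%E.
Proof.
move=> f0 Af; apply: ereal_inf_lbound; exists (P f) => //; exists (fun=> f).
by split => // x Ax Ox c c1; exists 0%N; exact: lt_le_trans c1 (Af _ Ax Ox).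
Qed.

Lemma upper_measure_disjoint A : A `&` Omega = set0 -> upper_measure A = 0%E.
Proof.
move=> A0; apply/eqP; rewrite eq_le upper_measure_ge0 andbT.
rewrite -[leRHS]/(0%:E) -positive0; apply: upper_measure_le.
  exact: nonneg_within_cst.
by move=> x Ax Ox; have : (A `&` Omega) x by []; rewrite A0.
Qed.

Lemma upper_measure_lty A : (upper_measure A < +oo)%E.
Proof.
apply: le_lt_trans (ltry (P (fun=> 1))); apply: upper_measure_le => //.
exact: nonneg_within_cst.
Qed.

Lemma upper_measure_fin A : upper_measure A \is a fin_num.
Proof. by rewrite ge0_fin_numE ?upper_measure_lty ?upper_measure_ge0. Qed.

Lemma upper_measure_majorized A (e : R) : 0 < e ->
  exists2 S, majorized A S & S <= fine (upper_measure A) + e.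
Proof.
move=> e0; have := lb_ereal_inf_adherent e0 (upper_measure_fin A).
move=> [_ [S AS <-]] Se; exists S => //.
by rewrite -lee_fin EFinD fineK ?upper_measure_fin// ltW.
Qed.

Lemma upper_measure_monotone : {homo upper_measure : A B / A `<=` B >-> (A <= B)%E}.
Proof.
move=> A B AB; apply: ereal_inf_le_tmp => _ [S [F [F0 ndF FS BF]] <-].
by exists S => //; exists F; split => // x /AB; exact: BF.
Qed.

Lemma upper_measure_sigma_subadditive : sigma_subadditive upper_measure.
Proof.
move=> A; apply/lee_addgt0Pr => e e0.
have e2 i : 0 < e / (2 ^ i.+1)%:R :> R by rewrite divr_gt0// ltr0n expn_gt0.
have /choice[S SP] : forall i, exists S, majorized (A i) S /\
    S <= fine (upper_measure (A i)) + e / (2 ^ i.+1)%:R.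
  by move=> i; have [S ? ?] := upper_measure_majorized (A i) (e2 i); exists S.
have [F FP] := choice (fun i => (SP i).1).
apply: le_trans (epsilon_trick _ _ (ltW e0)); last first.
  by move=> i; exact: upper_measure_ge0.
have F0 i n : nonneg_within (F i n) by have [] := FP i.
have ndF i : forall m n x, (m <= n)%N -> Omega x -> F i m x <= F i n x.
  by have [_ ndF _ _] := FP i; exact: majorized_mono.
(* Diagonal sequence: only the first n coverings enter the n-th term, so each term is a finite sum
   of continuous functions, and passing from n to n + 1 raises every old summand and adds a
   nonnegative one. *)
pose G n x := \sum_(i <- iota 0 n) F i n x.
have G0 n : nonneg_within (G n) by apply: nonneg_within_sum => i; exact: F0.
have PG n : ((P (G n))%:E <= \sum_(0 <= i <oo)
    (upper_measure (A i) + (e / (2 ^ i.+1)%:R)%:E))%E.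
  rewrite positive_sum// -sumEFin.
  apply: (@le_trans _ _ (\sum_(i <- iota 0 n)
      (upper_measure (A i) + (e / (2 ^ i.+1)%:R)%:E))%E).
    apply: lee_sum => i _; rewrite -(fineK (upper_measure_fin (A i))) -EFinD lee_fin.
    apply: le_trans (SP i).2; have [_ _ + _] := FP i; exact.
  have -> : iota 0 n = index_iota 0 n by rewrite /index_iota subn0.
  apply: nneseries_lim_ge => i _ _.
  by rewrite adde_ge0 ?upper_measure_ge0// lee_fin ltW.
(* Bounds in [majorized] are real numbers, so the case of an infinite series, where nothing has to
   be shown, is set apart. *)
have [fin|/negP infin] := boolP ((\sum_(0 <= i <oo)
    (upper_measure (A i) + (e / (2 ^ i.+1)%:R)%:E))%E \is a fin_num); last first.
  move: infin; rewrite ge0_fin_numE; last first.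
    by apply: nneseries_ge0 => i _ _; rewrite adde_ge0 ?upper_measure_ge0// lee_fin ltW.
  by move=> /negP; rewrite -leNgt leye_eq => /eqP ->; rewrite leey.
rewrite -(fineK fin); apply: ereal_inf_lbound; eexists; last reflexivity.
exists G; split => //.
- move=> n x Ox; have iotaSr : iota 0 n.+1 = iota 0 n ++ [:: n] by rewrite -addn1 iotaD.
  rewrite /G iotaSr big_cat/= big_seq1.
  apply: ler_wpDr; first exact: (F0 _ _).2.
  by apply: ler_sum => i _; exact: ndF.
- by move=> n; rewrite -lee_fin fineK.
move=> x [i _ Aix] Ox c c1; have [_ _ _ /(_ _ Aix Ox _ c1)[n cF]] := FP i.
exists (maxn n i.+1); rewrite /G.
apply: lt_le_trans cF _.
apply: (@le_trans _ _ (F i (maxn n i.+1) x)).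
  by apply: ndF => //; exact: leq_maxl.
rewrite (bigD1_seq i) ?iota_uniq//=; last by rewrite mem_iota/= leq_maxr.
by rewrite lerDl sumr_ge0// => j _; exact: (F0 _ _).2.
Qed.

HB.instance Definition _ := isOuterMeasure.Build R T upper_measure
  (upper_measure_disjoint (set0I Omega)) upper_measure_ge0 upper_measure_monotone
  upper_measure_sigma_subadditive.

(** The continuous cut-offs [h n] increase to the indicator of U = {a < f}. If the sequence F
    majorizes X at cost S, then [F n * h n] majorizes the part of X inside U, and [F m * (1 - h n)]
    with n fixed majorizes the part outside. Additivity of P makes the two costs add up to at most
    S. *)
Lemma caratheodory_gt (f : T -> R) (a : R) : {within Omega, continuous f} ->
  upper_measure.-caratheodory [set x | a < f x].
Proof.
move=> cf; apply: le_caratheodory_measurable => X.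
set U := [set x | a < f x].
change (upper_measure (X `&` U) + upper_measure (X `&` ~` U) <= upper_measure X)%E.
pose h (n : nat) x := Num.min 1 (Num.max 0 (n%:R * (f x - a))).
have h01 n x : 0 <= h n x <= 1.
  by rewrite /h le_min ler01 le_max lexx/= ge_min lexx.
have ch n : {within Omega, continuous (h n)}.
  apply: within_min; first exact: within_cst.
  apply: within_max; first exact: within_cst.
  apply: within_mul; first exact: within_cst.
  by apply: within_sub => //; exact: within_cst.
have h0 n : nonneg_within (h n).
  by split => // x _; case/andP: (h01 n x).
have h1 n : nonneg_within (fun x => 1 - h n x).
  split; first by apply: within_sub => //; exact: within_cst.
  by move=> x _; rewrite subr_ge0; case/andP: (h01 n x).
have ndh n x : h n x <= h n.+1 x.
  rewrite /h; have [fa|fa] := leP (f x) a.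
    have M m : Num.max 0 (m%:R * (f x - a)) = 0 :> R.
      by apply/max_idPl; rewrite mulr_ge0_le0// subr_le0.
    by rewrite !M.
  rewrite le_min !ge_min lexx/=; apply/orP; right.
  rewrite ge_max le_max lexx/= le_max -natr1 mulrDl mul1r.
  by apply/orP; right; rewrite lerDl subr_ge0 ltW.
apply/lee_addgt0Pr => e e0.
have [S [F [F0 ndF FS XF]] Se] := upper_measure_majorized X e0.
apply: (@le_trans _ _ S%:E); last first.
  by rewrite -(fineK (upper_measure_fin X)) -EFinD lee_fin.
have ndF' := majorized_mono ndF.
set A := X `&` _; set B := X `&` _.
have key n : P (fun x => F n x * h n x) <= S - fine (upper_measure B).
  rewrite lerBrDr -lerBrDl -lee_fin fineK ?upper_measure_fin//.
  apply: ereal_inf_lbound; eexists; last reflexivity.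
  (* The cut-off is frozen at n because [1 - h n] decreases in n. The index [maxn n m] keeps the
     sequence above [F n], which is what the comparison with [P (F n * h n)] requires. *)
  exists (fun m x => F (maxn n m) x * (1 - h n x)); split.
  - by move=> m; exact: nonneg_within_mul.
  - move=> m x Ox; apply: ler_wpM2r; first exact: (h1 _).2.
    by apply: ndF' => //; rewrite geq_max leq_maxl/= leq_max leqnSn orbT.
  - move=> m; rewrite lerBrDl.
    apply: (@le_trans _ _ (P (fun x => F (maxn n m) x * h n x) +
       P (fun x => F (maxn n m) x * (1 - h n x)))).
      rewrite lerD2r; apply: Pmon; [exact: nonneg_within_mul..|move=> x Ox].
      by apply: ler_wpM2r; [exact: (h0 _).2|apply: ndF' => //; exact: leq_maxl].
    rewrite -Padd; [|exact: nonneg_within_mul..].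
    by under eq_fun do rewrite -mulrDr addrC subrK mulr1.
  - move=> x [Xx /negP fa] Ox c c1; have [m cm] := XF _ Xx Ox _ c1; exists m.
    have -> : h n x = 0.
      rewrite /h; have -> : Num.max 0 (n%:R * (f x - a)) = 0 :> R.
        by apply/max_idPl; rewrite mulr_ge0_le0// subr_le0 leNgt.
      by apply/min_idPr.
    by rewrite subr0 mulr1; apply: lt_le_trans cm _; apply: ndF' => //; exact: leq_maxr.
rewrite -leeBrDr ?upper_measure_fin//.
rewrite -(fineK (upper_measure_fin B)) -EFinB; apply: ereal_inf_lbound.
eexists; last reflexivity.
exists (fun n x => F n x * h n x); split => //.
- by move=> n; exact: nonneg_within_mul.
- move=> n x Ox; apply: ler_pM => //; [exact: (F0 _).2|by case/andP: (h01 n x)|exact: ndF].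
- move=> x [Xx /= fa] Ox c c1; have [n cn] := XF _ Xx Ox _ c1.
  have [m /= ma] : exists m : nat, 1 <= m%:R * (f x - a).
    exists (Num.trunc (f x - a)^-1).+1.
    rewrite -ler_pdivrMr ?subr_gt0// mul1r.
    have := truncnS_gt (f x - a)^-1; exact: ltW.
  exists (maxn n m).
  have -> : h (maxn n m) x = 1.
    apply/min_idPl; rewrite le_max; apply/orP; right.
    apply: le_trans ma _; apply: ler_wpM2r; first by rewrite subr_ge0 ltW.
    by rewrite ler_nat leq_maxr.
  by rewrite mulr1; apply: lt_le_trans cn _; apply: ndF' => //; exact: leq_maxl.
Qed.

(** The identity is measurable from the Caratheodory sets to the Borel sets: its coordinates are
    measurable by [caratheodory_gt], and [rV_of_tuple], which is measurable for the Borel sets,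
    rebuilds a point from its coordinates. *)
Lemma caratheodory_borel (A : set T) : measurable A -> upper_measure.-caratheodory A.
Proof.
move=> mA.
pose CT := caratheodory_type upper_measure.
pose coords (x : CT) : d.-tuple (measurableTypeR R) := [tuple (x : T) ord0 i | i < d].
have mc : measurable_fun [set: CT] coords.
  apply/measurable_fun_tnthP => i.
  rewrite (_ : _ \o _ = fun x : CT => (x : T) ord0 i); last first.
    by apply/funext => x /=; rewrite tnth_mktuple.
  apply: (measurability _ (RGenOInfty.measurableE R)).
  move=> _ [_ [a ->] <-]; rewrite setTI.
  rewrite (_ : _ @^-1` _ = [set x : T | a < x ord0 i]); last first.
    by apply/seteqP; split => x /=; rewrite in_itv/= andbT.
  apply: caratheodory_gt; apply: continuous_subspaceT; exact: continuous_coord.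
have := measurableT_comp (@measurable_rV_of_tuple R d) mc measurableT mA.
rewrite setTI (_ : _ @^-1` A = A)//.
by apply/seteqP; split => x /=; rewrite /rV_of_tuple (_ : \row_i _ = x)//;
  apply/rowP => i; rewrite mxE tnth_mktuple.
Qed.

Definition riesz_measure : set T -> \bar R := upper_measure.

Let riesz_measure_sigma_additive : semi_sigma_additive riesz_measure.
Proof.
move=> F mF tF mUF.
apply: (@caratheodory_measure_sigma_additive R T upper_measure) => //.
- by move=> i; exact: caratheodory_borel.
- exact: caratheodory_borel.
Qed.

HB.instance Definition _ := isMeasure.Build _ T R riesz_measure
  (upper_measure_disjoint (set0I Omega)) upper_measure_ge0 riesz_measure_sigma_additive.

Let riesz_measure_fin : fin_num_fun riesz_measure.
Proof. by move=> A mA; exact: upper_measure_fin. Qed.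

HB.instance Definition _ := Measure_isFinite.Build _ T R riesz_measure riesz_measure_fin.

(* Dini's theorem: majorizing sequences are uniformly close to g on Omega. *)
Lemma positive_le_upper_measure (U : set T) g : nonneg_within g ->
  (forall x, Omega x -> g x <= 1) -> (forall x, Omega x -> ~ U x -> g x <= 0) ->
  P g <= fine (upper_measure U).
Proof.
move=> g0 g1 gU; rewrite -lee_fin fineK ?upper_measure_fin//.
apply: le_ereal_inf_tmp => _ [S [F [F0 ndF FS UF]] <-]; rewrite lee_fin.
have P1 : 0 <= P (fun=> 1) by apply: positive_ge0; exact: nonneg_within_cst.
apply/ler_addgt0Pr => e' e'0.
pose e := e' / (P (fun=> 1) + 1).
have e0 : 0 < e by rewrite divr_gt0// ltr_wpDl.
have eP : e * P (fun=> 1) <= e'.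
  by rewrite /e mulrAC ler_pdivrMr ?ltr_wpDl// ler_pM2l// lerDl.
have /compact_near_coveringP ncO := cptO.
have [N _ NO] : \forall n \near \oo, Omega `<=` [set x | Omega x -> g x - e < F n x].
  apply: (ncO _ _ (fun n x => Omega x -> g x - e < F n x)) => x Ox.
  have [N FN] : exists N, g x - e < F N x.
    have [Ux|nUx] := pselect (U x); last first.
      by exists 0%N; apply: lt_le_trans ((F0 0%N).2 _ Ox); have := gU _ Ox nUx; lra.
    by apply: UF => //; have := g1 _ Ox; lra.
  have /subspace_continuousP/(_ _ Ox) cgF : {within Omega, continuous (fun x => g x - F N x)}.
    by apply: within_sub; [exact: g0.1|exact: (F0 N).1].
  have gFN : g x - F N x < e by lra.
  have nx : \forall x' \near x, Omega x' -> g x' - F N x' < e.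
    exact: (cgF _ (open_nbhs_nbhs (conj (@open_lt R e) gFN))).
  exists ([set x' | Omega x' -> g x' - F N x' < e], [set n | (N <= n)%N]).
    by split => //=; exists N.
  move=> [x' n] /= [gF' Nn] Ox'; have := gF' Ox'.
  have : F N x' <= F n x' by apply: (majorized_mono ndF).
  lra.
apply: le_trans (_ : P (F N) + P (fun=> e * 1) <= _); last first.
  apply: lerD => //.
  by rewrite (@Phom e (fun=> 1)) ?(ltW e0)//; exact: nonneg_within_cst ler01.
have ce : nonneg_within (fun=> e * 1) by apply: nonneg_within_cst; rewrite mulr1 ltW.
rewrite -Padd//; apply: Pmon => //; first exact: nonneg_within_add.
by move=> x Ox; have /= := NO N (leqnn N) x Ox Ox; lra.
Qed.

Lemma measurable_gt (f : T -> R) (a : R) : {within Omega, continuous f} ->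
  measurable (Omega `&` [set x | a < f x]).
Proof.
move=> cf; have mO := compact_measurable_rV cptO.
have := measurable_within_continuous mO cf mO (measurable_itv `]a, +oo[).
rewrite (_ : _ @^-1` _ = [set x | a < f x])//.
by apply/seteqP; split => x /=; rewrite in_itv/= andbT.
Qed.

Lemma riesz_integrable f : {within Omega, continuous f} ->
  riesz_measure.-integrable Omega (EFin \o f).
Proof.
move=> cf; apply: integrable_within_continuous => //; exact: upper_measure_lty.
Qed.

(** Layer-cake argument, by induction on the number N of layers of height delta. The bottom layer
    min(f, delta) costs at most delta times the measure of {0 < f}, while its integral is at least
    delta times the measure of {delta < f}; the latter is the error left by the remaining layers.
    The errors telescope, and only that of the bottom layer survives. *)
Lemma riesz_le_approx (delta : R) (N : nat) f : 0 < delta -> nonneg_within f ->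
  (forall x, Omega x -> f x <= N%:R * delta) ->
  P f <= \int[riesz_measure]_(x in Omega) f x +
         delta * fine (riesz_measure (Omega `&` [set x | 0 < f x])).
Proof.
move=> d0; have mO := compact_measurable_rV cptO.
elim: N f => [|N ih] f f0 fN.
  have -> : P f = 0.
    rewrite -positive0; apply/eqP; rewrite eq_le.
    have c0 := nonneg_within_cst (lexx 0).
    apply/andP; split; apply: Pmon => //; last exact: (proj2 f0).
    by move=> x Ox; have := fN _ Ox; rewrite mul0r.
  rewrite addr_ge0//; first by apply: Rintegral_ge0; exact: f0.2.
  by apply: mulr_ge0; [exact: ltW|exact: fine_ge0].
pose f1 x := Num.min (f x) delta; pose f2 x := Num.max (f x - delta) 0.
have c1 : {within Omega, continuous f1} by apply: within_min; [exact: f0.1|exact: within_cst].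
have c2 : {within Omega, continuous f2}.
  by apply: within_max; [apply: within_sub; [exact: f0.1|exact: within_cst]|exact: within_cst].
have p1 : nonneg_within f1.
  by split => // x Ox; rewrite le_min f0.2//= ltW.
have p2 : nonneg_within f2.
  by split => // x Ox; rewrite le_max lexx orbT.
have fE : f = fun x => f1 x + f2 x.
  apply/funext => x; rewrite /f1 /f2; have [fd|fd] := leP (f x) delta.
    by rewrite (max_idPr _) ?addr0// subr_le0.
  by rewrite (max_idPl _) ?subr_ge0 ?ltW// addrC subrK.
set U := Omega `&` _.
have le1 : P f1 <= delta * fine (riesz_measure U).
  have -> : f1 = fun x => delta * (delta^-1 * f1 x).
    by apply/funext => x; rewrite mulrA divff ?mul1r// gt_eqF.
  have di : 0 <= delta^-1 by rewrite invr_ge0 ltW.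
  have p1' : nonneg_within (fun x => delta^-1 * f1 x).
    split; first by apply: within_mul => //; exact: within_cst.
    by move=> x Ox; rewrite mulr_ge0// p1.2.
  rewrite (@Phom delta (fun x => delta^-1 * f1 x)) ?(ltW d0)//.
  apply: ler_wpM2l; first exact: ltW.
  apply: positive_le_upper_measure => // x Ox.
    by rewrite mulrC ler_pdivrMr// mul1r /f1 ge_min lexx orbT.
  move=> nU; rewrite pmulr_rle0 ?invr_gt0// /f1 ge_min.
  by apply/orP; left; rewrite leNgt; apply/negP => fx; apply: nU.
have le2 := ih f2 p2.
have U2 : Omega `&` [set x | 0 < f2 x] = Omega `&` [set x | delta < f x].
  apply/seteqP; split => x /= [Ox]; rewrite /f2 lt_max ltxx orbF subr_gt0 //.
rewrite U2 in le2.
have mU2 := measurable_gt delta f0.1.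
set W := Omega `&` [set x | delta < f x] in mU2 le2 *.
have OW : Omega `&` W = W by rewrite /W setIA setIid.
have i1 : delta * fine (riesz_measure W) <= \int[riesz_measure]_(x in Omega) f1 x.
  rewrite -Rintegral_cst// -[X in \int[_]_(x in X) _]OW Rintegral_mkcondr.
  apply: le_Rintegral => //; last 2 first.
  - exact: riesz_integrable.
  - move=> x Ox; rewrite patchE; case: ifPn => [|_]; last exact: p1.2.
    by rewrite inE /f1 /= => -[_ dx]; rewrite (min_idPr (ltW dx)).
  rewrite -restrict_EFin; apply/(@integrable_restrict _ _ _ _ W) => //.
  by rewrite OW; exact: finite_measure_integrable_cst.
have -> : \int[riesz_measure]_(x in Omega) f x =
    \int[riesz_measure]_(x in Omega) f1 x + \int[riesz_measure]_(x in Omega) f2 x.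
  by rewrite fE RintegralD//; exact: riesz_integrable.
rewrite {1}fE Padd//.
have : P f2 <= \int[riesz_measure]_(x in Omega) f2 x +
    delta * fine (riesz_measure W).
  apply: le2 => x Ox; rewrite /f2 ge_max lerBlDr; apply/andP; split.
    by have := fN _ Ox; rewrite -natr1 mulrDl mul1r.
  by apply: mulr_ge0; [exact: ler0n|exact: ltW].
by move: le1 i1; clear; lra.
Qed.

Lemma riesz_le f : nonneg_within f -> P f <= \int[riesz_measure]_(x in Omega) f x.
Proof.
move=> f0; have mO := compact_measurable_rV cptO.
apply/ler_addgt0Pr => e e0.
pose K := fine (riesz_measure Omega).
have K0 : 0 <= K by rewrite fine_ge0.
pose delta := e / (K + 1).
have d0 : 0 < delta by rewrite divr_gt0// ltr_wpDl.
have [M [M0 fM]] := compact_within_bounded cptO f0.1.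
have := @riesz_le_approx delta (Num.trunc (M / delta)).+1 f d0 f0.
move=> /(_ _)/le_trans; apply.
  move=> x Ox; rewrite -ler_pdivrMr//.
  apply: le_trans (ltW (truncnS_gt (M / delta))).
  rewrite ler_pM2r ?invr_gt0//; apply: le_trans (fM _ Ox); exact: ler_norm.
rewrite lerD2l; apply: (@le_trans _ _ (delta * K)).
  apply: ler_wpM2l; first exact: ltW.
  apply: fine_le; [exact: upper_measure_fin..|].
  by apply: upper_measure_monotone; exact: subIsetl.
by rewrite /delta mulrAC ler_pdivrMr ?ltr_wpDl// ler_pM2l// lerDl.
Qed.

(** The inequality missing from [riesz_le] is [riesz_le] for [M - f], where M bounds f, because the
    total mass of the measure is at most the value of P at the constant 1. *)
Theorem riesz_representation f : nonneg_within f ->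
  P f = \int[riesz_measure]_(x in Omega) f x.
Proof.
move=> f0; apply/eqP; rewrite eq_le riesz_le//=.
have mO := compact_measurable_rV cptO.
have [M [M0 fM]] := compact_within_bounded cptO f0.1.
have c1 := nonneg_within_cst ler01; have cM := nonneg_within_cst M0.
have Mf0 : nonneg_within (fun x => M - f x).
  split; first by apply: within_sub; [exact: within_cst|exact: f0.1].
  by move=> x Ox; rewrite subr_ge0; apply: le_trans (fM _ Ox); exact: ler_norm.
have := riesz_le Mf0.
rewrite RintegralB//; [|exact/riesz_integrable/within_cst|exact/riesz_integrable/f0.1].
rewrite Rintegral_cst//.
have -> : P (fun x => M - f x) = P (fun=> M) - P f.
  apply/eqP; rewrite -subr_eq opprK addrC eq_sym addrC -Padd//.
  by apply/eqP; congr P; apply/funext => x; rewrite subrK.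
have -> : P (fun=> M) = M * P (fun=> 1).
  by rewrite -Phom//; congr P; apply/funext => x; rewrite mulr1.
have : M * fine (riesz_measure Omega) <= M * P (fun=> 1).
  apply: ler_wpM2l => //; rewrite -lee_fin fineK ?upper_measure_fin//.
  exact: upper_measure_le.
by clear; lra.
Qed.

Theorem positive_riesz : exists m : {finite_measure set T -> \bar R},
  (forall A, A `&` Omega = set0 -> m A = 0%E) /\
  forall f, nonneg_within f -> P f = \int[m]_(x in Omega) f x.
Proof.
by exists riesz_measure; split; [exact: upper_measure_disjoint|exact: riesz_representation].
Qed.

End positive_functional.

(** * Signed and vector-valued Riesz representation *)

Section charge_integral_difference.
Context {disp : measure_display} {T : measurableType disp} {R : realType}.

(** Any decomposition of the charge computes the integral: if jp - jn is the Jordan decomposition,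
    then jp + m2 and jn + m1 are the same measure, and all the integrals involved are finite. *)
Lemma charge_integral_measureB (nu : {charge set T -> \bar R})
    (m1 m2 : {finite_measure set T -> \bar R}) (D : set T) (f : T -> R) :
  (forall A, measurable A -> nu A = m1 A - m2 A)%E ->
  measurable D -> measurable_fun D f -> [bounded f x | x in D] ->
  charge_integral nu D f = \int[m1]_(x in D) f x - \int[m2]_(x in D) f x.
Proof.
move=> numm mD mf bf; rewrite /charge_integral.
set nuPN : hahn_decomposition _ _ _ := svalP _.
have int (m : {finite_measure set T -> \bar R}) : m.-integrable D (EFin \o f).
  by apply: measurable_bounded_integrable => //; rewrite -ge0_fin_numE// fin_num_measure.
pose jp : {finite_measure set T -> \bar R} := jordan_pos nuPN.
pose jn : {finite_measure set T -> \bar R} := jordan_neg nuPN.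
change (\int[jp]_(x in D) f x - \int[jn]_(x in D) f x =
  \int[m1]_(x in D) f x - \int[m2]_(x in D) f x).
have E : (\int[measure_add jp m2]_(x in D) (f x)%:E =
          \int[measure_add jn m1]_(x in D) (f x)%:E)%E.
  apply: eq_measure_integral => A mA _; rewrite [LHS]measure_addE [RHS]measure_addE.
  change (jp A + m2 A = jn A + m1 A)%E.
  have : (jp A - jn A = m1 A - m2 A)%E.
    by rewrite -numm// (jordan_decomp nuPN mA) /cadd/= cscaleN1.
  have : jp A \is a fin_num by exact: fin_num_measure.
  have : jn A \is a fin_num by exact: fin_num_measure.
  have : m1 A \is a fin_num by exact: fin_num_measure.
  have : m2 A \is a fin_num by exact: fin_num_measure.
  move: (jp A) (jn A) (m1 A) (m2 A) => [a| |] [b| |] [c| |] [e| |]//= _ _ _ _ [abce].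
  by rewrite -?EFinD; congr EFin; move: abce; clear; lra.
move: E; rewrite !integral_measure_add//; try exact: int; try exact/measurable_EFinP.
have fin m := integrable_fin_num mD (int m).
rewrite /Rintegral.
move: (fin jp) (fin jn) (fin m1) (fin m2) => /=.
move: (integral jp _ _) (integral jn _ _) (integral m1 _ _) (integral m2 _ _).
move=> [a| |] [b| |] [c| |] [e| |]//= _ _ _ _ [abce].
by move: abce; clear; lra.
Qed.
End charge_integral_difference.

Section signed_riesz.
Context {R : realType} {d : nat} (Omega : set 'rV[R]_d).
Local Notation T := 'rV[R]_d.
Hypothesis cptO : compact Omega.
Context (L : (T -> R) -> R) (C : R).
Hypothesis Llin : forall (a : R) (f g : T -> R), {within Omega, continuous f} ->
  {within Omega, continuous g} -> L (fun x => a * f x + g x) = a * L f + L g.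
Hypothesis Lbd : forall (f : T -> R) (M : R), 0 <= M -> {within Omega, continuous f} ->
  (forall x, Omega x -> `|f x| <= M) -> `|L f| <= C * M.

Let below (f : T -> R) := [set L g | g in
  [set g | {within Omega, continuous g} /\ forall x, Omega x -> `|g x| <= f x]].

(* |L|(f), to be used for f >= 0: it is additive there, so L = |L| - (|L| - L) is
   a difference of positive functionals. *)
Definition functional_variation (f : T -> R) : R := sup (below f).
Local Notation N := functional_variation.

Let below0 f : nonneg_within Omega f -> below f (L (fun=> 0)).
Proof.
move=> [cf f0]; exists (fun=> 0) => //; split; first exact: within_cst.
by move=> x Ox; rewrite normr0 f0.
Qed.

Let below_ub f : nonneg_within Omega f -> has_ubound (below f).
Proof.
move=> [cf f0]; have [M [M0 fM]] := compact_within_bounded cptO cf.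
exists (C * M) => _ [g [cg gf] <-]; apply: le_trans (ler_norm _) _.
apply: Lbd => // x Ox; apply: le_trans (gf _ Ox) _.
by apply: le_trans (ler_norm _) (fM _ Ox).
Qed.

Let le_variation (f g : T -> R) : nonneg_within Omega f -> {within Omega, continuous g} ->
  (forall x, Omega x -> `|g x| <= f x) -> L g <= N f.
Proof. by move=> f0 cg gf; apply: ub_le_sup; [exact: below_ub|exists g]. Qed.

Let variation_le (f : T -> R) (M : R) : nonneg_within Omega f -> (forall g : T -> R, {within Omega, continuous g} ->
  (forall x, Omega x -> `|g x| <= f x) -> L g <= M) -> N f <= M.
Proof.
move=> f0 h; apply: ge_sup => [|_ [g [cg gf] <-]]; last exact: h.
by exists (L (fun=> 0)); exact: below0.
Qed.

Let L_add (f g : T -> R) : {within Omega, continuous f} -> {within Omega, continuous g} ->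
  L (fun x => f x + g x) = L f + L g.
Proof.
by move=> cf cg; rewrite -[L f]mul1r -Llin//; congr L; apply/funext => x; rewrite mul1r.
Qed.

Let L_scale (a : R) (f : T -> R) : {within Omega, continuous f} -> L (fun x => a * f x) = a * L f.
Proof.
move=> cf; have c0 : {within Omega, continuous (fun _ : T => 0 : R)} by exact: within_cst.
have L0 : L (fun=> 0) = 0.
  have := L_add c0 c0; have -> : (fun x : T => 0 + 0 : R) = fun=> 0.
    by apply/funext => x; rewrite addr0.
  lra.
rewrite -[RHS]addr0 -L0 -Llin//; congr L.
by apply/funext => x; rewrite addr0.
Qed.

(** For the upper bound, a function h with |h| <= f + g is truncated to [h1], which takes values in
    [-f, f]; the remainder [h - h1] is then bounded by g. The lower bound adds two functions bounded
    by f and by g. *)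
Lemma variationD f g : nonneg_within Omega f -> nonneg_within Omega g ->
  N (fun x => f x + g x) = N f + N g.
Proof.
move=> f0 g0; have fg0 := nonneg_within_add f0 g0.
apply/eqP; rewrite eq_le; apply/andP; split.
  apply: variation_le => // h ch hfg.
  pose h1 x := Num.max (- f x) (Num.min (h x) (f x)).
  have ch1 : {within Omega, continuous h1}.
    apply: within_max; first by apply: within_opp; exact: f0.1.
    by apply: within_min => //; exact: f0.1.
  have -> : L h = L h1 + L (fun x => h x - h1 x).
    rewrite -L_add//; last exact: within_sub.
    by congr L; apply/funext => x; rewrite addrC subrK.
  have h1f x : Omega x -> `|h1 x| <= f x /\ `|h x - h1 x| <= g x.
    move=> Ox; have := hfg _ Ox; have := f0.2 _ Ox; have := g0.2 _ Ox.
    rewrite /h1 !ler_norml => gx fx /andP[hx1 hx2].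
    have [u|u] := leP (h x) (f x);
      [have [v|v] := leP (- f x) (h x)|have [v|v] := leP (- f x) (f x)];
      split; apply/andP; split; lra.
  apply: lerD; apply: le_variation => //; try exact: within_sub.
    by move=> x /h1f[].
  by move=> x /h1f[].
rewrite -lerBrDr; apply: variation_le => // h1 ch1 h1f.
rewrite lerBrDr addrC -lerBrDr; apply: variation_le => // h2 ch2 h2g.
rewrite lerBrDr addrC -L_add//; apply: le_variation => //; first exact: within_add.
by move=> x Ox; apply: le_trans (ler_normD _ _) _; apply: lerD; [exact: h1f|exact: h2g].
Qed.

(** For c > 0 one inequality, [half], suffices: the reverse one is [half] for the factor 1/c and the
    function c f. *)
Lemma variation_hom c f : 0 <= c -> nonneg_within Omega f ->
  N (fun x => c * f x) = c * N f.
Proof.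
move=> c0 f0.
have cf0 b : 0 <= b -> nonneg_within Omega (fun x => b * f x).
  by move=> b0; apply: nonneg_within_mul => //; exact: nonneg_within_cst.
have half (b : R) (h : T -> R) : 0 < b -> nonneg_within Omega h -> b * N h <= N (fun x => b * h x).
  move=> b0 h0.
  have bh0 : nonneg_within Omega (fun x => b * h x).
    by apply: nonneg_within_mul => //; apply: nonneg_within_cst; exact: ltW.
  rewrite -ler_pdivlMl//; apply: variation_le => // g cg gh.
  rewrite ler_pdivlMl// -L_scale//; apply: le_variation => //.
    by apply: within_mul => //; exact: within_cst.
  by move=> x Ox; rewrite normrM gtr0_norm// ler_pM2l// gh.
move: c0; rewrite le_eqVlt => /predU1P[<-|c0].
  rewrite mul0r; apply/eqP; rewrite eq_le; apply/andP; split.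
    apply: variation_le => [|g cg g0]; first exact: cf0.
    apply: le_trans (ler_norm _) _; rewrite -[leRHS](mulr0 C).
    by apply: Lbd => // x Ox; apply: le_trans (g0 _ Ox) _; rewrite mul0r.
  apply: (@le_trans _ _ (L (fun x => 0 * f x))).
    by rewrite L_scale ?mul0r//; exact: f0.1.
  apply: le_variation; [exact: cf0| |].
    by apply: within_mul; [exact: within_cst|exact: f0.1].
  by move=> x Ox; rewrite mul0r normr0 .
apply/eqP; rewrite eq_le half// andbT.
have ci : 0 < c^-1 by rewrite invr_gt0.
have := half _ _ ci (cf0 _ (ltW c0)).
rewrite ler_pdivrMl//; congr (_ <= _ * N _).
by apply/funext => x; rewrite mulrA mulVf ?mul1r// gt_eqF.
Qed.

Lemma signed_riesz : exists m1 m2 : {finite_measure set T -> \bar R},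
  (forall A, A `&` Omega = set0 -> m1 A = 0%E /\ m2 A = 0%E) /\
  forall f : T -> R, {within Omega, continuous f} ->
    L f = \int[m1]_(x in Omega) f x - \int[m2]_(x in Omega) f x.
Proof.
have arith (a b c x y : R) : a - b - x = a - c - (b - y) -> x = c - y by lra.
have N_abs (f : T -> R) : nonneg_within Omega f -> `|L f| <= N f.
  move=> f0; have ff x : Omega x -> `|f x| <= f x by move=> Ox; rewrite ger0_norm// f0.2.
  rewrite ler_norml lerNl; apply/andP; split; last by apply: le_variation => //; exact: f0.1.
  rewrite -mulN1r -L_scale; last exact: f0.1.
  apply: le_variation => //.
    by apply: within_mul; [exact: within_cst|exact: f0.1].
  by move=> x Ox; rewrite mulN1r normrN ff.
have mono (a : R) (f g : T -> R) : `|a| <= 1 -> nonneg_within Omega f -> nonneg_within Omega g ->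
    (forall x, Omega x -> f x <= g x) -> N f + a * L f <= N g + a * L g.
  move=> a1 f0 g0 fg.
  have gf0 : nonneg_within Omega (fun x => g x - f x).
    by split; [apply: within_sub; [exact: g0.1|exact: f0.1]|move=> x Ox; rewrite subr_ge0 fg].
  have gE : g = fun x => f x + (g x - f x) by apply/funext => x; rewrite addrC subrK.
  rewrite [in N g]gE variationD// [in L g]gE L_add; [|exact: f0.1|exact: gf0.1].
  rewrite mulrDr addrACA lerDl.
  have := N_abs _ gf0; rewrite -subr_ge0 => /le_trans; apply.
  rewrite lerD2l -lerNl; apply: le_trans (ler_norm _) _.
  by rewrite normrN normrM ler_piMl.
have hom (a c : R) (f : T -> R) : 0 <= c -> nonneg_within Omega f ->
    N (fun x => c * f x) + a * L (fun x => c * f x) = c * (N f + a * L f).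
  move=> c0 f0; rewrite variation_hom// L_scale ?(proj1 f0)//; first by ring.
  exact: f0.1.
have add (a : R) (f g : T -> R) : nonneg_within Omega f -> nonneg_within Omega g ->
    N (fun x => f x + g x) + a * L (fun x => f x + g x) = (N f + a * L f) + (N g + a * L g).
  move=> f0 g0; rewrite variationD// L_add; first by ring.
    exact: f0.1.
  exact: g0.1.
have n1 : `|1| <= 1 :> R by rewrite normr1.
have n0 : `|0 : R| <= 1 by rewrite normr0 ler01.
(* The functional |L| + a L is positive whenever |a| <= 1. The choices a = 1 and a = 0 give two
   measures whose difference represents L. *)
have [m1 [m1O m1P]] := positive_riesz cptO (add 1) (hom 1) (fun f g => @mono 1 f g n1).
have [m2 [m2O m2P]] := positive_riesz cptO (add 0) (hom 0) (fun f g => @mono 0 f g n0).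
have mO := compact_measurable_rV cptO.
have int (m : {finite_measure set T -> \bar R}) (f : T -> R) :
    {within Omega, continuous f} -> m.-integrable Omega (EFin \o f).
  move=> cf; apply: integrable_within_continuous => //.
  by rewrite -ge0_fin_numE// fin_num_measure.
exists m1, m2; split => [A AO|f cf]; first by rewrite m1O// m2O.
have pos (g : T -> R) : nonneg_within Omega g ->
    L g = \int[m1]_(x in Omega) g x - \int[m2]_(x in Omega) g x.
  by move=> g0; rewrite -m1P// -m2P// mul1r mul0r addr0 addrC addKr.
(* A function of arbitrary sign is the difference of max(f, 0) and max(f, 0) - f, both
   nonnegative. *)
have p1 : nonneg_within Omega (fun x => Num.max (f x) 0).
  split; first by apply: within_max => //; exact: within_cst.
  by move=> x _; rewrite le_max lexx orbT.
have p2 : nonneg_within Omega (fun x => Num.max (f x) 0 - f x).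
  split; first by apply: within_sub => //; exact: p1.1.
  by move=> x _; rewrite subr_ge0 le_max lexx.
have := pos _ p2; rewrite !RintegralB//; try by apply: int => //; exact: p1.1.
have -> : L (fun x => Num.max (f x) 0 - f x) = L (fun x => Num.max (f x) 0) - L f.
  rewrite -mulN1r -L_scale// -L_add//; last 2 first.
  - exact: p1.1.
  - by apply: within_mul => //; exact: within_cst.
  by congr L; apply/funext => x; rewrite mulN1r.
by rewrite (pos _ p1); exact: arith.
Qed.

End signed_riesz.

(** * Continuous vector-valued functions, their pairing with measures, and its Riesz
    representation *)

Section dnorm_theory.
Context {R : realType} {W : lmodType R} (form : {dot W for idfun}).

Lemma dnorm_ge0 (v : W) : 0 <= dnorm form v.
Proof. exact: sqrtr_ge0. Qed.

Lemma dnorm0 : dnorm form 0 = 0.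
Proof. by rewrite /dnorm linear0l sqrtr0. Qed.

Lemma dnormZ (a : R) v : dnorm form (a *: v) = `|a| * dnorm form v.
Proof.
rewrite /dnorm linearZl_LR linearZr_LR/= mulrA -expr2 sqrtrM ?sqr_ge0//.
by rewrite sqrtr_sqr.
Qed.

Lemma dnorm_sum (I : Type) (r : seq I) (f : I -> W) :
  dnorm form (\sum_(i <- r) f i) <= \sum_(i <- r) dnorm form (f i).
Proof.
elim: r => [|i r ih]; first by rewrite !big_nil dnorm0.
by rewrite !big_cons; apply: (le_trans (Defs.dnormD form _ _)); rewrite lerD2l.
Qed.

Lemma ler_dist_dnorm u v : `|dnorm form u - dnorm form v| <= dnorm form (u - v).
Proof.
have := Defs.dnormD form (u - v) v; have := Defs.dnormD form (v - u) u.
rewrite !subrK -[dnorm _ (v - u)]Defs.dnormN opprB ler_norml => h1 h2.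
by apply/andP; split; lra.
Qed.

Lemma sqr_dnorm v : dnorm form v ^+ 2 = form v v.
Proof. by rewrite sqr_sqrtr// dot_ge0. Qed.

End dnorm_theory.

Section continuous_on_theory.
Context {R : realType} {d : nat} (Omega : set 'rV[R]_d) {W : lmodType R}
  (form : {dot W for idfun}).
Local Notation T := 'rV[R]_d.

Lemma within_cvg0 (x : T) (f g : T -> R) : Omega x -> (forall y, `|f y| <= g y) ->
  g y @[y --> within Omega (nbhs x)] --> 0 -> f y @[y --> within Omega (nbhs x)] --> 0.
Proof.
move=> Ox fg g0; have g0' : (- g y) @[y --> within Omega (nbhs x)] --> (0 : R).
  by rewrite -oppr0; exact: cvgN.
have FF := @within_nbhs_proper _ Omega x (subset_closure Ox).
apply: (squeeze_cvgr _ g0' g0); apply: nearW => y.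
by rewrite -ler_norml.
Qed.

Lemma continuous_on_form (phi : T -> W) u : continuous_on Omega form phi ->
  {within Omega, continuous (fun x => form (phi x) u)}.
Proof.
move=> cphi; apply/subspace_continuousP => x Ox; apply/subr_cvg0.
apply: (within_cvg0 Ox (g := fun y => dnorm form (phi y - phi x) * dnorm form u)).
  by move=> y; rewrite -linearBl; exact: dot_CauchySchwarz.
by rewrite -(mul0r (dnorm form u)); apply: cvgM; [exact: cphi|exact: cvg_cst].
Qed.

Lemma continuous_on_dnorm (phi : T -> W) : continuous_on Omega form phi ->
  {within Omega, continuous (fun x => dnorm form (phi x))}.
Proof.
move=> cphi; apply/subspace_continuousP => x Ox; apply/subr_cvg0.
apply: (within_cvg0 Ox (g := fun y => dnorm form (phi y - phi x))).
  by move=> y; exact: ler_dist_dnorm.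
exact: cphi.
Qed.

Lemma continuous_onZ (f : T -> R) (b : W) : {within Omega, continuous f} ->
  continuous_on Omega form (fun x => f x *: b).
Proof.
move=> /subspace_continuousP cf x Ox.
under eq_fun do rewrite -scalerBl dnormZ.
have h : `|f y - f x| * dnorm form b @[y --> within Omega (nbhs x)] -->
    `|0 : R| * dnorm form b.
  apply: cvgM; last exact: cvg_cst.
  by apply: cvg_norm; apply/subr_cvg0; exact: cf.
by rewrite normr0 mul0r in h.
Qed.

Lemma continuous_onD (phi psi : T -> W) : continuous_on Omega form phi ->
  continuous_on Omega form psi -> continuous_on Omega form (fun x => phi x + psi x).
Proof.
move=> c1 c2 x Ox.
apply: (within_cvg0 Ox (g := fun y => dnorm form (phi y - phi x) + dnorm form (psi y - psi x))).
  by move=> y; rewrite ger0_norm ?dnorm_ge0// opprD addrACA Defs.dnormD.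
have h := cvgD (c1 x Ox) (c2 x Ox); rewrite addr0 in h; exact: h.
Qed.

Lemma continuous_on_scale (a : R) (phi : T -> W) : continuous_on Omega form phi ->
  continuous_on Omega form (fun x => a *: phi x).
Proof.
move=> c1 x Ox; under eq_fun do rewrite -scalerBr dnormZ.
have h := cvgM (cvg_cst `|a|) (c1 x Ox); rewrite mulr0 in h; exact: h.
Qed.

Lemma continuous_on_cst (v : W) : continuous_on Omega form (fun=> v).
Proof. by move=> x Ox; under eq_fun do rewrite subrr dnorm0; exact: cvg_cst. Qed.

Lemma continuous_on_sum (I : Type) (r : seq I) (f : I -> T -> W) :
  (forall i, continuous_on Omega form (f i)) ->
  continuous_on Omega form (fun x => \sum_(i <- r) f i x).
Proof.
move=> cf; elim: r => [|i r ih].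
  by under eq_fun do rewrite big_nil; exact: continuous_on_cst.
by under eq_fun do rewrite big_cons; exact: continuous_onD.
Qed.

Lemma continuous_on_lin (a : R) (phi psi : T -> W) : continuous_on Omega form phi ->
  continuous_on Omega form psi -> continuous_on Omega form (fun x => a *: phi x + psi x).
Proof. by move=> c1 c2; apply: continuous_onD => //; exact: continuous_on_scale. Qed.

Lemma continuous_on_bounded (phi : T -> W) : compact Omega ->
  continuous_on Omega form phi ->
  exists M : R, 0 <= M /\ forall x, Omega x -> dnorm form (phi x) <= M.
Proof.
move=> cO /continuous_on_dnorm /(compact_within_bounded cO)[M [M0 h]].
by exists M; split => // x /h; exact/le_trans/ler_norm.
Qed.

End continuous_on_theory.

Section finite_measure_add.
Context {disp : measure_display} {T : measurableType disp} {R : realType}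
  (m1 m2 : {finite_measure set T -> \bar R}).

Let measure_add_fin : fin_num_fun (measure_add m1 m2).
Proof.
move=> A mA; rewrite [measure_add _ _ A]measure_addE fin_numD.
by apply/andP; split; exact: fin_num_measure.
Qed.

HB.instance Definition _ := Measure.on (measure_add m1 m2).
HB.instance Definition _ :=
  Measure_isFinite.Build _ T R (measure_add m1 m2) measure_add_fin.

Lemma Rintegral_measure_add (D : set T) (f : T -> R) :
  measurable D -> measurable_fun D f -> [bounded f x | x in D] ->
  \int[measure_add m1 m2]_(x in D) f x = \int[m1]_(x in D) f x + \int[m2]_(x in D) f x.
Proof.
move=> mD mf bf.
have int (m' : {finite_measure set T -> \bar R}) : m'.-integrable D (EFin \o f).
  by apply: measurable_bounded_integrable => //; rewrite -ge0_fin_numE// fin_num_measure.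
rewrite /Rintegral (integral_measure_add mD (int m1) (int m2)).
by rewrite fineD//; apply: integrable_fin_num => //; exact: int.
Qed.

End finite_measure_add.

Section charge_integral_theory.
Context {disp : measure_display} {T : measurableType disp} {R : realType}.

(** Hides the chosen Hahn decomposition. Together with [charge_integral_measureB], this is all that
    is used of [charge_integral] from here on. *)
Lemma charge_integral_split (nu : {charge set T -> \bar R}) :
  exists m1 m2 : {finite_measure set T -> \bar R},
  (forall A, measurable A -> nu A = m1 A - m2 A)%E /\
  forall (D : set T) (f : T -> R), charge_integral nu D f = \int[m1]_(x in D) f x - \int[m2]_(x in D) f x.
Proof.
rewrite /charge_integral; set nuPN : hahn_decomposition _ _ _ := svalP _.
exists (jordan_pos nuPN), (jordan_neg nuPN); split => // A mA.
by rewrite (jordan_decomp nuPN mA) /cadd/= cscaleN1.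
Qed.

Lemma charge_integralD (nu nu1 nu2 : {charge set T -> \bar R}) (D : set T) (f : T -> R) :
  (forall A, measurable A -> nu A = nu1 A + nu2 A)%E ->
  measurable D -> measurable_fun D f -> [bounded f x | x in D] ->
  charge_integral nu D f = charge_integral nu1 D f + charge_integral nu2 D f.
Proof.
move=> nu12 mD mf bf.
have [p1 [q1 [pq1 ->]]] := charge_integral_split nu1.
have [p2 [q2 [pq2 ->]]] := charge_integral_split nu2.
rewrite (@charge_integral_measureB _ _ _ _ (measure_add p1 p2) (measure_add q1 q2))//.
  by rewrite !Rintegral_measure_add//; move: (Rintegral p1 D f) (Rintegral p2 D f) (Rintegral q1 D f)
    (Rintegral q2 D f) => a b c e; rewrite opprD addrACA.
move=> A mA; rewrite nu12// pq1// pq2//.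
apply: etrans _ (esym (congr2 (fun x y => x - y)%E (measure_addE p1 p2 A) (measure_addE q1 q2 A))).
have : q1 A \is a fin_num by exact: fin_num_measure.
have : q2 A \is a fin_num by exact: fin_num_measure.
by move=> f2 f1; rewrite fin_num_oppeD// addeACA.
Qed.

Lemma charge_integralN (nu nu1 : {charge set T -> \bar R}) (D : set T) (f : T -> R) :
  (forall A, measurable A -> nu A = - nu1 A)%E ->
  measurable D -> measurable_fun D f -> [bounded f x | x in D] ->
  charge_integral nu D f = - charge_integral nu1 D f.
Proof.
move=> nu1N mD mf bf.
have [p1 [q1 [pq1 ->]]] := charge_integral_split nu1.
rewrite (@charge_integral_measureB _ _ _ _ q1 p1)//; first by rewrite opprB.
move=> A mA; rewrite nu1N// pq1//.
have : q1 A \is a fin_num by exact: fin_num_measure.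
have : p1 A \is a fin_num by exact: fin_num_measure.
by move: (p1 A) (q1 A) => [a| |] [b| |]//= _ _; congr EFin; rewrite opprB.
Qed.

End charge_integral_theory.

Section vintegral_theory.
Context {R : realType} {d : nat} {Omega : set 'rV[R]_d} {W : lmodType R}
  {form : {dot W for idfun}} (cptO : compact Omega).
Local Notation T := 'rV[R]_d.
Local Notation M := (vmeasure Omega form).
Implicit Types (m : M) (phi psi : T -> W) (e : seq W).

Lemma within_form_bounded phi u : continuous_on Omega form phi ->
  [/\ measurable Omega, measurable_fun Omega (fun x => form (phi x) u) &
      [bounded form (phi x) u | x in Omega]].
Proof.
move=> cphi; have cf := continuous_on_form (u := u) cphi.
have mO := compact_measurable_rV cptO.
split => //; first exact: measurable_within_continuous.
have [B [B0 fB]] := compact_within_bounded cptO cf.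
exists B; split => [|x Bx y Oy]; first exact: num_real.
by apply: le_trans (ltW Bx); exact: fB.
Qed.

Lemma integrable_form (mu : {finite_measure set T -> \bar R}) phi u :
  continuous_on Omega form phi ->
  mu.-integrable Omega (EFin \o (fun x => form (phi x) u)).
Proof.
move=> c1; have [mO mf bf] := within_form_bounded u c1.
by apply: measurable_bounded_integrable => //; rewrite -ge0_fin_numE// fin_num_measure.
Qed.

Lemma vintegral_lin e m (a : R) phi psi : continuous_on Omega form phi ->
  continuous_on Omega form psi ->
  vintegral e (fun x => a *: phi x + psi x) m = a * vintegral e phi m + vintegral e psi m.
Proof.
move=> c1 c2; rewrite /vintegral mulr_sumr -big_split; apply: eq_bigr => b _ /=.
have [p [q [_ E]]] := charge_integral_split (vm_comp m b).
have mO := compact_measurable_rV cptO.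
have lin (mu : {finite_measure set T -> \bar R}) :
    \int[mu]_(x in Omega) form (a *: phi x + psi x) b =
    a * (\int[mu]_(x in Omega) form (phi x) b) + \int[mu]_(x in Omega) form (psi x) b.
  under eq_Rintegral do rewrite linearDl linearZl_LR/=.
  have i1 := integrable_form mu b c1; have i2 := integrable_form mu b c2.
  rewrite RintegralD//; last first.
    by apply: (@eq_integrable _ _ _ mu _ mO _ _ _ (integrableZl mO a i1)).
  by rewrite RintegralZl.
by rewrite !E !lin mulrBr opprD addrACA.
Qed.

Lemma vintegral_addm e m1 m2 phi : continuous_on Omega form phi ->
  vintegral e phi (vm_add m1 m2) = vintegral e phi m1 + vintegral e phi m2.
Proof.
move=> c1; rewrite /vintegral -big_split; apply: eq_bigr => b _ /=.
have [mO mf bf] := within_form_bounded b c1.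
apply: charge_integralD => // A mA.
by change ((form (m1 A + m2 A) b)%:E = (form (m1 A) b + form (m2 A) b)%:E); rewrite linearDl.
Qed.

Lemma vintegral_oppm e m phi : continuous_on Omega form phi ->
  vintegral e phi (vm_opp m) = - vintegral e phi m.
Proof.
move=> c1; rewrite /vintegral -sumrN; apply: eq_bigr => b _ /=.
have [mO mf bf] := within_form_bounded b c1.
apply: charge_integralN => // A mA.
by change ((form (- m A) b)%:E = (- form (m A) b)%:E); rewrite linearNl.
Qed.

Lemma eq_vintegral e m phi psi : (forall x, Omega x -> phi x = psi x) ->
  vintegral e phi m = vintegral e psi m.
Proof.
move=> phipsi; apply: eq_bigr => b _.
have [p [q [_ E]]] := charge_integral_split (vm_comp m b).
by rewrite !E; congr (_ - _); apply: eq_Rintegral => x /set_mem Ox; rewrite phipsi.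
Qed.

(** The constant comes from the masses of the Jordan parts of the components and is cruder than the
    total variation. It makes the total variation finite and the pairing continuous for uniform
    convergence. *)
Lemma vintegral_bounded e m : exists K : R, 0 <= K /\
  forall phi B, continuous_on Omega form phi ->
    (forall x, Omega x -> dnorm form (phi x) <= B) -> `|vintegral e phi m| <= K * B.
Proof.
have mO := compact_measurable_rV cptO.
have bnd b : exists K : R, 0 <= K /\ forall phi B, continuous_on Omega form phi ->
    (forall x, Omega x -> dnorm form (phi x) <= B) ->
    `|charge_integral (vm_comp m b) Omega (fun x => form (phi x) b)| <= K * B.
  have [p [q [_ E]]] := charge_integral_split (vm_comp m b).
  exists ((fine (p Omega) + fine (q Omega)) * dnorm form b); split.
    by rewrite mulr_ge0 ?dnorm_ge0// addr_ge0// fine_ge0.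
  move=> phi B c1 phiB.
  have le (mu : {finite_measure set T -> \bar R}) :
      `|\int[mu]_(x in Omega) form (phi x) b| <= fine (mu Omega) * dnorm form b * B.
    have i1 := integrable_form mu b c1.
    apply: le_trans (le_normr_Rintegral mO i1) _.
    have -> : fine (mu Omega) * dnorm form b * B =
        \int[mu]_(x in Omega) (B * dnorm form b).
      by rewrite Rintegral_cst// -mulrA mulrC [B * _]mulrC.
    apply: le_Rintegral => //.
    - exact: (@integrable_norm _ _ _ mu _ _ i1).
    - exact: finite_measure_integrable_cst.
    - move=> x Ox; apply: le_trans (dot_CauchySchwarz _ _ _) _.
      by apply: ler_wpM2r; [exact: dnorm_ge0|exact: phiB].
  rewrite E; apply: le_trans (ler_normB _ _) _.
  by rewrite !mulrDl; apply: lerD.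
have /choice[K KP] := bnd.
exists (\sum_(b <- e) K b); split; first by apply: sumr_ge0 => b _; exact: (KP b).1.
move=> phi B c1 phiB; apply: le_trans (ler_norm_sum _ _ _) _.
by rewrite mulr_suml; apply: ler_sum => b _; exact: (KP b).2.
Qed.

Lemma vintegral_le_tv e m phi : continuous_on Omega form phi ->
  (forall x, Omega x -> dnorm form (phi x) <= 1) ->
  ((vintegral e phi m)%:E <= tv_norm e m)%E.
Proof. by move=> c1 phi1; apply: ereal_sup_ubound; exists phi. Qed.

Lemma tv_norm_fin e m : tv_norm e m \is a fin_num.
Proof.
have [K [K0 Km]] := vintegral_bounded e m.
rewrite ge0_fin_numE; last first.
  apply: le_trans (_ : ((vintegral e (fun=> 0) m)%:E <= _)%E).
    have : `|vintegral e (fun=> 0) m| <= K * 0.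
      by apply: Km => [|x _]; [exact: continuous_on_cst|rewrite dnorm0].
    by rewrite mulr0 normr_le0 => /eqP ->.
  apply: vintegral_le_tv; first exact: continuous_on_cst.
  by move=> x _; rewrite dnorm0.
apply: le_lt_trans (ltry K); apply: ge_ereal_sup => _ [phi [c1 phi1] <-].
rewrite lee_fin; apply: le_trans (ler_norm _) _.
by rewrite -[K]mulr1; exact: Km.
Qed.

End vintegral_theory.

Section vector_riesz.
Context {R : realType} {d : nat} (Omega : set 'rV[R]_d) {W : lmodType R}
  (form : {dot W for idfun}).
Local Notation T := 'rV[R]_d.
Local Notation cont := (continuous_on Omega form).
Hypothesis cptO : compact Omega.
Context (e : seq W).
Hypothesis expand_e : forall w, w = \sum_(b <- e) form w b *: b.
Hypothesis ortho_e : {in e &, forall b b', form b b' = (b == b')%:R}.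
Hypothesis uniq_e : uniq e.
Context (L : (T -> W) -> R) (C : R).
Hypothesis Llin : forall (a : R) (phi psi : T -> W), cont phi -> cont psi ->
  L (fun x => a *: phi x + psi x) = a * L phi + L psi.
Hypothesis C0 : 0 <= C.
Hypothesis Lbd : forall (phi : T -> W) (B : R), 0 <= B -> cont phi ->
  (forall x, Omega x -> dnorm form (phi x) <= B) -> `|L phi| <= C * B.

Lemma functional_sum (I : Type) (r : seq I) (f : I -> T -> W) :
  (forall i, cont (f i)) -> L (fun x => \sum_(i <- r) f i x) = \sum_(i <- r) L (f i).
Proof.
move=> cf; have L0 : L (fun=> 0) = 0.
  have c0 : cont (fun=> 0) by exact: continuous_on_cst.
  have := Llin 1 c0 c0; rewrite mul1r.
  have -> : (fun x : T => 1 *: 0 + 0 : W) = fun=> 0.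
    by apply/funext => x; rewrite scaler0 addr0.
  lra.
elim: r => [|i r ih]; first by under eq_fun do rewrite big_nil; rewrite big_nil.
under eq_fun do rewrite big_cons; rewrite big_cons -ih.
have -> : (fun x => f i x + \sum_(j <- r) f j x) =
    (fun x => 1 *: f i x + \sum_(j <- r) f j x).
  by apply/funext => x; rewrite scale1r.
by rewrite Llin ?mul1r//; exact: continuous_on_sum.
Qed.

(** Componentwise: for each basis vector b the functional f |-> L(f b) is a difference of two finite
    measures, and this difference is the coefficient of b in the vector measure. Orthonormality
    recovers the coefficients through [form]. *)
Theorem vector_riesz : exists m : vmeasure Omega form,
  forall phi, cont phi -> vintegral e phi m = L phi.
Proof.
have comp b : exists mm : {finite_measure set T -> \bar R} * {finite_measure set T -> \bar R},
    (forall A, A `&` Omega = set0 -> mm.1 A = 0%E /\ mm.2 A = 0%E) /\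
    forall f : T -> R, {within Omega, continuous f} ->
      L (fun x => f x *: b) = \int[mm.1]_(x in Omega) f x - \int[mm.2]_(x in Omega) f x.
  have [] := @signed_riesz R d Omega cptO (fun f => L (fun x => f x *: b))
    (C * dnorm form b) _ _.
  - move=> a f g cf cg; rewrite -Llin; [|exact: continuous_onZ..].
    by congr L; apply/funext => x; rewrite scalerDl scalerA.
  - move=> f B B0 cf fB; rewrite -mulrA; apply: Lbd.
    + by rewrite mulr_ge0// dnorm_ge0.
    + exact: continuous_onZ.
    + move=> x Ox; rewrite dnormZ mulrC; apply: ler_wpM2l; first exact: dnorm_ge0.
      exact: fB.
  by move=> m1 [m2 [mO mL]]; exists (m1, m2).
have {comp} [m mP] := choice comp.
pose s b A : R := fine ((m b).1 A) - fine ((m b).2 A).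
pose v A : W := \sum_(b <- e) s b A *: b.
have s_add b (F : (set T)^nat) : (forall i, measurable (F i)) -> trivIset setT F ->
    (\sum_(i < n) s b (F i)) @[n --> \oo] --> s b (\bigcup_i F i).
  move=> mF tF.
  have mUF : measurable (\bigcup_i F i) by exact: bigcup_measurable.
  have fc (mu : {finite_measure set T -> \bar R}) :
      (\sum_(i < n) fine (mu (F i))) @[n --> \oo] --> fine (mu (\bigcup_i F i)).
    have := @measure_semi_sigma_additive _ _ _ mu F mF tF mUF.
    rewrite -[X in _ --> X]fineK ?fin_num_measure// => /fine_cvg.
    apply: cvg_trans; apply: near_eq_cvg; apply: nearW => n /=.
    rewrite big_mkord sum_fine// => i _; exact: fin_num_measure.
  rewrite (_ : (fun n => _) = (fun n => \sum_(i < n) fine ((m b).1 (F i)) -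
      \sum_(i < n) fine ((m b).2 (F i)))); last by apply/funext => n; rewrite /s sumrB.
  exact: cvgB.
have v_add (F : (set T)^nat) : (forall i, measurable (F i)) -> trivIset setT F ->
    dnorm form (v (\bigcup_i F i) - \sum_(i < n) v (F i)) @[n --> \oo] --> (0 : R).
  move=> mF tF.
  pose g n := \sum_(b <- e) `|s b (\bigcup_i F i) - \sum_(i < n) s b (F i)| * dnorm form b.
  have g0 : g n @[n --> \oo] --> (0 : R).
    have -> : 0 = \sum_(b <- e) 0 * dnorm form b :> R.
      by rewrite big1// => b _; rewrite mul0r.
    rewrite /g; apply: cvg_big => [|b _]; first exact: add_continuous.
    apply: cvgM; last exact: cvg_cst.
    have h : (s b (\bigcup_i F i) - \sum_(i < n) s b (F i)) @[n --> \oo] -->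
        s b (\bigcup_i F i) - s b (\bigcup_i F i).
      by apply: cvgB; [exact: cvg_cst|exact: s_add].
    by rewrite subrr in h; move/cvg_norm : h; rewrite normr0; exact.
  apply: (squeeze_cvgr _ (cvg_cst 0) g0); apply: nearW => n.
  rewrite dnorm_ge0/= /g /v exchange_big/= -sumrB.
  apply: le_trans (dnorm_sum _ _ _) _; apply: ler_sum => b _.
  by rewrite -scaler_suml -scalerBl dnormZ.
have v_supp A : measurable A -> A `&` Omega = set0 -> v A = 0.
  move=> mA AO; rewrite /v big1// => b _; rewrite /s; have [-> ->] := (mP b).1 _ AO.
  by rewrite subrr scale0r.
exists (VMeasure v_add v_supp) => phi cphi.
have v_form b A : b \in e -> form (v A) b = s b A.
  move=> be; rewrite /v linear_sumlz (bigD1_seq b)//= linearZl_LR/= ortho_e// eqxx mulr1.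
  rewrite big1_seq ?addr0// => b' /andP[bb' b'e].
  by rewrite linearZl_LR/= ortho_e// (negbTE bb') mulr0.
have -> : L phi = L (fun x => \sum_(b <- e) form (phi x) b *: b).
  by congr L; apply/funext => x; exact: expand_e.
rewrite functional_sum; last by move=> b; apply: continuous_onZ; exact: continuous_on_form.
rewrite /vintegral; apply: eq_big_seq => b be.
have [mO mf bf] := within_form_bounded cptO b cphi.
rewrite (mP b).2; last exact: continuous_on_form.
apply: charge_integral_measureB => // A mA.
rewrite /vm_comp [(_ : set T -> \bar R) A](_ : _ = (form (v A) b)%:E)// v_form// /s.
by rewrite EFinB !fineK// fin_num_measure.
Qed.

End vector_riesz.

(** * Integration by parts *)

Section lebesgue_tuple_theory.
Context {R : realType}.
Local Notation mR := (measurableTypeR R).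
Local Notation leb := (@lebesgue_measure R).

Definition consr n (a : R) (y : 'rV[R]_n) : 'rV[R]_n.+1 :=
  \row_i oapp (fun j => y ord0 j) a (unlift ord0 i).

Lemma consr0 n a (y : 'rV[R]_n) : consr a y ord0 ord0 = a.
Proof. by rewrite mxE unlift_none. Qed.

Lemma consr_lift n a (y : 'rV[R]_n) i : consr a y ord0 (lift ord0 i) = y ord0 i.
Proof. by rewrite mxE liftK. Qed.

Lemma rV_of_pcons n (a : mR) (t : n.-tuple mR) :
  rV_of_tuple (pcons (a, t)) = consr a (rV_of_tuple t).
Proof.
apply/rowP => i; rewrite !mxE; case: unliftP => [j ->|->] /=; last by rewrite tnth0.
by rewrite mxE tnthS.
Qed.

Lemma consr_axis0 n (a s : R) (y : 'rV[R]_n) :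
  consr a y + s *: axis ord0 = consr (a + s) y.
Proof.
apply/rowP => i; rewrite !mxE eqxx /=; case: unliftP => [j ->|->] /=.
  by rewrite mulr0 addr0.
by rewrite ?eqxx mulr1.
Qed.

Lemma consr_axisS n (a s : R) (y : 'rV[R]_n) l :
  consr a y + s *: axis (lift ord0 l) = consr a (y + s *: axis l).
Proof.
apply/rowP => i; rewrite !mxE eqxx /=; case: unliftP => [j ->|->] /=.
  by rewrite !mxE eqxx /= (inj_eq lift_inj).
by rewrite mulr0 addr0.
Qed.

Definition tuple_box n (M : R) : set (n.-tuple mR) := [set t | forall i, `|tnth t i| <= M].

Lemma measurable_tuple_box n M : measurable (@tuple_box n M).
Proof.
rewrite (_ : tuple_box M = \bigcap_(i : 'I_n)
    ((fun t : n.-tuple mR => tnth t i) @^-1` `[- M, M]%classic)).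
  apply: fin_bigcap_measurable; first exact: finite_finset.
  by move=> i _; rewrite -[X in measurable X]setTI; exact: measurable_tnth.
apply/seteqP; split => t /=.
  by move=> h i _ /=; rewrite in_itv/= -ler_norml.
by move=> h i; have /= := h i Logic.I; rewrite in_itv/= -ler_norml.
Qed.

Lemma lebesgue_tuple_box n M : (lebesgue_tuple R n (tuple_box M) < +oo)%E.
Proof.
elim: n => [|n ih].
  by change ((\d_([tuple] : 0.-tuple mR)) (@tuple_box 0 M) < +oo :> \bar R)%E; rewrite diracE ltry.
change ((leb \x lebesgue_tuple R n) (@pcons R n @^-1` tuple_box M) < +oo)%E.
have -> : @pcons R n @^-1` tuple_box M = `[- M, M]%classic `*` tuple_box M.
  apply/seteqP; split => -[a t] /= h.
    split; first by have := h ord0; rewrite tnth0 /= in_itv/= -ler_norml.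
    by move=> i; have := h (lift ord0 i); rewrite tnthS; exact.
  move: h => [aM tM] i; case: (unliftP ord0 i) => [j ->|->] /=.
    by rewrite tnthS; exact: tM.
  by rewrite tnth0; move: aM; rewrite in_itv/= -ler_norml.
rewrite product_measure1E//; last exact: measurable_tuple_box.
rewrite lte_mul_pinfty// ge0_fin_numE//.
rewrite [ltLHS](_ : _ = lebesgue_measure (`[- M, M]%classic : set R))//.
by rewrite lebesgue_measure_itv/=; case: ifP => // _; rewrite -EFinD ltry.
Qed.

Lemma integrable_tuple_box n (F : n.-tuple mR -> R) M K :
  measurable_fun setT F -> (forall t, `|F t| <= K) ->
  (forall t, ~ tuple_box M t -> F t = 0) ->
  (lebesgue_tuple R n).-integrable setT (EFin \o F).
Proof.
move=> mF FK F0; have mB := @measurable_tuple_box n M.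
have -> : EFin \o F = (EFin \o F) \_ (tuple_box M).
  apply/funext => t; rewrite patchE; case: ifPn => //.
  by rewrite notin_setE => /F0 /= ->.
apply: (integrable_mkcond _ mB).1; apply: measurable_bounded_integrable => //.
- exact: lebesgue_tuple_box.
- exact: measurable_funTS.
exists K; split => [|x Kx t _]; first exact: num_real.
by apply: le_trans (ltW Kx); exact: FK.
Qed.

Lemma integral_tuple_fubini n (F : n.+1.-tuple mR -> R) M K :
  measurable_fun setT F -> (forall t, `|F t| <= K) ->
  (forall t, ~ tuple_box M t -> F t = 0) ->
  (\int[lebesgue_tuple R n.+1]_t (F t)%:E =
     \int[leb]_a \int[lebesgue_tuple R n]_t (F (pcons (a, t)))%:E)%E /\
  (\int[lebesgue_tuple R n.+1]_t (F t)%:E =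
     \int[lebesgue_tuple R n]_t \int[leb]_a (F (pcons (a, t)))%:E)%E.
Proof.
move=> mF FK F0; have mp := @measurable_pcons R n.
have iF : (leb \x lebesgue_tuple R n)%E.-integrable setT ((EFin \o F) \o @pcons R n).
  have := integrable_tuple_box mF FK F0.
  move=> /integrableP[mEF]; rewrite ge0_integral_pushforward//; last first.
    exact: measurableT_comp.
  rewrite preimage_setT => h; apply/integrableP; split => //.
  exact: measurableT_comp.
have -> : (\int[lebesgue_tuple R n.+1]_t (F t)%:E =
    \int[leb \x lebesgue_tuple R n]_z (F (pcons z))%:E)%E.
  rewrite [LHS](_ : _ = \int[pushforward (leb \x lebesgue_tuple R n)%E (@pcons R n)]_t
    (EFin \o F) t)%E// integral_pushforward//.
  exact: measurableT_comp.
split; first by rewrite -(integral12_prod_meas1 iF).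
by rewrite -(integral21_prod_meas1 iF).
Qed.

End lebesgue_tuple_theory.

Section integration_by_parts.
Context {R : realType}.
Local Notation mR := (measurableTypeR R).
Local Notation leb := (@lebesgue_measure R).

Lemma is_derive_line {U : normedModType R} (f : U -> R) (x v : U) (t df : R) :
  is_derive (x + t *: v) v f df <-> is_derive t 1 (fun s : R => f (x + s *: v)) df.
Proof.
have E : (fun h : R => h^-1 *: ((f \o shift (x + t *: v)) (h *: v) - f (x + t *: v))) =
    (fun h : R => h^-1 *: (((fun s : R => f (x + s *: v)) \o shift t) (h *: (1 : R)) -
      f (x + t *: v))).
  apply/funext => h /=; congr (_ *: (f _ - _)).
  by rewrite [h *: 1]mulr1 scalerDl addrCA.
by split => -[d1 d2]; apply: DeriveDef; move: d1 d2; rewrite /derivable /derive E.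
Qed.

Lemma integral_derive_compact (w dw : R -> R) (M : R) : 0 < M ->
  (forall t : R, is_derive t (1 : R) w (dw t)) -> continuous dw ->
  (forall t, M <= `|t| -> w t = 0) -> (forall t, M <= `|t| -> dw t = 0) ->
  (\int[leb]_t (dw t)%:E = 0)%E.
Proof.
move=> M0 wdw cdw w0 dw0.
have cw : continuous w.
  by move=> t; apply: differentiable_continuous; apply/derivable1_diffP; case: (wdw t).
have -> : (\int[leb]_t (dw t)%:E = \int[leb]_(t in `[(- M)%R, M]) (dw t)%:E)%E.
  rewrite [RHS]integral_mkcond; apply: eq_integral => t _.
  rewrite patchE; case: ifPn => //; rewrite notin_setE /= in_itv/= -ler_norml => /negP.
  by rewrite -ltNge => /ltW /dw0 ->.
rewrite (@continuous_FTC2 _ dw w).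
- by rewrite !w0 ?normrN ?gtr0_norm ?subee.
- by lra.
- exact: continuous_subspaceT.
- split.
  + by move=> t _; case: (wdw t).
  + by apply: cvg_at_right_filter; exact: cw.
  + by apply: cvg_at_left_filter; exact: cw.
- by move=> t _; rewrite derive1E; case: (wdw t).
Qed.

(** Induction on the dimension. If l is the first direction, Fubini puts the first coordinate
    innermost, where the integral of a derivative with bounded support vanishes. Otherwise the first
    coordinate is frozen outermost and the induction hypothesis applies to the slices. Measurability
    in tuple coordinates and continuity along the axis are required in a form that passes to
    slices. *)
Lemma integral_partial n (l : 'I_n) (u v : 'rV[R]_n -> R) (M K : R) : 0 < M ->
  measurable_fun setT (v \o @rV_of_tuple R n) -> (forall x, `|v x| <= K) ->
  (forall (x : 'rV[R]_n) i, M <= `|x ord0 i| -> u x = 0) ->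
  (forall (x : 'rV[R]_n) i, M <= `|x ord0 i| -> v x = 0) ->
  (forall x, continuous (fun t : R => v (x + t *: axis l))) ->
  (forall x, is_derive x (axis l) u (v x)) ->
  (\int[lebesgue_tuple R n]_t (v (rV_of_tuple t))%:E = 0)%E.
Proof.
move=> M0; elim: n l u v => [[]//|n ih] l u v mv vK u0 v0 cv uv.
have v0' t : ~ tuple_box M t -> (v \o @rV_of_tuple R n.+1) t = 0.
  move=> /existsNP[i /negP]; rewrite -ltNge => ti; apply: (v0 _ i).
  by rewrite mxE ltW.
have [F1 F2] := integral_tuple_fubini mv (fun t => vK _) v0'.
have line (x : 'rV[R]_n.+1) (t : R) :
    is_derive t (1 : R) (fun s : R => u (x + s *: axis l)) (v (x + t *: axis l)).
  exact: (proj1 (is_derive_line u x (axis l) t _) (uv _)).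
case: (unliftP ord0 l) => [l' El|El].
  rewrite [LHS]F1; apply: integral0_eq => a _ /=.
  under eq_integral do rewrite rV_of_pcons.
  apply: (ih l' (u \o consr a) (v \o consr a)).
  - rewrite (_ : _ \o _ = (v \o @rV_of_tuple R n.+1) \o (fun t => @pcons R n (a, t))).
      apply: measurableT_comp => //; apply: measurableT_comp; first exact: measurable_pcons.
      exact: measurable_pair1.
    by apply/funext => t /=; rewrite rV_of_pcons.
  - by move=> x; exact: vK.
  - by move=> x i xi; apply: (u0 _ (lift ord0 i)); rewrite consr_lift.
  - by move=> x i xi; apply: (v0 _ (lift ord0 i)); rewrite consr_lift.
  - move=> x; have := cv (consr a x); rewrite El.
    by under eq_fun do rewrite consr_axisS.
  - move=> x; suff : is_derive (x + 0 *: axis l') (axis l') (u \o consr a) ((v \o consr a) x).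
      by rewrite scale0r addr0.
    apply: (proj2 (is_derive_line (u \o consr a) x (axis l') 0 _)).
    have := line (consr a x) 0; rewrite El scale0r addr0.
    by under eq_fun do rewrite consr_axisS.
rewrite [LHS]F2; apply: integral0_eq => t _ /=.
under eq_integral do rewrite rV_of_pcons.
pose x0 := consr 0 (rV_of_tuple t).
have xE a : consr a (rV_of_tuple t) = x0 + a *: axis l.
  by rewrite El consr_axis0 add0r.
have coord a : (consr a (rV_of_tuple t)) ord0 l = a by rewrite El consr0.
apply: (@integral_derive_compact (fun a => u (consr a (rV_of_tuple t)))
  (fun a => v (consr a (rV_of_tuple t))) M) => //.
- by move=> a; under eq_fun do rewrite xE; rewrite xE; exact: line.
- by under eq_fun do rewrite xE; exact: cv.
- by move=> a aM; apply: (u0 _ l); rewrite coord.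
- by move=> a aM; apply: (v0 _ l); rewrite coord.
Qed.

(** Gives product kernels unit mass. In dimension 0 the measure is a point mass, so the empty
    product also integrates to 1. *)
Lemma integral_tuple_prod n (h : 'I_n -> R -> R) :
  (forall i, measurable_fun setT (h i)) -> (forall i t, 0 <= h i t) ->
  (forall i, \int[leb]_t (h i t)%:E = 1)%E ->
  (\int[lebesgue_tuple R n]_t (\prod_i h i (tnth t i))%:E = 1)%E.
Proof.
elim: n h => [|n ih] h mh h0 h1.
  under eq_integral do rewrite big_ord0.
  rewrite integral_cst// mul1e.
  by change ((\d_([tuple] : 0.-tuple mR)) setT = 1 :> \bar R)%E; rewrite diracE in_setT.
pose F (t : n.+1.-tuple mR) := \prod_i h i (tnth t i).
have mprod k (g : 'I_k -> R -> R) : (forall i, measurable_fun setT (g i)) ->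
    measurable_fun setT (fun t : k.-tuple mR => \prod_i g i (tnth t i)).
  move=> mg; apply: measurable_prod => i _.
  exact: (measurableT_comp (mg i) (@measurable_tnth _ mR k i)).
have F0 t : 0 <= F t by apply: prodr_ge0.
have mF : measurable_fun setT (EFin \o F).
  by apply/measurable_EFinP; exact: (mprod _ h mh).
have mFp : measurable_fun setT ((EFin \o F) \o @pcons R n).
  exact: (measurableT_comp mF (@measurable_pcons R n)).
rewrite [LHS](_ : _ = \int[pushforward (leb \x lebesgue_tuple R n)%E (@pcons R n)]_t
    (EFin \o F) t)%E//.
rewrite (ge0_integral_pushforward (@measurable_pcons R n) _ measurableT mF); last first.
  by move=> t _; rewrite lee_fin.
rewrite preimage_setT fubini_tonelli1//; last by move=> z; rewrite lee_fin.
rewrite -(h1 ord0); apply: eq_integral => a _.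
transitivity (\int[lebesgue_tuple R n]_t
    ((h ord0 a)%:E * (\prod_i h (lift ord0 i) (tnth t i))%:E))%E.
  apply: eq_integral => t _; rewrite /= /F big_ord_recl -EFinM; congr (_ * _)%:E.
  by apply: eq_bigr => i _; rewrite tnthS.
have hS0 t : (0 <= (\prod_i h (lift ord0 i) (tnth t i))%:E :> \bar R)%E.
  by rewrite lee_fin prodr_ge0.
have mhS : measurable_fun setT
    (fun t : n.-tuple mR => (\prod_i h (lift ord0 i) (tnth t i))%:E).
  by apply/measurable_EFinP; exact: (mprod _ (fun i => h (lift ord0 i)) (fun i => mh _)).
rewrite ge0_integralZl ?lee_fin//.
by rewrite (ih (fun i => h (lift ord0 i)))// mule1.
Qed.

End integration_by_parts.

Section lebesgue_rV_theory.
Context {R : realType} {d : nat}.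
Local Notation T := 'rV[R]_d.
Local Notation leb := (lebesgue_rV R d).

Lemma compact_coord_bounded (K : set T) : compact K ->
  exists2 M : R, 0 < M & forall x i, K x -> `|x ord0 i| < M.
Proof.
move=> cK.
have /choice[m mP] : forall i : 'I_d, exists M : R, 0 <= M /\ forall x, K x -> `|x ord0 i| <= M.
  move=> i; apply: compact_within_bounded => //.
  by apply: continuous_subspaceT; exact: continuous_coord.
exists (\sum_i m i + 1) => [|x i Kx].
  by rewrite ltr_wpDl// sumr_ge0// => i _; exact: (mP i).1.
apply: le_lt_trans ((mP i).2 _ Kx) _; rewrite (bigD1 i)//= -addrA ltrDl.
by rewrite ltr_wpDl// sumr_ge0// => j _; exact: (mP j).1.
Qed.

Lemma lebesgue_rV_compact (K : set T) : compact K -> (leb K < +oo)%E.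
Proof.
move=> cK; have [M M0 KM] := compact_coord_bounded cK.
apply: le_lt_trans (lebesgue_tuple_box d M).
change (lebesgue_tuple R d (@rV_of_tuple R d @^-1` K) <= lebesgue_tuple R d (tuple_box M))%E.
apply: le_measure; rewrite ?inE; last 2 first.
- exact: measurable_tuple_box.
- by move=> t /= Kt i; have := KM _ i Kt; rewrite mxE => /ltW.
rewrite -[X in measurable X]setTI; apply: measurable_rV_of_tuple => //.
exact: compact_measurable_rV.
Qed.

Lemma integral_rV_tuple (f : T -> R) : measurable_fun setT f ->
  (lebesgue_tuple R d).-integrable setT (EFin \o (f \o @rV_of_tuple R d)) ->
  (\int[leb]_x (f x)%:E = \int[lebesgue_tuple R d]_t (f (rV_of_tuple t))%:E)%E.
Proof.
move=> mf intf.
rewrite [LHS](_ : _ = \int[pushforward (lebesgue_tuple R d) (@rV_of_tuple R d)]_x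
  (EFin \o f) x)%E//.
rewrite (integral_pushforward (@measurable_rV_of_tuple R d)) ?preimage_setT//.
exact/measurable_EFinP.
Qed.

Lemma ge0_integral_rV_tuple (f : T -> R) : measurable_fun setT f -> (forall x, 0 <= f x) ->
  (\int[leb]_x (f x)%:E = \int[lebesgue_tuple R d]_t (f (rV_of_tuple t))%:E)%E.
Proof.
move=> mf f0.
rewrite [LHS](_ : _ = \int[pushforward (lebesgue_tuple R d) (@rV_of_tuple R d)]_x
  (EFin \o f) x)%E//.
have mEf : measurable_fun setT (EFin \o f) by exact/measurable_EFinP.
rewrite (ge0_integral_pushforward (@measurable_rV_of_tuple R d) _ measurableT mEf).
  by rewrite preimage_setT.
by move=> x _; rewrite lee_fin.
Qed.

Lemma continuous_line (x a : T) : continuous (fun t : R => x + t *: a).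
Proof.
move=> t; apply: cvgD; first exact: cvg_cst.
by apply: cvgZr_tmp; exact: cvg_id.
Qed.

Lemma integral_rV_partial (l : 'I_d) (u v : T -> R) (K : set T) : compact K ->
  continuous v -> (forall x, is_derive x (axis l) u (v x)) ->
  (forall x, ~ K x -> u x = 0) -> (forall x, ~ K x -> v x = 0) ->
  (\int[leb]_x (v x)%:E = 0)%E.
Proof.
move=> cK cv uv u0 v0.
have [M M0 KM] := compact_coord_bounded cK.
have [B [B0 vB]] := compact_within_bounded cK (continuous_subspaceT cv).
have mv : measurable_fun setT v by exact: measurable_continuous_rV.
have mvt : measurable_fun setT (v \o @rV_of_tuple R d).
  exact: (measurableT_comp mv (@measurable_rV_of_tuple R d)).
have {}vB x : `|v x| <= B.
  have [Kx|nKx] := pselect (K x); first exact: vB.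
  by rewrite v0// normr0.
have far (x : T) i : M <= `|x ord0 i| -> ~ K x.
  by move=> Mx Kx; have := KM _ i Kx; rewrite ltNge Mx.
rewrite integral_rV_tuple//; last first.
  apply: (integrable_tuple_box (M := M) (K := B)) => // [t|t]; first exact: vB.
  move=> /existsNP[i /negP]; rewrite -ltNge => ti; apply: v0; apply: (far _ i).
  by rewrite mxE ltW.
apply: (@integral_partial R d l u v M B) => //.
- by move=> x i /far; exact: u0.
- by move=> x i /far; exact: v0.
move=> x t; apply: (@continuous_comp _ _ _ (fun t : R => x + t *: axis l) v).
  exact: continuous_line.
exact: cv.
Qed.

End lebesgue_rV_theory.

Section rintegral_within.
Context {R : realType} {d : nat} (m : {measure set 'rV[R]_d -> \bar R}) (A : set 'rV[R]_d).
Hypotheses (cA : compact A) (mA : (m A < +oo)%E).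

Lemma Rintegral_within_sum (I : Type) (r : seq I) (f : I -> 'rV[R]_d -> R) :
  (forall i, {within A, continuous (f i)}) ->
  \int[m]_(x in A) (\sum_(i <- r) f i x) = \sum_(i <- r) \int[m]_(x in A) f i x.
Proof.
move=> cf; have mA' := compact_measurable_rV cA.
elim: r => [|i r ih].
  under eq_Rintegral do rewrite big_nil.
  by rewrite big_nil Rintegral_cst// mul0r.
under eq_Rintegral do rewrite big_cons.
rewrite big_cons RintegralD ?ih//; apply: integrable_within_continuous => //.
exact: within_sum.
Qed.

Lemma EFin_Rintegral_within (f : 'rV[R]_d -> R) : {within A, continuous f} ->
  (\int[m]_(x in A) (f x)%:E = (\int[m]_(x in A) f x)%:E)%E.
Proof.
move=> cf; rewrite /Rintegral fineK//; apply: integrable_fin_num.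
  exact: compact_measurable_rV.
exact: integrable_within_continuous.
Qed.

End rintegral_within.

(** * The divergence theorem for C^1 functions and compactly supported test fields *)

Section gradient_bound.
Context {R : realType} {d : nat} (Omega : set 'rV[R]_d) {V : vectType R}
  (form : {dot V for idfun}) (e : seq V).
Local Notation T := 'rV[R]_d.
Local Notation leb := (lebesgue_rV R d).
Hypothesis cptO : compact Omega.
Hypothesis expand_e : forall w, w = \sum_(b <- e) form w b *: b.

Lemma parseval u v : form u v = \sum_(b <- e) form u b * form v b.
Proof.
rewrite [in LHS](expand_e u) linear_sumlz; apply: eq_bigr => b _.
by rewrite linearZl_LR/= [form b v]Defs.dotC.
Qed.

Lemma dot_powE (w z : {ffun 'I_d -> V}) :
  dot_pow d form w z = \sum_(b <- e) \sum_(l < d) form (w l) b * form (z l) b.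
Proof.
rewrite exchange_big; apply: eq_bigr => l _; exact: parseval.
Qed.

Lemma form_vdivE u (psi : T -> {ffun 'I_d -> V}) x :
  form u (vdiv form e psi x) =
  \sum_(b <- e) \sum_(l < d) form u b * 'D_(axis l) (fun y => form (psi y l) b) x.
Proof.
rewrite /vdiv linear_sumr; apply: eq_bigr => b _.
by rewrite linearZr_LR/= mulrC mulr_sumr.
Qed.

Lemma within_form_pow (g : T -> {ffun 'I_d -> V}) l b :
  continuous_on Omega (dot_pow d form) g -> {within Omega, continuous (fun x => form (g x l) b)}.
Proof.
move=> /(continuous_on_form (u := [ffun k => if k == l then b else 0])).
apply: within_eq => x _; rewrite [LHS](bigD1 l)//= ffunE eqxx big1 ?addr0// => k kl.
by rewrite ffunE (negbTE kl) linear0r.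
Qed.

Section divergence.
Context (phi : T -> V) (g psi : T -> {ffun 'I_d -> V}).
Hypotheses (C1 : C1_with_gradient Omega form e phi g) (tpsi : test_field Omega form e psi).
Let supp := closure [set x | psi x != 0].
Let pc l b (x : T) := form (psi x l) b.
(** The partial derivative in direction l of the product of the b-components of phi and of
    [psi _ l]. It is continuous on all of R^d, although phi is only controlled on Omega, because psi
    vanishes near every point outside its support, which lies in the interior. *)
Let flux l b (x : T) := form (g x l) b * pc l b x + form (phi x) b * 'D_(axis l) (pc l b) x.

Let psi0 x : ~ supp x -> psi x = 0.
Proof. by move=> nx; apply: contrapT => /eqP px; apply: nx; exact: subset_closure. Qed.

Let near_off x : ~ supp x -> \forall y \near x, ~ supp y.
Proof.
move=> nx; apply: open_nbhs_nbhs; split => //.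
by apply: closed_openC; exact: closed_closure.
Qed.

Let pc0 l b x : ~ supp x -> pc l b x = 0.
Proof. by move=> /psi0 px; rewrite /pc px ffunE linear0l. Qed.

Let dpc0 l b x : ~ supp x -> 'D_(axis l) (pc l b) x = 0.
Proof.
move=> nx; rewrite (@near_eq_derive _ _ _ _ (cst 0)) ?derive_cst//.
by apply: filterS (near_off nx) => y; exact: pc0.
Qed.

Let flux0 l b x : ~ supp x -> flux l b x = 0.
Proof. by move=> nx; rewrite /flux pc0// dpc0// !mulr0 addr0. Qed.

Let interior_continuous (f : T -> R) x : {within Omega, continuous f} -> Omega° x ->
  f y @[y --> x] --> f x.
Proof.
move=> /subspace_continuousP cf Ox; have := cf x (interior_subset Ox).
by rewrite within_interior.
Qed.

Let continuous_flux l b : b \in e -> continuous (flux l b).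
Proof.
move=> be x; have [cphi cg _] := C1; have [sm _ supO] := tpsi.
have [sx|nx] := pselect (supp x); last first.
  rewrite /continuous_at flux0//.
  have E : {near x, (fun=> 0 : R) =1 flux l b}.
    by apply: filterS (near_off nx) => y /flux0 ->.
  exact: (cvg_trans (near_eq_cvg E) (cvg_cst _)).
have Ox := supO _ sx.
have [c0 /(_ l)[_ c1]] := sm l b be 1%N.
have h1 : {for x, continuous (fun y => form (g y l) b)}.
  by apply: interior_continuous => //; exact: within_form_pow.
have h2 : {for x, continuous (fun y => form (phi y) b)}.
  by apply: interior_continuous => //; exact: continuous_on_form.
exact: (continuousD (continuousM h1 (c0 x)) (continuousM h2 (c1 x))).
Qed.

Let derive_flux l b x : b \in e ->
  is_derive x (axis l) (fun y => form (phi y) b * pc l b y) (flux l b x).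
Proof.
move=> be; have [_ _ dphi] := C1; have [sm _ supO] := tpsi.
have [sx|nx] := pselect (supp x); last first.
  rewrite flux0//; apply: near_eq_is_derive (is_derive_cst (0 : R) x (axis l)).
  by apply: filterS (near_off nx) => y /pc0 ->; rewrite mulr0.
have Ox := supO _ sx.
have [_ /(_ l)[dpsi _]] := sm l b be 1%N.
have d2 : is_derive x (axis l) (pc l b) ('D_(axis l) (pc l b) x).
  by apply: DeriveDef => //; exact: dpsi.
have := is_deriveM (dphi x l b Ox be) d2.
rewrite /flux; congr (is_derive _ _ _ _); rewrite addrC; congr (_ + _).
by rewrite mulrC.
Qed.

Let integral_flux l b : b \in e -> \int[leb]_(x in Omega) flux l b x = 0.
Proof.
move=> be; have [_ csupp supO] := tpsi.
rewrite Rintegral_mkcond.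
have -> : flux l b \_ Omega = flux l b.
  apply/funext => x; rewrite patchE; case: ifPn => //.
  rewrite notin_setE => nO; rewrite flux0// => /supO /interior_subset; exact: nO.
have u0 x : ~ supp x -> form (phi x) b * pc l b x = 0 by move=> /pc0 ->; rewrite mulr0.
have I := @integral_rV_partial _ _ l (fun y => form (phi y) b * pc l b y) (flux l b) supp
  csupp (@continuous_flux l b be) (fun x => derive_flux l x be) u0 (@flux0 l b).
by rewrite /Rintegral I.
Qed.

(** The integrand is F - G, where F is the sum of all fluxes, with integral zero, and G is the
    pointwise product of g and psi. The Cauchy-Schwarz inequality bounds |G| by |psi|. *)
Lemma integral_vdiv_le : (forall x, Omega x -> dnorm (dot_pow d form) (g x) <= 1) ->
  (\int[leb]_(x in Omega) (form (phi x) (vdiv form e psi x))%:E <=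
   \int[leb]_(x in Omega) (dnorm (dot_pow d form) (psi x))%:E)%E.
Proof.
move=> g1; have mO := compact_measurable_rV cptO; have lO := lebesgue_rV_compact cptO.
have [cphi cg _] := C1; have [sm _ _] := tpsi.
have cpc l b : b \in e -> {within Omega, continuous (pc l b)}.
  by move=> be; apply: continuous_subspaceT; have := sm l b be 0%N.
have cdpc l b : b \in e -> {within Omega, continuous ('D_(axis l) (pc l b))}.
  by move=> be; apply: continuous_subspaceT; have [_ /(_ l)[]] := sm l b be 1%N.
pose F (x : T) := \sum_(b <- e) \sum_(l < d) flux l b x.
pose G (x : T) := \sum_(b <- e) \sum_(l < d) form (g x l) b * pc l b x.
have within_sum_e (f : 'I_d -> V -> T -> R) :
    (forall l b, b \in e -> {within Omega, continuous (f l b)}) ->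
    {within Omega, continuous (fun x => \sum_(b <- e) \sum_(l < d) f l b x)}.
  (* Smoothness of components is known only for b in [e], whereas [within_sum] asks for continuity
     of the summand at every index; the conditional makes the other summands constant. *)
  move=> cf; have -> : (fun x => \sum_(b <- e) \sum_(l < d) f l b x) =
      (fun x => \sum_(b <- e) (if b \in e then \sum_(l < d) f l b x else 0)).
    by apply/funext => x; apply: eq_big_seq => b ->.
  apply: within_sum => b; case: (boolP (b \in e)) => be; last exact: within_cst.
  by apply: within_sum => l; exact: cf.
have cflux l b : b \in e -> {within Omega, continuous (flux l b)}.
  by move=> be; apply: continuous_subspaceT; exact: continuous_flux.
have cG : {within Omega, continuous G}.
  by apply: within_sum_e => l b be; apply: within_mul; [exact: within_form_pow|exact: cpc].
have cF : {within Omega, continuous F} by exact: within_sum_e.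
have F0 : \int[leb]_(x in Omega) F x = 0.
  have -> : F = (fun x => \sum_(b <- e) (if b \in e then \sum_(l < d) flux l b x else 0)).
    by apply/funext => x; apply: eq_big_seq => b ->.
  rewrite Rintegral_within_sum//; last first.
    move=> b; case: (boolP (b \in e)) => be; last exact: within_cst.
    by apply: within_sum => l; exact: cflux.
  rewrite big1// => b _; case: (boolP (b \in e)) => be; last by rewrite Rintegral_cst// mul0r.
  rewrite Rintegral_within_sum//; last by move=> l; exact: cflux.
  by rewrite big1// => l _; exact: integral_flux.
have FG x : form (phi x) (vdiv form e psi x) = F x - G x.
  rewrite form_vdivE /F /G -sumrB; apply: eq_bigr => b _.
  by rewrite -sumrB; apply: eq_bigr => l _; rewrite /flux addrC addKr.
have GE x : G x = dot_pow d form (g x) (psi x) by rewrite dot_powE.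
have cpsi : {within Omega, continuous (fun x => dnorm (dot_pow d form) (psi x))}.
  have -> : (fun x => dnorm (dot_pow d form) (psi x)) =
      (fun x => Num.sqrt (\sum_(b <- e) \sum_(l < d) pc l b x * pc l b x)).
    by apply/funext => x; rewrite /dnorm dot_powE.
  have cs : {within Omega, continuous (fun x => \sum_(b <- e) \sum_(l < d) pc l b x * pc l b x)}.
    by apply: within_sum_e => l b be; apply: within_mul; exact: cpc.
  move=> x; apply: (@continuous_comp (subspace Omega) _ _ _ (@Num.sqrt R)); first exact: cs.
  exact: sqrt_continuous.
have cFG : {within Omega, continuous (fun x => F x - G x)} by exact: within_sub.
under eq_integral do rewrite FG.
rewrite !EFin_Rintegral_within// lee_fin.
have iF := integrable_within_continuous lO cptO cF.
have iG := integrable_within_continuous lO cptO cG.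
rewrite RintegralB// F0 sub0r.
apply: le_trans (ler_norm _) _; rewrite normrN.
apply: le_trans (le_normr_Rintegral mO iG) _.
apply: le_Rintegral => //.
- by apply: integrable_within_continuous => //; exact: within_norm.
- exact: integrable_within_continuous.
move=> x Ox; rewrite GE; apply: le_trans (dot_CauchySchwarz _ _ _) _.
by rewrite ler_piMl ?dnorm_ge0// g1.
Qed.

End divergence.

Lemma gradient_norm_le1 (phi : T -> V) (g : T -> {ffun 'I_d -> V}) :
  C1_with_gradient Omega form e phi g ->
  (forall x, Omega x -> dnorm (dot_pow d form) (g x) <= 1) ->
  (gradient_norm Omega form e phi <= 1)%E.
Proof.
move=> C1 g1; apply: ge_ereal_sup => _ [psi [tpsi psi1] <-].
exact: le_trans (integral_vdiv_le C1 tpsi g1) psi1.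
Qed.

End gradient_bound.

(** * Smooth kernels *)

Section smooth_functions_of_one_variable.
Context {R : realType}.
Implicit Types f g : R -> R.

(** A derivative is carried as a witness, so that the rules for sums, products and affine
    substitutions supply it by a formula; [Ck_prod] turns this into the partial derivatives used by
    [Ck]. *)
Fixpoint Ck1 (k : nat) (h : R -> R) : Prop :=
  match k with
  | 0%N => continuous h
  | k'.+1 => exists h' : R -> R, (forall t : R, is_derive t (1 : R) h (h' t)) /\ Ck1 k' h'
  end.

Lemma is_derive1_continuous f (f' : R -> R) :
  (forall t : R, is_derive t (1 : R) f (f' t)) -> continuous f.
Proof.
move=> ff' t; apply: differentiable_continuous; apply/derivable1_diffP.
by case: (ff' t).
Qed.

Lemma Ck1_continuous k h : Ck1 k h -> continuous h.
Proof. by case: k => [//|k] /= [h' [/is_derive1_continuous]]. Qed.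

Lemma Ck1W k h : Ck1 k.+1 h -> Ck1 k h.
Proof.
elim: k h => [|k ih] h; first exact: Ck1_continuous.
by move=> [h' [hh' /ih ch']]; exists h'.
Qed.

Lemma Ck1D k f g : Ck1 k f -> Ck1 k g -> Ck1 k (fun t => f t + g t).
Proof.
elim: k f g => [|k ih] f g /=; first by move=> cf cg t; apply: cvgD; [exact: cf|exact: cg].
move=> [f' [ff' cf']] [g' [gg' cg']]; exists (fun t => f' t + g' t); split; last exact: ih.
by move=> t; exact: is_deriveD.
Qed.

Lemma Ck1M k f g : Ck1 k f -> Ck1 k g -> Ck1 k (fun t => f t * g t).
Proof.
elim: k f g => [|k ih] f g; first by move=> cf cg t; apply: cvgM; [exact: cf|exact: cg].
move=> cf cg; have [f' [ff' cf']] := cf; have [g' [gg' cg']] := cg.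
exists (fun t => f t * g' t + g t * f' t); split; last first.
  by apply: Ck1D; apply: ih => //; exact: Ck1W.
by move=> t; exact: is_deriveM.
Qed.

Lemma Ck1_cst k (c : R) : Ck1 k (fun=> c).
Proof.
elim: k c => [|k ih] c /=; first by move=> t; exact: cvg_cst.
by exists (fun=> 0); split => // t; exact: is_derive_cst.
Qed.

Lemma is_derive_affine (a c t : R) : is_derive t (1 : R) (fun s : R => a * s + c) a.
Proof.
have := is_deriveD (is_deriveZ a (is_derive_id t (1 : R))) (is_derive_cst c t (1 : R)).
by rewrite addr0 [a *: 1]mulr1.
Qed.

Lemma Ck1_affine k (a c : R) h : Ck1 k h -> Ck1 k (fun t => h (a * t + c)).
Proof.
elim: k h => [|k ih] h /=.
  move=> ch t; apply: (@continuous_comp _ _ _ (fun t : R => a * t + c) h); last exact: ch.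
  apply: (is_derive1_continuous (f' := fun=> a)) => s; exact: is_derive_affine.
move=> [h' [hh' ch']]; exists (fun t => a * h' (a * t + c)); split; last first.
  by apply: Ck1M; [exact: Ck1_cst|exact: ih].
move=> t; have := @is_derive1_comp R h (fun t : R => a * t + c) t _ _ (hh' _) (is_derive_affine a c t).
by rewrite mulrC.
Qed.

Lemma is_derive_quadratic f (x d C : R) :
  (forall h : R, `|f (h + x) - f x - d * h| <= C * h ^+ 2) -> is_derive x (1 : R) f d.
Proof.
move=> fC.
have cv : h^-1 *: ((f \o shift x) (h *: (1 : R)) - f x) @[h --> 0^'] --> d.
  apply/subr_cvg0.
  have ub : C * `|h| @[h --> (0 : R)^'] --> (0 : R).
    have : C * `|h| @[h --> (0 : R)] --> C * `|0 : R|.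
      by apply: cvgM; [exact: cvg_cst|apply: cvg_norm; exact: cvg_id].
    rewrite normr0 mulr0 => h; exact: cvg_within_filter h.
  have lb : - (C * `|h|) @[h --> (0 : R)^'] --> (0 : R).
    by have := cvgN ub; rewrite oppr0; exact.
  apply: (squeeze_cvgr _ lb ub); near=> h.
  have h0 : h != 0 by near: h; exact: nbhs_dnbhs_neq.
  rewrite -ler_norml /= [h *: 1]mulr1.
  have -> : h^-1 *: (f (h + x) - f x) - d = h^-1 * (f (h + x) - f x - d * h).
    by rewrite [_ *: _]/(_ * _) [RHS]mulrBr mulrCA mulVf// mulr1.
  rewrite normrM normfV ler_pdivrMl ?normr_gt0//.
  have -> : `|h| * (C * `|h|) = C * `|h| ^+ 2 by ring.
  by rewrite real_normK ?num_real// fC.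
apply: DeriveDef; first by apply/cvg_ex; exists d.
by apply/cvg_lim.
Unshelve. all: by end_near. Qed.

Lemma horner_le_expR (Q : {poly R}) : exists2 C : R, 0 <= C &
  forall u, 0 <= u -> `|Q.[u]| <= C * expR u.
Proof.
(* Each monomial satisfies u^i <= i! exp(u), by the exponential series. *)
exists (\sum_(i < size Q) `|Q`_i| * i`!%:R).
  by apply: sumr_ge0 => i _; rewrite mulr_ge0.
move=> u u0; rewrite horner_coef; apply: le_trans (ler_norm_sum _ _ _) _.
rewrite mulr_suml; apply: ler_sum => i _.
rewrite normrM -mulrA ler_wpM2l// ger0_norm ?exprn_ge0//.
case: (nat_of_ord i) => [|k]; first by rewrite expr0 mul1r; apply: le_trans (expR_ge1Dx u); lra.
rewrite mulrC -ler_pdivrMr ?ltr0n ?fact_gt0//.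
by apply: le_trans (expR_ge1Dxn k u0); rewrite lerDr.
Qed.

(* The class of functions P(1/t) exp(-1/t), extended by 0 to t <= 0, is stable
   under differentiation. *)
Definition flat (P : {poly R}) (t : R) : R :=
  if 0 < t then P.[t^-1] * expR (- t^-1) else 0.

(** For t > 0 this is [horner_le_expR] for the polynomial X^2 P at 1/t. The quadratic bound is what
    yields derivative 0 at the origin. *)
Lemma flat_le (P : {poly R}) : exists C : R, forall t, `|flat P t| <= C * t ^+ 2.
Proof.
have [C C0 PC] := horner_le_expR (P * 'X^2); exists C => t.
rewrite /flat; case: ifPn => [t0|_]; last by rewrite normr0 mulr_ge0// sqr_ge0.
have ti : 0 < t^-1 by rewrite invr_gt0.
have t2 : 0 < t^-1 ^+ 2 by rewrite exprn_gt0.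
have := PC _ (ltW ti); rewrite hornerM hornerXn normrM (gtr0_norm t2) => h.
rewrite normrM (gtr0_norm (expR_gt0 _)) expRN ler_pdivrMr ?expR_gt0//.
by rewrite mulrAC -ler_pdivrMr ?exprn_gt0// -exprVn.
Qed.

(** For t > 0, with u = 1/t, the derivative of P(u) is - u^2 P'(u) and that of exp(-u) is u^2
    exp(-u), whence the polynomial X^2 (P - P'). At t = 0 the bound [flat_le] takes over. *)
Lemma is_derive_flat (P : {poly R}) (t : R) :
  is_derive t (1 : R) (flat P) (flat ('X^2 * (P - P^`())) t).
Proof.
have [t0|t0|->] := ltgtP t 0.
- have -> : flat ('X^2 * (P - P^`())) t = 0 by rewrite /flat ltNge (ltW t0).
  apply: near_eq_is_derive (is_derive_cst (0 : R) t (1 : R)).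
  near=> s; have s0 : s < 0 by near: s; exact: lt_nbhsl.
  by rewrite /flat ltNge (ltW s0).
- have tn0 : t != 0 by rewrite gt_eqF.
  have dV : is_derive t (1 : R) (fun s : R => s^-1) (- t ^- 2).
    have := @is_deriveV R id t (1 : R) (1 : R) tn0 (is_derive_id t 1).
    by rewrite [_ *: 1]mulr1.
  have dP := @is_derive1_comp R (horner P) (fun s => s^-1) t _ _ (is_derive_poly P t^-1) dV.
  have dE := @is_derive1_comp R expR (fun s => - s^-1) t _ _ (is_derive_expR _) (is_deriveN dV).
  have dM : is_derive t (1 : R) (fun s => P.[s^-1] * expR (- s^-1))
      (flat ('X^2 * (P - P^`())) t).
    have := is_deriveM dP dE; congr (is_derive _ _ _ _).
    rewrite /flat t0 hornerM hornerXn hornerD hornerN opprK exprVn /=.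
    have sE (a b : R) : a *: b = a * b by [].
    by rewrite !sE; ring.
  apply: near_eq_is_derive dM.
  near=> s; have s0 : 0 < s by near: s; exact: lt_nbhsr.
  by rewrite /flat s0.
have [C fC] := flat_le P.
rewrite {2}/flat ltxx; apply: (is_derive_quadratic (C := C)) => h.
by rewrite addr0 {2}/flat ltxx mul0r !subr0.
Unshelve. all: by end_near. Qed.

Lemma Ck1_flat k P : Ck1 k (flat P).
Proof.
elim: k P => [|k ih] P /=.
  exact: is_derive1_continuous (is_derive_flat P).
by exists (flat ('X^2 * (P - P^`()))); split => // t; exact: is_derive_flat.
Qed.

End smooth_functions_of_one_variable.

Section bump.
Context {R : realType}.
Local Notation leb := (@lebesgue_measure R).

Lemma flat1_ge0 (t : R) : 0 <= flat 1 t.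
Proof. by rewrite /flat; case: ifPn => // _; rewrite hornerC mul1r expR_ge0. Qed.

Lemma flat1_gt0 (t : R) : 0 < t -> 0 < flat 1 t.
Proof. by move=> t0; rewrite /flat t0 hornerC mul1r expR_gt0. Qed.

Lemma flat1_eq0 (t : R) : t <= 0 -> flat 1 t = 0.
Proof. by move=> t0; rewrite /flat ltNge t0. Qed.

Lemma integral_translation (G : R -> R) (c : R) : continuous G -> (forall t, 0 <= G t) ->
  (\int[leb]_t (G (t - c))%:E = \int[leb]_t (G t)%:E)%E.
Proof.
move=> cG G0; pose F (t : R) := t - c.
have dF (t : R) : is_derive t (1 : R) F 1.
  have := is_derive_affine 1 (- c) t.
  by congr (is_derive _ _ _ _); apply/funext => s; rewrite mul1r.
have F' : derive1 F = fun=> 1.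
  by apply/funext => t; rewrite derive1E; case: (dF t).
rewrite (@increasing_ge0_integration_by_substitutionT R F G)//.
- by apply: eq_integral => t _; rewrite F' fctE /= mulr1.
- by move=> x y; rewrite /F ltrD2r.
- by rewrite F'; exact: cst_continuous.
- by rewrite F'; exact: is_cvg_cst.
- by rewrite F'; exact: is_cvg_cst.
- apply/cvgrNyPle => A; near=> t.
  rewrite /F lerBlDr; near: t; apply: nbhs_ninfty_le; exact: num_real.
- apply/cvgryPge => A; near=> t.
  rewrite /F lerBrDr; near: t; apply: nbhs_pinfty_ge; exact: num_real.
Unshelve. all: by end_near. Qed.

(** The normalised product of flat(r + t) and flat(r - t). Unit mass is stated for t |-> h(c - t),
    the form in which kernels enter convolutions; it follows from evenness and translation
    invariance. *)
Lemma exists_bump (r : R) : 0 < r -> exists h : R -> R,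
  [/\ forall k, Ck1 k h, forall t, 0 <= h t, forall t, r <= `|t| -> h t = 0 &
      forall c, (\int[leb]_t (h (c - t))%:E = 1)%E].
Proof.
move=> r0; pose rho t := flat 1 (r + t) * flat 1 (r - t).
have Crho k : Ck1 k rho.
  apply: Ck1M.
    by have := Ck1_affine 1 r (Ck1_flat k 1); under eq_fun do rewrite mul1r addrC.
  by have := Ck1_affine (-1) r (Ck1_flat k 1); under eq_fun do rewrite mulN1r addrC.
have crho : continuous rho := Ck1_continuous (Crho 0%N).
have rho0 t : 0 <= rho t by rewrite mulr_ge0 ?flat1_ge0.
have rhoN t : rho (- t) = rho t by rewrite /rho opprK mulrC.
have rho_far t : r <= `|t| -> rho t = 0.
  rewrite /rho; have [t0|t0] := ger0P t.
    by move=> rt; rewrite [flat 1 (r - t)]flat1_eq0 ?mulr0// subr_le0.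
  by move=> rt; rewrite flat1_eq0 ?mul0r//; lra.
pose I := (\int[leb]_t (rho t)%:E)%E.
have mrho A : measurable_fun A rho.
  by apply: measurable_funTS; exact: continuous_measurable_fun.
have I_fin : I \is a fin_num.
  have -> : I = (\int[leb]_(t in `[(- r)%R, r]) (rho t)%:E)%E.
    rewrite [RHS]integral_mkcond; apply: eq_integral => t _.
    rewrite patchE; case: ifPn => //; rewrite notin_setE /= in_itv/= -ler_norml => /negP.
    by rewrite -ltNge => /ltW /rho_far ->.
  apply: integrable_fin_num => //; apply: continuous_compact_integrable.
    exact: segment_compact.
  exact: continuous_subspaceT.
have I_gt0 : (0 < I)%E.
  (* On this smaller interval the function has a positive minimum, so its integral is positive and
     can be divided out. *)
  pose S : set R := `[(- (r / 2))%R, r / 2]%classic.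
  have mS : measurable S by exact: measurable_itv.
  have S0 : S !=set0 by exists 0; rewrite /S /= in_itv/=; apply/andP; split; lra.
  have [t0 St0 mint0] := @compact_EVT_min _ R rho S S0 (@segment_compact _ _ _)
    (continuous_subspaceT crho).
  have rt0 : 0 < rho t0.
    move: St0; rewrite inE /S /= in_itv/= => /andP[h1 h2].
    by rewrite mulr_gt0// flat1_gt0//; lra.
  have lt1 : (0 < \int[leb]_(t in S) (rho t0)%:E)%E.
    rewrite integral_cst//.
    rewrite [X in (_ < _ * X)%E](_ : _ =
      lebesgue_measure (`[(- (r / 2))%R, r / 2]%classic : set R))//.
    rewrite lebesgue_measure_itv/= lte_fin.
    have -> : (- (r / 2) < r / 2) by lra.
    by rewrite -EFinD -EFinM lte_fin mulr_gt0//; lra.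
  have le1 : (\int[leb]_(t in S) (rho t0)%:E <= \int[leb]_(t in S) (rho t)%:E)%E.
    apply: ge0_le_integral => //.
    - by move=> t _; rewrite lee_fin ltW.
    - by apply/measurable_EFinP; exact: mrho.
    - by move=> t St; rewrite lee_fin mint0// inE.
  have le2 : (\int[leb]_(t in S) (rho t)%:E <= I)%E.
    apply: ge0_subset_integral => //.
      by apply/measurable_EFinP; exact: mrho.
    by move=> t _; rewrite lee_fin.
  exact: lt_le_trans lt1 (le_trans le1 le2).
have fI : 0 < fine I by rewrite fine_gt0// I_gt0/= ltey_eq I_fin.
exists (fun t => (fine I)^-1 * rho t); split.
- by move=> k; apply: Ck1M => //; exact: Ck1_cst.
- by move=> t; rewrite mulr_ge0// invr_ge0 ltW.
- by move=> t /rho_far ->; rewrite mulr0.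
have EI : ((fine I)^-1%:E * I = 1)%E.
  by rewrite -[X in (_ * X)%E](fineK I_fin) -EFinM mulVf// gt_eqF.
move=> c; have rhoE t : rho (c - t) = rho (t - c) by rewrite -rhoN opprB.
have E : (\int[leb]_t (rho (c - t))%:E = I)%E.
  by under eq_integral do rewrite rhoE; exact: integral_translation.
have mc : measurable_fun setT (fun t : R => (rho (c - t))%:E).
  apply/measurable_EFinP; rewrite (_ : (fun t => _) = (fun t => rho (t - c))).
    apply: continuous_measurable_fun => t.
    apply: (@continuous_comp _ _ _ (fun t : R => t - c) rho); last exact: crho.
    by apply: cvgB; [exact: cvg_id|exact: cvg_cst].
  by apply/funext => t; rewrite rhoE.
have rc0 (t : R) : setT t -> (0 <= (rho (c - t))%:E)%E by rewrite lee_fin.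
have k0 : (0 <= (fine I)^-1%:E)%E by rewrite lee_fin invr_ge0 ltW.
under eq_integral do rewrite EFinM.
by rewrite (ge0_integralZl leb measurableT mc rc0 k0) E.
Qed.

End bump.

Section tensor_product.
Context {R : realType} {d : nat}.
Local Notation T := 'rV[R]_d.

Lemma continuous_prod (I : Type) (r : seq I) (f : I -> T -> R) :
  (forall i, continuous (f i)) -> continuous (fun y => \prod_(i <- r) f i y).
Proof.
move=> cf; elim: r => [|i r ih].
  by under eq_fun do rewrite big_nil; exact: cst_continuous.
by under eq_fun do rewrite big_cons; move=> y; apply: continuousM; [exact: cf|exact: ih].
Qed.

Lemma is_derive_prod (h h' : 'I_d -> R -> R) l (y : T) :
  (forall t : R, is_derive t (1 : R) (h l) (h' l t)) ->
  is_derive y (axis l) (fun y : T => \prod_i h i (y ord0 i))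
    (\prod_i (if i == l then h' i else h i) (y ord0 i)).
Proof.
move=> hh'; suff : is_derive (y + 0 *: axis l) (axis l)
    (fun y : T => \prod_i h i (y ord0 i))
    (\prod_i (if i == l then h' i else h i) (y ord0 i)) by rewrite scale0r addr0.
apply: (proj2 (is_derive_line (fun y : T => \prod_i h i (y ord0 i)) y (axis l) 0 _)).
have -> : (fun s : R => \prod_i h i ((y + s *: axis l) ord0 i)) =
    (fun s : R => (\prod_(i | i != l) h i (y ord0 i)) * h l (1 * s + y ord0 l)).
  apply/funext => s; rewrite (bigD1 l)//= mulrC; congr (_ * h l _).
    apply: eq_bigr => i il; congr (h i _).
    by rewrite !mxE eqxx /= (negbTE il) mulr0 addr0.
  by rewrite !mxE !eqxx /= mulr1 mul1r addrC.
have d1 := @is_derive1_comp R (h l) (fun t : R => 1 * t + y ord0 l) 0 _ _ (hh' _)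
  (is_derive_affine 1 (y ord0 l) 0).
have := is_deriveZ (\prod_(i | i != l) h i (y ord0 i)) d1.
congr (is_derive _ _ _ _).
rewrite [in RHS](bigD1 l)//= eqxx [RHS]mulrC mulr0 add0r mulr1.
rewrite [_ *: _]/(_ * _); congr (_ * _).
by apply: eq_bigr => i il; rewrite (negbTE il).
Qed.

(** The induction stays within products of one-variable functions, since a partial derivative only
    replaces one factor; hence a separate factor for each coordinate. *)
Lemma Ck_prod k (h : 'I_d -> R -> R) : (forall i, Ck1 k (h i)) ->
  Ck k (fun y : T => \prod_i h i (y ord0 i)).
Proof.
elim: k h => [|k ih] h ch /=.
  apply: continuous_prod => i y.
  apply: (@continuous_comp _ _ _ (fun y : T => y ord0 i) (h i)); last exact: ch.
  exact: continuous_coord.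
split.
  apply: continuous_prod => i y.
  apply: (@continuous_comp _ _ _ (fun y : T => y ord0 i) (h i)).
    exact: continuous_coord.
  exact: (Ck1_continuous (ch i)).
move=> l; have [h' h'P] := choice ch.
have dl y := @is_derive_prod h h' l y (fun t => (h'P l).1 t).
split; first by move=> y; case: (dl y).
rewrite (_ : 'D_(axis l) _ = fun y : T => \prod_i (if i == l then h' i else h i) (y ord0 i)).
  by apply: (ih (fun i => if i == l then h' i else h i)) => i; case: ifPn => _; [exact: (h'P i).2|exact: Ck1W].
by apply/funext => y; case: (dl y).
Qed.

End tensor_product.

(** * Mollification *)

Section convolution.
Context {R : realType} {d : nat} (Omega : set 'rV[R]_d).
Local Notation T := 'rV[R]_d.
Local Notation leb := (lebesgue_rV R d).
Hypothesis cptO : compact Omega.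
Context (x0 : T) (s : R).

Definition dilation (x : T) : T := x0 + s *: (x - x0).

Lemma continuous_reflection (c : T) : continuous (fun y : T => c - y).
Proof.
move=> y; apply: (@cvgB _ _ _ (nbhs y) _ (fun=> c) id); last exact: (@cvg_id _ (nbhs y)).
exact: (@cvg_cst _ c _ (nbhs y)).
Qed.

(** The convolution of kappa with f cut off outside Omega, evaluated at the contracted point. All
    dependence on x sits in the kernel, so f need only be continuous on Omega. *)
Definition conv_kernel (f kappa : T -> R) (x : T) : R :=
  \int[leb]_(y in Omega) (f y * kappa (dilation x - y)).

Lemma within_kernel (f kappa : T -> R) x : {within Omega, continuous f} -> continuous kappa ->
  {within Omega, continuous (fun y => f y * kappa (dilation x - y))}.
Proof.
move=> cf ck; apply: within_mul => //; apply: continuous_subspaceT => y.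
apply: (@continuous_comp _ _ _ (fun y : T => dilation x - y) kappa); last exact: ck.
exact: continuous_reflection.
Qed.

Lemma integrable_kernel (f kappa : T -> R) x : {within Omega, continuous f} ->
  continuous kappa ->
  leb.-integrable Omega (EFin \o (fun y => f y * kappa (dilation x - y))).
Proof.
move=> cf ck; apply: integrable_within_continuous => //.
  exact: lebesgue_rV_compact.
exact: within_kernel.
Qed.

(** Uniformity in y comes from compactness of Omega: around each y a joint neighbourhood of (y, x)
    works, and finitely many of them cover Omega. *)
Lemma kernel_near (kappa : T -> R) x (tau : R) : continuous kappa -> 0 < tau ->
  \forall x' \near x, forall y, Omega y ->
    `|kappa (dilation x' - y) - kappa (dilation x - y)| < tau.
Proof.
move=> ck tau0; have /compact_near_coveringP ncO := cptO.
pose Q x' y := `|kappa (dilation x' - y) - kappa (dilation x - y)| < tau.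
have : \forall x' \near x, Omega `<=` Q x'.
  apply: (ncO _ (nbhs x) Q) => y Oy.
  pose z0 := dilation x - y.
  have t2 : 0 < tau / 2 by rewrite divr_gt0.
  have : \forall z \near z0, `|kappa z0 - kappa z| < tau / 2.
    by have /cvgrPdist_lt/(_ _ t2) := ck z0.
  move=> /nbhs_ballP[e /= e0 ez]; have e2 : 0 < e / 2 by rewrite divr_gt0.
  (* The contraction multiplies distances by |s|; dividing by |s| + 1 keeps the displacement below e
     / 2 and allows s = 0. *)
  have s0 : 0 < e / 2 / (`|s| + 1) by rewrite divr_gt0// ltr_wpDl.
  exists (ball y (e / 2), ball x (e / 2 / (`|s| + 1))).
    by split; exact: nbhsx_ballx.
  move=> [y' x'] [/=]; rewrite -!ball_normE /= => yy' xx'.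
  have k1 : `|kappa z0 - kappa (dilation x' - y')| < tau / 2.
    apply: ez; rewrite -ball_normE /= /z0 /dilation.
    rewrite (_ : _ - (_ - y') = s *: (x - x') - (y - y')); last first.
      by apply/rowP => i; rewrite !mxE; ring.
    apply: le_lt_trans (ler_normB _ _) _; rewrite (splitr e); apply: ler_ltD => //.
    rewrite normrZ; apply: le_trans (_ : `|s| * (e / 2 / (`|s| + 1)) <= _).
      by apply: ler_wpM2l => //; exact: ltW.
    by rewrite mulrCA ger_pMr// ler_pdivrMr ?ltr_wpDl// mul1r lerDl.
  have k2 : `|kappa z0 - kappa (dilation x - y')| < tau / 2.
    apply: ez; rewrite -ball_normE /= (_ : z0 - _ = y' - y); last first.
      by apply/rowP => i; rewrite !mxE; ring.
    by rewrite distrC; apply: lt_trans yy' _; rewrite ltr_pdivrMr// ltr_pMr// ltr1n.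
  change (`|kappa (dilation x' - y') - kappa (dilation x - y')| < tau).
  have -> : kappa (dilation x' - y') - kappa (dilation x - y') =
      (kappa z0 - kappa (dilation x - y')) - (kappa z0 - kappa (dilation x' - y')) by ring.
  by apply: le_lt_trans (ler_normB _ _) _; rewrite (splitr tau); exact: ltrD.
by apply: filterS => x' h y /h.
Qed.

Lemma continuous_conv_kernel (f kappa : T -> R) : {within Omega, continuous f} ->
  continuous kappa -> continuous (conv_kernel f kappa).
Proof.
move=> cf ck x; have mO := compact_measurable_rV cptO.
have lO := lebesgue_rV_compact cptO.
have [B [B0 fB]] := compact_within_bounded cptO cf.
apply/(@cvgrPdist_le _ _ _ _ (nbhs_filter x)) => tau tau0.
pose K := B * fine (leb Omega) + 1.
have K0 : 0 < K by rewrite ltr_wpDl// mulr_ge0// fine_ge0.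
have tK : 0 < tau / K by rewrite divr_gt0.
apply: filterS (kernel_near x ck tK) => x' hx'.
rewrite distrC /conv_kernel -RintegralB//; try exact: integrable_kernel.
have c1 : {within Omega, continuous (fun y => f y * kappa (dilation x' - y) -
    f y * kappa (dilation x - y))}.
  by apply: within_sub; exact: within_kernel.
have i1 := integrable_within_continuous lO cptO c1.
apply: le_trans (le_normr_Rintegral mO i1) _.
apply: (@le_trans _ _ (\int[leb]_(y in Omega) (B * (tau / K)))).
  apply: le_Rintegral => //.
  - by apply: integrable_within_continuous => //; exact: within_norm.
  - by apply: integrable_within_continuous => //; exact: within_cst.
  move=> y Oy; rewrite -mulrBr normrM.
  by apply: ler_pM => //; [exact: fB|exact/ltW/hx'].
rewrite Rintegral_cst// mulrAC mulrCA ger_pMr// ler_pdivrMr// mul1r lerDl //.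
Qed.

(** Differentiation under the integral sign along the line x + t [axis l], dominated by a constant,
    which is integrable on the compact Omega. The factor s is the chain rule for the contraction. *)
Lemma is_derive_conv_kernel (f kappa dkappa : T -> R) (l : 'I_d) (B : R) x :
  {within Omega, continuous f} -> continuous kappa -> continuous dkappa ->
  (forall z, is_derive z (axis l) kappa (dkappa z)) -> (forall z, `|dkappa z| <= B) ->
  is_derive x (axis l) (conv_kernel f kappa) (s * conv_kernel f dkappa x).
Proof.
move=> cf ck cdk dk dB; have mO := compact_measurable_rV cptO.
have lO := lebesgue_rV_compact cptO.
have [A [A0 fA]] := compact_within_bounded cptO cf.
pose F (t : R) (y : T) : R := f y * kappa (dilation (x + t *: axis l) - y).
have dilE (t : R) y : dilation (x + t *: axis l) - y = (dilation x - y) + (s * t) *: axis l.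
  by apply/rowP => i; rewrite !mxE; ring.
have dF (t : R) y : is_derive t (1 : R) (F^~ y) (f y * (s * dkappa (dilation (x + t *: axis l) - y))).
  have h1 := (proj1 (is_derive_line kappa (dilation x - y) (axis l) (s * t) _)) (dk _).
  have h2 : is_derive t (1 : R) (fun t : R => s * t) s.
    have := is_derive_affine s 0 t; by under eq_fun do rewrite addr0.
  have h3 := @is_derive1_comp R (fun t : R => kappa (dilation x - y + t *: axis l)) (fun t : R => s * t) t _ _ h1 h2.
  have := is_deriveZ (f y) h3; congr (is_derive _ _ _ _).
    by apply/funext => u; rewrite /F dilE.
  by rewrite dilE mulrC.
have d1E (t : R) y : partial1of2 F t y = f y * (s * dkappa (dilation (x + t *: axis l) - y)).
  by rewrite partial1of2E; case: (dF t y).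
have I0 : (`]-1, 1[%classic : set R) 0 by rewrite /= in_itv/= ltr01 ltrN10.
have intF (t : R) : (`]-1, 1[%classic : set R) t -> leb.-integrable Omega (EFin \o F t).
  by move=> _; exact: integrable_kernel.
have derF (t : R) y : (`]-1, 1[%classic : set R) t -> Omega y -> derivable (F^~ y) t 1.
  by move=> _ _; case: (dF t y).
pose C := A * (`|s| * B).
have C0 : 0 <= C.
  by rewrite mulr_ge0// mulr_ge0// (le_trans _ (dB 0)).
have intC : leb.-integrable Omega (EFin \o (fun=> C)).
  by apply: integrable_within_continuous => //; exact: within_cst.
have dFC (t : R) y : (`]-1, 1[%classic : set R) t -> Omega y -> `|partial1of2 F t y| <= C.
  move=> _ Oy; rewrite d1E 2!normrM; apply: ler_pM; [exact: normr_ge0| |exact: fA|].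
    by rewrite mulr_ge0.
  by apply: ler_wpM2l => //; exact: dB.
have := cvg_differentiation_under_integral mO I0 intF derF (fun=> C0) intC dFC.
have -> : \int[leb]_(y in Omega) partial1of2 F 0 y = s * conv_kernel f dkappa x.
  rewrite /conv_kernel -RintegralZl//; last exact: integrable_kernel.
  by apply: eq_Rintegral => y _; rewrite d1E scale0r addr0 mulrCA.
move=> cv; suff : is_derive (x + 0 *: axis l) (axis l) (conv_kernel f kappa)
    (s * conv_kernel f dkappa x) by rewrite scale0r addr0.
apply: (proj2 (is_derive_line (conv_kernel f kappa) x (axis l) 0 _)).
have cv' : h^-1 *: (((fun t : R => conv_kernel f kappa (x + t *: axis l)) \o shift 0) (h *: (1 : R)) -
    conv_kernel f kappa (x + 0 *: axis l)) @[h --> (0 : R)^'] --> s * conv_kernel f dkappa x.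
  apply: cvg_trans cv; apply: near_eq_cvg; apply: nearW => h /=.
  by rewrite [h *: 1]mulr1.
apply: DeriveDef; first by apply/cvg_ex; exists (s * conv_kernel f dkappa x).
by apply/cvg_lim.
Qed.

End convolution.

Section product_kernel.
Context {R : realType} {d : nat}.
Local Notation T := 'rV[R]_d.
Local Notation leb := (lebesgue_rV R d).

Lemma CkZ k (a : R) (f : T -> R) : Ck k f -> Ck k (fun y => a * f y).
Proof.
elim: k f => [|k ih] f.
  by move=> cf y; apply: continuousM; [exact: cst_continuous|exact: cf].
move=> [cf df]; split; first by move=> y; apply: continuousM; [exact: cst_continuous|exact: cf].
move=> l; have [dl cl] := df l.
have dZ y : is_derive y (axis l) (fun y => a * f y) (a * 'D_(axis l) f y).
  by apply: is_deriveZ; apply: derivableP.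
split; first by move=> y; case: (dZ y).
rewrite (_ : 'D_(axis l) _ = fun y => a * 'D_(axis l) f y); first exact: ih.
by apply/funext => y; case: (dZ y).
Qed.

Lemma vanishing_continuous_bounded (f : R -> R) (r : R) : continuous f ->
  (forall t, r < `|t| -> f t = 0) -> exists2 B : R, 0 <= B & forall t, `|f t| <= B.
Proof.
move=> cf f0.
have [B [B0 fB]] : exists B : R, 0 <= B /\ forall t, `[- r, r]%classic t -> `|f t| <= B.
  apply: compact_within_bounded; first exact: segment_compact.
  exact: continuous_subspaceT.
exists B => // t; have [rt|tr] := ltP r `|t|; first by rewrite f0// normr0.
by apply: fB; rewrite /= in_itv/= -ler_norml.
Qed.

Context (h h' : R -> R) (r : R).
Hypothesis smooth_h : forall k, Ck1 k h.
Hypothesis h_ge0 : forall t, 0 <= h t.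
Hypothesis h_vanish : forall t, r <= `|t| -> h t = 0.
Hypothesis h_int : forall c, (\int[@lebesgue_measure R]_t (h (c - t))%:E = 1)%E.
Hypothesis r0 : 0 < r.
Hypothesis dh : forall t : R, is_derive t (1 : R) h (h' t).
Hypothesis ch' : continuous h'.

Let ch : continuous h. Proof. exact: (smooth_h 0). Qed.

Definition kernel (z : T) : R := \prod_i h (z ord0 i).
Definition dkernel l (z : T) : R := \prod_i (if i == l then h' else h) (z ord0 i).

Let continuous_comp_coord (f : R -> R) i : continuous f -> continuous (fun z : T => f (z ord0 i)).
Proof.
move=> cf y; apply: (@continuous_comp _ _ _ (fun y : T => y ord0 i) f); last exact: cf.
exact: continuous_coord.
Qed.

Lemma continuous_kernel : continuous kernel.
Proof. by apply: continuous_prod => i; exact: continuous_comp_coord. Qed.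

Lemma continuous_dkernel l : continuous (dkernel l).
Proof. by apply: continuous_prod => i; apply: continuous_comp_coord; case: ifP. Qed.

Lemma is_derive_kernel l z : is_derive z (axis l) kernel (dkernel l z).
Proof. exact: (@is_derive_prod _ _ (fun=> h) (fun=> h')). Qed.

Lemma dkernel_bounded l : exists B, forall z, `|dkernel l z| <= B.
Proof.
have [B B0 hB] : exists2 B : R, 0 <= B & forall t, `|h t| <= B.
  by apply: (vanishing_continuous_bounded (r := r)) => // t /ltW; exact: h_vanish.
(* At a point with r < |t|, strictly, h vanishes in a whole neighbourhood, and so does its
   derivative. *)
have [B' B0' hB'] : exists2 B : R, 0 <= B & forall t, `|h' t| <= B.
  apply: (vanishing_continuous_bounded (r := r)) => // t rt.
  have [_ <-] := dh t; rewrite (@near_eq_derive _ _ _ _ (cst 0)) ?derive_cst//.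
  have : \forall s \near t, r < `|s|.
    by apply: (cvgr_gt _ (cvg_norm (@cvg_id _ (nbhs t)))).
  by apply: filterS => s /ltW; exact: h_vanish.
exists (\prod_(i < d) Num.max B B') => z; rewrite normr_prod; apply: ler_prod => i _.
by rewrite normr_ge0/= le_max; case: ifP; rewrite ?hB ?hB' ?orbT.
Qed.

Lemma kernel_ge0 z : 0 <= kernel z.
Proof. by rewrite prodr_ge0. Qed.

(** Balls of row vectors are cubes, so a product of one-variable bumps of radius r is supported in a
    ball of the same radius. *)
Lemma kernel_support c y : kernel (c - y) != 0 -> ball c r y.
Proof.
move=> k0; split => // i j; rewrite (ord1 i); rewrite /ball/= ltNge; apply: contra k0 => /h_vanish hj.
by rewrite /kernel (bigD1 j)//= !mxE hj mul0r.
Qed.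

Lemma integral_kernel c : (\int[leb]_y (kernel (c - y))%:E = 1)%E.
Proof.
rewrite ge0_integral_rV_tuple; last by move=> y; exact: kernel_ge0.
  rewrite -[RHS](@integral_tuple_prod _ d (fun i t => h (c ord0 i - t))).
  - apply: eq_integral => t _; congr EFin; apply: eq_bigr => i _.
    by rewrite !mxE.
  - move=> i; apply: continuous_measurable_fun => t.
    apply: (@continuous_comp _ _ _ (fun t : R => c ord0 i - t) h); last exact: ch.
    by apply: cvgB; [exact: cvg_cst|exact: cvg_id].
  - by move=> i t; exact: h_ge0.
  - by move=> i; exact: h_int.
apply: measurable_continuous_rV => y.
apply: (@continuous_comp _ _ _ (fun y : T => c - y) kernel); last exact: continuous_kernel.
exact: continuous_reflection.
Qed.

Lemma is_derive_kernel_reflect l c y :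
  is_derive y (axis l) (fun y => kernel (c - y)) (- dkernel l (c - y)).
Proof.
have E : (fun y => kernel (c - y)) = (fun y : T => \prod_i (fun i t => h (-1 * t + c ord0 i)) i (y ord0 i)).
  by apply/funext => z; apply: eq_bigr => i _; rewrite !mxE mulN1r addrC.
rewrite E; have d1 (t : R) : is_derive t (1 : R) (fun t => h (-1 * t + c ord0 l)) (- h' (-1 * t + c ord0 l)).
  have := @is_derive1_comp R h (fun t : R => -1 * t + c ord0 l) t _ _ (dh _) (is_derive_affine (-1) (c ord0 l) t).
  by congr (is_derive _ _ _ _); rewrite mulrN1.
have := @is_derive_prod _ _ (fun i t => h (-1 * t + c ord0 i)) (fun i t => - h' (-1 * t + c ord0 i)) l y d1.
congr (is_derive _ _ _ _); rewrite /dkernel (bigD1 l)//= [in RHS](bigD1 l)//= eqxx -[in RHS]mulNr.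
congr (- h' _ * _); first by rewrite !mxE mulN1r addrC.
by apply: eq_bigr => i il; rewrite (negbTE il) !mxE mulN1r addrC.
Qed.

Lemma smooth_kernel_reflect c : smooth (fun y => kernel (c - y)).
Proof.
move=> k; have E : (fun y => kernel (c - y)) = (fun y : T => \prod_i (fun i t => h (-1 * t + c ord0 i)) i (y ord0 i)).
  by apply/funext => z; apply: eq_bigr => i _; rewrite !mxE mulN1r addrC.
by rewrite E; apply: (@Ck_prod _ _ k (fun i t => h (-1 * t + c ord0 i))) => i; exact: Ck1_affine.
Qed.

End product_kernel.

Section uniform_continuity.
Context {R : realType} {d : nat} (Omega : set 'rV[R]_d) {W : lmodType R}
  (form : {dot W for idfun}).
Local Notation T := 'rV[R]_d.

Lemma compact_uniformly_continuous_on (phi : T -> W) (tau : R) : compact Omega ->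
  continuous_on Omega form phi -> 0 < tau ->
  exists2 eta : R, 0 < eta & forall x y, Omega x -> Omega y -> ball x eta y ->
    dnorm form (phi y - phi x) <= tau.
Proof.
move=> /compact_near_coveringP ncO cphi tau0.
pose Q (eta : R) (x : T) := Omega x -> forall y, Omega y -> ball x eta y ->
  dnorm form (phi y - phi x) <= tau.
have : \forall eta \near (0 : R)^'+, Omega `<=` Q eta.
  apply: (ncO _ _ Q) => x Ox; have t2 : 0 < tau / 2 by rewrite divr_gt0.
  have : \forall y \near x, Omega y -> dnorm form (phi y - phi x) <= tau / 2.
    have /cvgrPdist_le/(_ _ t2) := cphi x Ox.
    by apply: filterS => y; rewrite sub0r normrN ger0_norm// dnorm_ge0.
  move=> /nbhs_ballP[delta /= delta0 xd]; have d2 : 0 < delta / 2 by rewrite divr_gt0.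
  exists (ball x (delta / 2), [set eta | eta < delta / 2]).
    by split; [exact: nbhsx_ballx|exact: nbhs_right_lt].
  move=> [x' eta] [/= xx' etad]; change (Q eta x') => Ox' y Oy x'y.
  have h1 : dnorm form (phi x' - phi x) <= tau / 2.
    by apply: xd => //; apply: le_ball xx'; rewrite ler_pdivrMr// ler_pMr// ler1n.
  have h2 : dnorm form (phi y - phi x) <= tau / 2.
    apply: xd => //; rewrite (splitr delta); apply: ball_triangle xx' _.
    by apply: le_ball x'y; exact: ltW.
  have -> : phi y - phi x' = (phi y - phi x) + - (phi x' - phi x) by rewrite opprB addrA subrK.
  by apply: le_trans (Defs.dnormD _ _ _) _; rewrite (splitr tau) Defs.dnormN; exact: lerD.
move=> H; have [eta [eta0 etaQ]] := filter_ex (filterI (nbhs_right_gt (0 : R)) H).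
exists eta => // x y Ox; exact: etaQ.
Qed.

End uniform_continuity.

Section mollification.
Context {R : realType} {d : nat} (Omega : set 'rV[R]_d) {V : vectType R}
  (form : {dot V for idfun}) (e : seq V).
Local Notation T := 'rV[R]_d.
Local Notation leb := (lebesgue_rV R d).
Hypothesis cptO : compact Omega.
Hypothesis convO : @convex_set R T Omega.
Hypothesis expand_e : forall w, w = \sum_(b <- e) form w b *: b.
Hypothesis ortho_e : {in e &, forall b b', form b b' = (b == b')%:R}.
Hypothesis uniq_e : uniq e.

Lemma form_basis_sum (a : V -> R) b : b \in e -> form (\sum_(c <- e) a c *: c) b = a b.
Proof.
move=> be; rewrite linear_sumlz (bigD1_seq b)//= big_seq_cond big1 ?addr0.
  by rewrite linearZl_LR/= ortho_e// eqxx mulr1.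
by move=> c /andP[ce cb]; rewrite linearZl_LR/= ortho_e// (negbTE cb) mulr0.
Qed.

Lemma dnorm_basis b : b \in e -> dnorm form b = 1.
Proof. by move=> be; rewrite /dnorm ortho_e// eqxx sqrtr1. Qed.

Lemma dnorm_le_coord (v : V) (t : R) : (forall b, b \in e -> `|form v b| <= t) ->
  dnorm form v <= t *+ size e.
Proof.
move=> vt; rewrite {1}(expand_e v); apply: le_trans (dnorm_sum _ _ _) _.
rewrite -[leRHS]addr0 -iter_addr -count_predT -big_const_seq big_seq [leRHS]big_seq; apply: ler_sum => b be.
by rewrite dnormZ dnorm_basis// mulr1 vt.
Qed.

(** A point y of the small ball is the convex combination eps z + (1 - eps) x, where z is obtained
    by magnifying the displacement of y from the contracted point by 1/eps and moving it to x0; z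
    then lies in the given ball. *)
Lemma convex_homothety_ball (x0 x : T) (rho eps : R) : ball x0 rho `<=` Omega -> Omega x ->
  0 < eps -> eps <= 1 -> ball (dilation x0 (1 - eps) x) (eps * rho) `<=` Omega.
Proof.
move=> bO Ox e0 e1 y by_.
pose z : T := x0 + eps^-1 *: (y - dilation x0 (1 - eps) x).
have Oz : Omega z.
  apply: bO; move: by_; rewrite -!ball_normE /= => h.
  rewrite opprD addrA subrr sub0r normrN normrZ gtr0_norm ?invr_gt0// mulrC.
  by rewrite ltr_pdivrMr// mulrC distrC mulrC [X in _ < X]mulrC.
have := convO (Itv01 (ltW e0) e1) (mem_set Oz) (mem_set Ox).
move=> /set_mem; congr (Omega _).
rewrite /z /dilation; apply/rowP => i; rewrite !mxE /=.
by rewrite /unstable.onem; field; rewrite gt_eqF.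
Qed.

Variables (x0 : T) (rho : R).
Hypotheses (rho0 : 0 < rho) (ballO : ball x0 rho `<=` Omega).

Section fixed_scale.
Variables (eps r : R) (h h' : R -> R).
Hypotheses (eps0 : 0 < eps) (eps1 : eps <= 1) (r0 : 0 < r) (r_eps : r < eps * rho).
Hypothesis smooth_h : forall k, Ck1 k h.
Hypothesis h_ge0 : forall t, 0 <= h t.
Hypothesis h_vanish : forall t, r <= `|t| -> h t = 0.
Hypothesis h_int : forall c, (\int[@lebesgue_measure R]_t (h (c - t))%:E = 1)%E.
Hypothesis dh : forall t : R, is_derive t (1 : R) h (h' t).
Hypothesis ch' : continuous h'.
Local Notation s := (1 - eps).
Local Notation dil := (dilation x0 s).
Local Notation kap := (kernel (d := d) h).
Local Notation dkap := (dkernel (d := d) h h').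

Definition mollify (phi : T -> V) x : V :=
  \sum_(b <- e) conv_kernel Omega x0 s (fun y => form (phi y) b) kap x *: b.

Definition mollify_gradient (phi : T -> V) x : {ffun 'I_d -> V} :=
  [ffun l => \sum_(b <- e) (s * conv_kernel Omega x0 s (fun y => form (phi y) b) (dkap l) x) *: b].

Let ck : continuous kap. Proof. exact: continuous_kernel. Qed.
Let cdk l : continuous (dkap l). Proof. exact: continuous_dkernel. Qed.

Let ckr x : continuous (fun y => kap (dil x - y)).
Proof.
move=> y; apply: (@continuous_comp _ _ _ (fun y : T => dil x - y) kap); last exact: ck.
exact: continuous_reflection.
Qed.

Lemma form_mollify phi x b : b \in e ->
  form (mollify phi x) b = conv_kernel Omega x0 s (fun y => form (phi y) b) kap x.
Proof. exact: (form_basis_sum (fun b => conv_kernel Omega x0 s (fun y => form (phi y) b) kap x)). Qed.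

Lemma form_mollify_gradient phi x l b : b \in e ->
  form (mollify_gradient phi x l) b =
  s * conv_kernel Omega x0 s (fun y => form (phi y) b) (dkap l) x.
Proof.
rewrite ffunE.
exact: (form_basis_sum (fun b => s * conv_kernel Omega x0 s (fun y => form (phi y) b) (dkap l) x)).
Qed.

Lemma mollify_C1 phi : continuous_on Omega form phi ->
  C1_with_gradient Omega form e (mollify phi) (mollify_gradient phi).
Proof.
move=> cphi; have cf b := continuous_on_form (u := b) cphi; split.
- apply: continuous_on_sum => b; apply: continuous_onZ.
  by apply: continuous_subspaceT; exact: continuous_conv_kernel.
- have cg l b : {within Omega, continuous (fun x =>
      s * conv_kernel Omega x0 s (fun y => form (phi y) b) (dkap l) x)}.
    apply: within_mul; first exact: within_cst.
    by apply: continuous_subspaceT; exact: continuous_conv_kernel.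
  have -> : mollify_gradient phi = fun x => \sum_(l < d) \sum_(b <- e)
      (s * conv_kernel Omega x0 s (fun y => form (phi y) b) (dkap l) x) *:
      [ffun k => if k == l then b else 0].
    apply/funext => x; apply/ffunP => k; rewrite ffunE sum_ffunE (bigD1 k)//= [X in _ = _ + X]big1 ?addr0.
      by rewrite sum_ffunE; apply: eq_bigr => b _; rewrite !ffunE eqxx.
    by move=> l lk; rewrite sum_ffunE big1// => b _; rewrite !ffunE eq_sym (negbTE lk) scaler0.
  by apply: continuous_on_sum => l; apply: continuous_on_sum => b; exact: continuous_onZ.
- move=> x l b Ox be; rewrite form_mollify_gradient//.
  have -> : (fun y => form (mollify phi y) b) = conv_kernel Omega x0 s (fun y => form (phi y) b) kap.
    by apply/funext => y; rewrite form_mollify.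
  have [B dB] := dkernel_bounded smooth_h h_vanish dh ch' l.
  by apply: is_derive_conv_kernel dB => //; exact: is_derive_kernel.
Qed.

Lemma kernel_support_Omega x y : Omega x -> kap (dil x - y) != 0 -> Omega y.
Proof.
move=> Ox /(kernel_support h_vanish r0) bx; apply: (convex_homothety_ball ballO Ox eps0 eps1).
by apply: le_ball bx; exact: ltW.
Qed.

(** The kernel centred at the contracted point is supported inside Omega even when x is a boundary
    point, so integrating over Omega only loses no mass. *)
Lemma integral_kernel_Omega x : Omega x -> (\int[leb]_(y in Omega) (kap (dil x - y))%:E = 1)%E.
Proof.
move=> Ox; rewrite -[RHS](integral_kernel smooth_h h_ge0 h_int (dil x)).
rewrite integral_mkcond; apply: eq_integral => y _; rewrite patchE.
case: ifPn => // /negP nO; congr EFin; apply/eqP; rewrite eq_sym; apply: contrapT => /negP k0.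
by apply: nO; apply/mem_set; exact: kernel_support_Omega k0.
Qed.

(** Since the kernel has unit mass on Omega, each component of the difference is an average of
    components of phi y - phi x over points y close to x. The factor [size e] is the price of
    estimating coordinate by coordinate. *)
Lemma mollify_close phi eta tau x : continuous_on Omega form phi ->
  (forall y, Omega y -> ball x eta y -> dnorm form (phi y - phi x) <= tau) ->
  (forall y, ball (dil x) r y -> ball x eta y) -> 0 <= tau -> Omega x ->
  dnorm form (mollify phi x - phi x) <= tau *+ size e.
Proof.
move=> cphi phi_tau brx tau0 Ox; apply: dnorm_le_coord => b be.
have lO := lebesgue_rV_compact cptO.
have cf := continuous_on_form (u := b) cphi.
have k1 := integral_kernel_Omega Ox.
have ckx : {within Omega, continuous (fun y => kap (dil x - y))}.
  by apply: continuous_subspaceT; exact: ckr.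
have ikZ (a : R) : a = \int[leb]_(y in Omega) (a * kap (dil x - y)).
  rewrite RintegralZl; first by rewrite /Rintegral k1 mulr1.
    exact: compact_measurable_rV.
  exact: integrable_within_continuous.
have E : form (mollify phi x - phi x) b =
    \int[leb]_(y in Omega) ((form (phi y) b - form (phi x) b) * kap (dil x - y)).
  rewrite linearBl/= form_mollify// [form (phi x) b in LHS]ikZ /conv_kernel -RintegralB//.
  - by apply: eq_Rintegral => y _; rewrite mulrBl.
  - exact: compact_measurable_rV.
  - exact: integrable_kernel.
  - by apply: integrable_within_continuous => //; apply: within_mul => //; exact: within_cst.
have c1 : {within Omega, continuous (fun y => (form (phi y) b - form (phi x) b) * kap (dil x - y))}.
  by apply: within_mul => //; apply: within_sub => //; exact: within_cst.
rewrite E; apply: le_trans (le_normr_Rintegral _ (integrable_within_continuous lO cptO c1)) _.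
  exact: compact_measurable_rV.
rewrite [leRHS]ikZ.
apply: le_Rintegral.
- exact: compact_measurable_rV.
- by apply: integrable_within_continuous => //; exact: within_norm.
- by apply: integrable_within_continuous => //; apply: within_mul => //; exact: within_cst.
move=> y Oy; rewrite normrM -linearBl (ger0_norm (kernel_ge0 _ _))//.
have [->|k0] := eqVneq (kap (dil x - y)) 0; first by rewrite !mulr0.
apply: ler_wpM2r; first exact: kernel_ge0.
apply: le_trans (dot_CauchySchwarz _ _ _) _; rewrite (dnorm_basis be) mulr1.
by apply: phi_tau => //; apply: brx; exact: (kernel_support h_vanish r0).
Qed.

Section gradient_field.
Variables (x : T) (w : {ffun 'I_d -> V}).
Hypothesis Ox : Omega x.

(** The test field that probes the weak gradient at x in the direction w. The sign cancels the one
    from the reflection y |-> dil x - y, so s times the integral of phi against its divergence is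
    the product of [mollify_gradient] at x with w, whereas its norm has integral |w|. *)
Let field (y : T) : {ffun 'I_d -> V} := - kap (dil x - y) *: w.

Let form_field y l b : form (field y l) b = - form (w l) b * kap (dil x - y).
Proof. by rewrite ffunE linearZl_LR/= mulNr mulrC mulNr. Qed.

Let derive_field y l b :
  is_derive y (axis l) (fun y => form (field y l) b) (form (w l) b * dkap l (dil x - y)).
Proof.
rewrite (_ : (fun y => _) = fun y => - form (w l) b * kap (dil x - y)); last first.
  by apply/funext => z; exact: form_field.
have := is_deriveZ (- form (w l) b) (is_derive_kernel_reflect dh l (dil x) y).
by congr (is_derive _ _ _ _); rewrite [_ *: _]mulrNN.
Qed.

(** The gap between r and eps rho absorbs the closure, so the support lies in an open ball contained
    in Omega, hence in the interior. *)
Let field_support : closure [set y | field y != 0] `<=` ball (dil x) (eps * rho).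
Proof.
have er : 0 < eps * rho - r by rewrite subr_gt0.
move=> y /(_ _ (nbhsx_ballx y _ er))[z [/= fz yz]].
have bz : ball (dil x) r z.
  apply: (kernel_support h_vanish r0); apply: contraNN fz => /eqP k0.
  by rewrite /field k0 oppr0 scale0r.
have -> : eps * rho = r + (eps * rho - r) by rewrite addrC subrK.
by apply: (ball_triangle bz); exact: ball_sym.
Qed.

Let test_field_kernel : test_field Omega form e field.
Proof.
have sub : closure [set y | field y != 0] `<=` Omega.
  by apply: subset_trans (field_support) _; exact: (convex_homothety_ball ballO Ox eps0 eps1).
split.
- move=> l b _; rewrite (_ : (fun y => _) = fun y => - form (w l) b * kap (dil x - y)); last first.
    by apply/funext => z; exact: form_field.
  by move=> k; apply: CkZ; exact: smooth_kernel_reflect.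
- by apply: (subclosed_compact (@closed_closure _ _) cptO).
- move=> y /field_support yb; apply: (interiorS (convex_homothety_ball ballO Ox eps0 eps1)).
  have /interior_id -> // : open (ball (dil x) (eps * rho)).
  by apply: ball_open; rewrite mulr_gt0.
Qed.

Lemma mollify_gradient_dot phi : continuous_on Omega form phi ->
  (gradient_norm Omega form e phi <= 1)%E -> dnorm (dot_pow d form) w <= 1 ->
  dot_pow d form (mollify_gradient phi x) w <= 1.
Proof.
move=> cphi gphi w1; have cf b := continuous_on_form (u := b) cphi.
have lO := lebesgue_rV_compact cptO.
have vdivE y : form (phi y) (vdiv form e field y) =
    \sum_(b <- e) \sum_(l < d) form (w l) b * (form (phi y) b * dkap l (dil x - y)).
  rewrite form_vdivE; apply: eq_bigr => b _; apply: eq_bigr => l _.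
  by have [_ ->] := derive_field y l b; rewrite mulrCA.
have cterm b l : {within Omega, continuous (fun y => form (phi y) b * dkap l (dil x - y))}.
  by apply: within_kernel.
have cterm' b l : {within Omega, continuous
    (fun y => form (w l) b * (form (phi y) b * dkap l (dil x - y)))}.
  by apply: within_mul => //; exact: within_cst.
have E : (\int[leb]_(y in Omega) (form (phi y) (vdiv form e field y))%:E =
    (\sum_(b <- e) \sum_(l < d) form (w l) b *
       conv_kernel Omega x0 s (fun y => form (phi y) b) (dkap l) x)%:E)%E.
  under eq_integral do rewrite vdivE.
  rewrite EFin_Rintegral_within//; last first.
    by apply: within_sum => b; apply: within_sum => l.
  congr EFin; rewrite Rintegral_within_sum//; last by move=> b; apply: within_sum => l.
  apply: eq_bigr => b _; rewrite Rintegral_within_sum//; apply: eq_bigr => l _.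
  rewrite RintegralZl//; first exact: compact_measurable_rV.
  exact: integrable_within_continuous.
have bound : \sum_(b <- e) \sum_(l < d) form (w l) b *
    conv_kernel Omega x0 s (fun y => form (phi y) b) (dkap l) x <= 1.
  rewrite -lee_fin -E; apply: le_trans gphi; apply: ereal_sup_ubound; exists field => //; split => //.
  have -> : (1%:E = \int[leb]_(y in Omega) (kap (dil x - y))%:E)%E by rewrite integral_kernel_Omega.
  have dn y : dnorm (dot_pow d form) (field y) <= kap (dil x - y).
    by rewrite /field dnormZ normrN ger0_norm ?kernel_ge0// ler_piMr// kernel_ge0.
  apply: ge0_le_integral => //.
  - exact: compact_measurable_rV.
  - by move=> y _; rewrite lee_fin dnorm_ge0.
  - apply/measurable_EFinP; rewrite (_ : (fun y => _) =
      (fun y => kap (dil x - y) * dnorm (dot_pow d form) w)); last first.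
      by apply/funext => y; rewrite /field dnormZ normrN ger0_norm ?kernel_ge0.
    by apply: measurable_funM; [exact: measurable_continuous_rV|exact: measurable_cst].
  - by apply/measurable_EFinP; exact: measurable_continuous_rV.
  - by move=> y _; rewrite lee_fin.
rewrite (dot_powE expand_e).
have -> : \sum_(b <- e) \sum_(l < d) form (mollify_gradient phi x l) b * form (w l) b =
    s * \sum_(b <- e) \sum_(l < d) form (w l) b *
    conv_kernel Omega x0 s (fun y => form (phi y) b) (dkap l) x.
  rewrite mulr_sumr big_seq [RHS]big_seq; apply: eq_bigr => b be.
  rewrite mulr_sumr; apply: eq_bigr => l _; rewrite form_mollify_gradient//.
  by rewrite mulrAC mulrA.
(* The contraction factor s lies in [0, 1], so it does not spoil the bound. *)
apply: le_trans (_ : s * 1 <= 1); last by rewrite mulr1 gerBl ltW.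
by apply: ler_wpM2l => //; rewrite subr_ge0.
Qed.

End gradient_field.

Lemma mollify_gradient_le1 phi x : Omega x -> continuous_on Omega form phi ->
  (gradient_norm Omega form e phi <= 1)%E ->
  dnorm (dot_pow d form) (mollify_gradient phi x) <= 1.
Proof.
move=> Ox cphi gphi; rewrite leNgt; apply/negP => N1.
pose w := mollify_gradient phi x; pose N := dnorm (dot_pow d form) w.
rewrite -/w -/N in N1.
have N0 : 0 < N by apply: lt_trans N1.
(* Testing with the normalised gradient itself returns its norm. *)
have := mollify_gradient_dot (w := N^-1 *: w) Ox cphi gphi.
rewrite dnormZ gtr0_norm ?invr_gt0// mulVf ?gt_eqF// => /(_ (lexx _)).
by rewrite linearZr_LR/= -/w -sqr_dnorm -/N expr2 mulKf ?gt_eqF// leNgt N1.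
Qed.

End fixed_scale.

Lemma C1_approximation phi tau : continuous_on Omega form phi ->
  (gradient_norm Omega form e phi <= 1)%E -> 0 < tau ->
  exists Phi G, [/\ C1_with_gradient Omega form e Phi G,
    forall x, Omega x -> dnorm (dot_pow d form) (G x) <= 1 &
    forall x, Omega x -> dnorm form (Phi x - phi x) <= tau].
Proof.
move=> cphi gphi tau0.
(* Compensates the factor [size e] of [mollify_close]; the successor avoids division by zero when
   the basis is empty. *)
pose t := tau / (size e).+1%:R; have t0 : 0 < t by rewrite divr_gt0.
have [eta eta0 phi_eta] := compact_uniformly_continuous_on cptO cphi t0.
have [M [M0 xM]] : exists M : R, 0 <= M /\ forall x : T, Omega x -> `|x - x0| <= M.
  have [M [M0 OM]] : exists M : R, 0 <= M /\ forall x : T, Omega x -> `| `|x - x0| | <= M.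
    apply: compact_within_bounded => //; apply: continuous_subspaceT => x.
    apply: (@cvg_norm _ _ _ (nbhs x)).
    apply: (@cvgB _ _ _ (nbhs x) _ id (fun=> x0)); first exact: (@cvg_id _ (nbhs x)).
    exact: (@cvg_cst _ x0 _ (nbhs x)).
  by exists M; split => // x /OM; rewrite normr_id.
have D0 : 0 < rho + M + 1 by rewrite ltr_wpDl// addr_ge0// ltW.
(* The kernel at x sees only points y with |x - y| < eps M + eps rho: the contraction moves x by at
   most eps M, and the radius of the kernel is below eps rho. This choice makes the sum at most eta,
   and the minimum with 1 keeps the convex combinations legitimate. *)
pose eps := Num.min 1 (eta / (rho + M + 1)).
have eps0 : 0 < eps by rewrite lt_min ltr01 divr_gt0.
have eps1 : eps <= 1 by rewrite ge_min lexx.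
have epsD : eps * (rho + M + 1) <= eta by rewrite -ler_pdivlMr// ge_min lexx orbT.
have er : 0 < eps * rho by rewrite mulr_gt0.
pose r := eps * rho / 2; have r0 : 0 < r by rewrite divr_gt0.
have rer : r < eps * rho by rewrite ltr_pdivrMr// ltr_pMr// ltr1n.
have [h [sh h0 hv hi]] := exists_bump r0.
have [h' [dh ch']] : exists h' : R -> R, (forall t : R, is_derive t (1 : R) h (h' t)) /\ continuous h'.
  by have [h' [dh ch']] := sh 1%N; exists h'.
exists (mollify eps h phi), (mollify_gradient eps h h' phi); split.
- exact: (mollify_C1 _ sh hv dh ch').
- by move=> x Ox; exact: (mollify_gradient_le1 eps0 eps1 r0 rer sh h0 hv hi dh ch').
move=> x Ox; apply: (@le_trans _ _ (t *+ size e)); last first.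
  rewrite -mulr_natr /t mulrAC ler_pdivrMr ?ltr0Sn//; apply: ler_wpM2l; first exact: ltW.
  by rewrite ler_nat.
apply: (mollify_close eps0 eps1 r0 rer sh h0 hv hi (eta := eta)) => //; last exact: ltW.
- by move=> y Oy; exact: phi_eta.
move=> y; rewrite -!ball_normE /= => xy.
have -> : x - y = eps *: (x - x0) + (dilation x0 (1 - eps) x - y).
  by rewrite /dilation; apply/rowP => i; rewrite !mxE; ring.
apply: le_lt_trans (ler_normD _ _) _; rewrite normrZ gtr0_norm//.
apply: (@lt_le_trans _ _ (eps * M + eps * rho)).
  by apply: ler_ltD; [apply: ler_wpM2l; [exact: ltW|exact: xM]|exact: lt_trans xy rer].
apply: le_trans epsD; rewrite -mulrDr; apply: ler_wpM2l; first exact: ltW.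
by rewrite [M + rho]addrC lerDl.
Qed.

End mollification.

(** * Duality *)

Section orthonormal_basis_pow.
Context {R : realType} (d : nat) {V : vectType R} (form : {dot V for idfun}) (e : seq V).
Hypothesis expand_e : forall w, w = \sum_(b <- e) form w b *: b.
Hypothesis ortho_e : {in e &, forall b b', form b b' = (b == b')%:R}.
Hypothesis uniq_e : uniq e.

Let single (l : 'I_d) (b : V) : {ffun 'I_d -> V} := [ffun k => if k == l then b else 0].

Let dot_single w l b : dot_pow d form w (single l b) = form (w l) b.
Proof.
rewrite [LHS](bigD1 l)//= ffunE eqxx big1 ?addr0// => k kl.
by rewrite ffunE (negbTE kl) linear0r.
Qed.

Let basis_neq0 b : b \in e -> b != 0.
Proof.
move=> be; apply/eqP => b0; have /eqP := ortho_e be be.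
by rewrite eqxx b0 linear0l eq_sym oner_eq0.
Qed.

Let single_inj l b l' b' : b \in e -> single l b = single l' b' -> l = l' /\ b = b'.
Proof.
move=> be /ffunP/(_ l); rewrite !ffunE eqxx; case: eqP => [-> //|_ b0].
by have := basis_neq0 be; rewrite b0 eqxx.
Qed.

Lemma expand_basis_pow w : w = \sum_(c <- basis_pow d e) dot_pow d form w c *: c.
Proof.
rewrite big_allpairs_dep/= big_enum/=; apply/ffunP => k; rewrite sum_ffunE (bigD1 k)//=.
rewrite [X in _ = _ + X]big1 ?addr0 => [|l lk]; last first.
  by rewrite sum_ffunE big1// => b _; rewrite !ffunE eq_sym (negbTE lk) scaler0.
rewrite sum_ffunE {1}(expand_e (w k)); apply: eq_bigr => b _.
by rewrite [in RHS]ffunE ffunE eqxx dot_single.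
Qed.

Lemma ortho_basis_pow :
  {in basis_pow d e &, forall c c', dot_pow d form c c' = (c == c')%:R}.
Proof.
move=> _ _ /allpairsP[[l b] [_ /= be ->]] /allpairsP[[l' b'] [_ /= be' ->]].
rewrite -!/(single _ _) dot_single ffunE.
have -> : (single l b == single l' b') = (l == l') && (b == b').
  apply/eqP/andP => [/(single_inj be)[-> ->]|[/eqP-> /eqP->]]; by rewrite ?eqxx.
by rewrite eq_sym; case: eqP => [_|_]; [rewrite ortho_e|rewrite linear0l].
Qed.

Lemma uniq_basis_pow : uniq (basis_pow d e).
Proof.
apply: allpairs_uniq => //; first exact: enum_uniq.
move=> _ _ /allpairsP[[l b] [_ /= be ->]] /allpairsP[[l' b'] [_ /= be' ->]] /=.
by move=> /(single_inj be)[-> ->].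
Qed.

End orthonormal_basis_pow.

Lemma orthonormal_uniq (R : realType) (V : vectType R) (form : {dot V for idfun}) (e : seq V) :
  orthonormal form e ->
  uniq e /\ {in e &, forall b b', form b b' = (b == b')%:R}.
Proof.
elim: e => [//|v e ih] /andP[/= /andP[/eqP v1 e1] /andP[]]; rewrite /ortho_rec /= andbT => /allP ve pe.
have [ue oe] := ih (introT andP (conj e1 pe)).
have ne : v \notin e.
  by apply/negP => /ve /=; rewrite v1 oner_eq0.
split; first by rewrite ne.
have neq b : b \in e -> (v == b) = false.
  by move=> be; apply/eqP => vb; move: ne; rewrite vb be.
move=> b b'; rewrite !inE => /orP[/eqP->|be] /orP[/eqP->|be'].
- by rewrite eqxx.
- by rewrite neq// (eqP (ve _ be')).
- by rewrite Defs.dotC eq_sym neq// (eqP (ve _ be)).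
- exact: oe.
Qed.

Lemma expand_orthonormal_basis (R : realType) (V : vectType R) (form : {dot V for idfun})
    n (e : n.-tuple V) : basis_of fullv e -> orthonormal form e ->
  forall w, w = \sum_(b <- e) form w b *: b.
Proof.
move=> be ho w; have [ue oe] := orthonormal_uniq ho.
have E := coord_basis be (memvf w); rewrite {1}E [RHS](big_nth 0) size_tuple big_mkord; apply: eq_bigr => i _.
congr (_ *: _); rewrite [in RHS]E linear_sumlz (bigD1 i)//= big1 ?addr0.
  by rewrite linearZl_LR/= oe ?mem_nth ?size_tuple// eqxx mulr1.
move=> j ji; rewrite linearZl_LR/= oe ?mem_nth ?size_tuple//.
by rewrite nth_uniq ?size_tuple// -(inj_eq val_inj) in ji *; rewrite (negbTE ji) mulr0.
Qed.

Section sup_norm.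
Context {R : realType} {d : nat} (Omega : set 'rV[R]_d) {W : lmodType R}
  (form : {dot W for idfun}).
Local Notation T := 'rV[R]_d.
Local Notation cont := (continuous_on Omega form).
Hypothesis cptO : compact Omega.
Hypothesis O0 : Omega !=set0.

(** A supremum in the real numbers, meaningful only for bounded functions; continuity on the compact
    Omega is therefore assumed wherever it has to be an upper bound. *)
Definition sup_dnorm (phi : T -> W) : R := sup [set dnorm form (phi x) | x in Omega].

Lemma dnorm_le_sup phi x : cont phi -> Omega x -> dnorm form (phi x) <= sup_dnorm phi.
Proof.
move=> cphi Ox; apply: ub_le_sup; last by exists x.
have [M [_ phiM]] := continuous_on_bounded cptO cphi.
by exists M => _ [y Oy <-]; exact: phiM.
Qed.

Lemma sup_dnorm_le phi B : (forall x, Omega x -> dnorm form (phi x) <= B) ->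
  sup_dnorm phi <= B.
Proof.
move=> phiB; apply: ge_sup; last by move=> _ [y Oy <-]; exact: phiB.
by have [x Ox] := O0; exists (dnorm form (phi x)), x.
Qed.

Lemma sup_dnorm_ge0 phi : cont phi -> 0 <= sup_dnorm phi.
Proof.
by have [x Ox] := O0 => /dnorm_le_sup/(_ Ox); apply: le_trans; exact: dnorm_ge0.
Qed.

Lemma sup_dnormD phi psi : cont phi -> cont psi ->
  sup_dnorm (fun x => phi x + psi x) <= sup_dnorm phi + sup_dnorm psi.
Proof.
move=> c1 c2; apply: sup_dnorm_le => x Ox; apply: le_trans (Defs.dnormD _ _ _) _.
by apply: lerD; exact: dnorm_le_sup.
Qed.

Let sup_dnormZ_le (a : R) phi : 0 <= a -> cont phi ->
  sup_dnorm (fun x => a *: phi x) <= a * sup_dnorm phi.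
Proof.
move=> a0 c1; apply: sup_dnorm_le => x Ox; rewrite dnormZ ger0_norm//.
by apply: ler_wpM2l => //; exact: dnorm_le_sup.
Qed.

Lemma sup_dnormZ (a : R) phi : 0 <= a -> cont phi ->
  sup_dnorm (fun x => a *: phi x) = a * sup_dnorm phi.
Proof.
move=> a0 c1; have c2 := continuous_on_scale a c1; apply/eqP; rewrite eq_le.
rewrite sup_dnormZ_le//= ; have [->|an0] := eqVneq a 0.
  by rewrite mul0r; apply: sup_dnorm_ge0; exact: continuous_on_scale.
have ap : 0 < a by rewrite lt0r an0.
rewrite -ler_pdivlMl//; apply: le_trans (sup_dnormZ_le _ c2); last by rewrite invr_ge0.
apply: sup_dnorm_le => x Ox; rewrite -[phi x]scale1r -(mulVf an0) -scalerA.
by apply: (@dnorm_le_sup (fun x => a^-1 *: (a *: phi x))) => //; exact: continuous_on_scale.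
Qed.

End sup_norm.

Section duality.
Context {R : realType} {d : nat} (Omega : set 'rV[R]_d) {V : vectType R}
  (form : {dot V for idfun}) (e : seq V) (lambda : R).
Local Notation T := 'rV[R]_d.
Local Notation M := (vmeasure Omega form).
Local Notation Md := (vmeasure Omega (dot_pow d form)).
Local Notation C1 := (C1_with_gradient Omega form e).
Hypothesis cptO : compact Omega.
Hypothesis convO : @convex_set R T Omega.
Hypothesis intO : Omega° !=set0.
Hypothesis expand_e : forall w, w = \sum_(b <- e) form w b *: b.
Hypothesis ortho_e : {in e &, forall b b', form b b' = (b == b')%:R}.
Hypothesis uniq_e : uniq e.
Hypothesis lambda0 : 0 < lambda.
Implicit Types (mu nu delta : M) (sigma : Md).

Let vadd := @vintegral_addm R d Omega V form cptO.
Let vopp := @vintegral_oppm R d Omega V form cptO.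

Lemma W1_le_tv mu nu delta sigma : div_eq e sigma (vm_add (vm_sub mu nu) delta) ->
  (W1 e (vm_add mu delta) nu <= tv_norm (basis_pow d e) sigma)%E.
Proof.
move=> dsigma; apply: ub_ereal_sup => _ [phi [cphi gphi] <-].
have [x0 [rho /= rho0 ballO]] : exists x0, exists2 rho : R, 0 < rho & ball x0 rho `<=` Omega.
  by have [x0 /nbhs_ballP[rho rho0 bO]] := intO; exists x0, rho.
have := tv_norm_fin cptO (basis_pow d e) sigma.
set tv := tv_norm _ _ => tvfin; rewrite -(fineK tvfin) lee_fin.
set m := vm_sub nu _; have [K [K0 Km]] := vintegral_bounded cptO e m.
apply/ler_addgt0Pr => eps eps0.
(* Uniform accuracy that changes the pairing with [m] by at most eps; adding 1 covers K = 0. *)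
have t0 : 0 < eps / (K + 1) by rewrite divr_gt0// ltr_wpDl.
have [Phi [G [C1PG G1 Phi_phi]]] :=
  C1_approximation cptO convO expand_e ortho_e uniq_e rho0 ballO cphi gphi t0.
have [cPhi cG _] := C1PG.
(* [m] is the opposite of the right-hand side of the divergence constraint, which cancels the minus
   sign of the weak formulation. *)
have PhiG : vintegral e Phi m = vintegral (basis_pow d e) G sigma.
  have := dsigma _ _ C1PG; rewrite /m /vm_sub !(vadd, vopp)// => h.
  by rewrite -[RHS]opprK h; ring.
have close : vintegral e phi m - vintegral e Phi m <= eps.
  have := vintegral_lin cptO e m (-1) cPhi cphi; rewrite mulN1r addrC => <-.
  apply: le_trans (ler_norm _) _; apply: le_trans (_ : K * (eps / (K + 1)) <= _).
    apply: Km => [|x Ox]; first exact: continuous_on_lin.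
    by rewrite scaleN1r -Defs.dnormN opprD opprK; exact: Phi_phi.
  by rewrite mulrCA ger_pMr// ler_pdivrMr ?ltr_wpDl// mul1r lerDl.
have le_tv : vintegral e Phi m <= fine tv.
  by rewrite -lee_fin fineK// PhiG; exact: vintegral_le_tv.
by rewrite -(subrK (vintegral e Phi m) (vintegral e phi m)) addrC; exact: lerD.
Qed.

Lemma T11_le_transport mu nu delta sigma : div_eq e sigma (vm_add (vm_sub mu nu) delta) ->
  (T11 e lambda mu nu <= tv_norm (basis_pow d e) sigma + lambda%:E * tv_norm e delta)%E.
Proof.
move=> dsigma; apply: le_trans (ereal_inf_lbound _) _; first by exists delta.
by apply: leeD => //; exact: W1_le_tv.
Qed.

Definition dual_value mu nu : \bar R :=
  ereal_sup [set (vintegral e phi (vm_sub nu mu))%:E | phi in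
    [set phi | exists2 g, C1 phi g &
      forall x, Omega x -> dnorm (dot_pow d form) (g x) <= 1 /\ dnorm form (phi x) <= lambda]].

Lemma vintegralZ (W : lmodType R) (f : {dot W for idfun}) (es : seq W)
    (m : vmeasure Omega f) (a : R) phi :
  continuous_on Omega f phi -> vintegral es (fun x => a *: phi x) m = a * vintegral es phi m.
Proof.
move=> cphi; have c0 : continuous_on Omega f (fun=> 0) by exact: continuous_on_cst.
have v0 : vintegral es (fun=> 0) m = 0.
  have := vintegral_lin cptO es m (-1) c0 c0; rewrite mulN1r addNr => <-.
  by apply: eq_vintegral => x _; rewrite scaler0 addr0.
have := vintegral_lin cptO es m a cphi c0; rewrite v0 addr0 => <-.
by apply: eq_vintegral => x _; rewrite addr0.
Qed.

Lemma dual_value_le_T11 mu nu : (dual_value mu nu <= T11 e lambda mu nu)%E.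
Proof.
apply: le_ereal_inf_tmp => _ [delta _ <-]; apply: ub_ereal_sup => _ [phi [g C1phi phi_le] <-].
have [cphi cg _] := C1phi.
have -> : vintegral e phi (vm_sub nu mu) =
    vintegral e phi (vm_sub nu (vm_add mu delta)) + vintegral e phi delta.
  by rewrite /vm_sub !(vadd, vopp)//; ring.
rewrite EFinD; apply: leeD.
  apply: ereal_sup_ubound; exists phi => //; split => //.
  by apply: (gradient_norm_le1 cptO expand_e C1phi) => x /phi_le[].
have -> : vintegral e phi delta = lambda * vintegral e (fun x => lambda^-1 *: phi x) delta.
  by rewrite vintegralZ// mulVKf// gt_eqF.
rewrite EFinM; apply: lee_wpmul2l; first by rewrite lee_fin ltW.
apply: vintegral_le_tv => [|x /phi_le[_ h]]; first exact: continuous_on_scale.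
by rewrite dnormZ gtr0_norm ?invr_gt0// ler_pdivrMl// mulr1.
Qed.

Let O0 : Omega !=set0.
Proof. by have [x /interior_subset Ox] := intO; exists x. Qed.

Let contd := continuous_on Omega (dot_pow d form).
Let cont := continuous_on Omega form.

Lemma C1_lin (a : R) phi psi g h : C1 phi g -> C1 psi h ->
  C1 (fun x => a *: phi x + psi x) (fun x => a *: g x + h x).
Proof.
move=> [c1 c2 dphi] [c1' c2' dpsi]; split; [exact: continuous_on_lin|exact: continuous_on_lin|].
move=> x l b Ox be; have d1 := is_deriveZ a (dphi x l b Ox be).
have := is_deriveD d1 (dpsi x l b Ox be).
congr (is_derive _ _ _ _); last by rewrite !ffunE linearDl linearZl_LR.
by apply/funext => y; rewrite linearDl linearZl_LR.
Qed.

Lemma C1_0 : C1 (fun=> 0) (fun=> 0).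
Proof.
split; [exact: continuous_on_cst|exact: continuous_on_cst|].
move=> x l b _ _; rewrite ffunE !linear0l; exact: is_derive_cst.
Qed.

Lemma dual_value_fin mu nu : exists2 D : R, 0 <= D & dual_value mu nu = D%:E.
Proof.
have [K [K0 Km]] := vintegral_bounded cptO e (vm_sub nu mu).
have ge0 : (0%:E <= dual_value mu nu)%E.
  apply: ereal_sup_ubound; exists (fun=> 0).
    exists (fun=> 0); first exact: C1_0.
    by move=> x Ox; rewrite !dnorm0 ler01 ltW.
  have c0 : cont (fun=> 0) by exact: continuous_on_cst.
  congr EFin; rewrite -[RHS](mul0r (vintegral e (fun=> 0) (vm_sub nu mu))) -vintegralZ//.
  by apply: eq_vintegral => x _; rewrite scale0r.
have leK : (dual_value mu nu <= (K * lambda)%:E)%E.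
  apply: ub_ereal_sup => _ [phi [g [cphi _ _] phi_le] <-]; rewrite lee_fin.
  by apply: le_trans (ler_norm _) _; apply: Km => // x /phi_le[].
have fin : dual_value mu nu \is a fin_num.
  by rewrite ge0_fin_numE//; apply: le_lt_trans leK _; exact: ltry.
by exists (fine (dual_value mu nu)); [rewrite -lee_fin fineK|rewrite fineK].
Qed.

Lemma dual_attained mu nu : exists sigma delta,
  div_eq e sigma (vm_add (vm_sub mu nu) delta) /\
  (tv_norm (basis_pow d e) sigma + lambda%:E * tv_norm e delta <= dual_value mu nu)%E.
Proof.
have [D D0 DE] := dual_value_fin mu nu.
(* Pairs of functions on the whole of R^d; continuity on Omega is the predicate S, which is why the
   extension theorem is stated relative to a subspace. F consists of the pairs made of a gradient
   and its C^1 function. *)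
pose E : lmodType R := ((T -> {ffun 'I_d -> V}) * (T -> V))%type.
pose S : set E := [set z | contd z.1 /\ cont z.2].
pose F : set E := [set z | C1 z.2 z.1].
pose f (z : E) : R := vintegral e z.2 (vm_sub nu mu).
pose N (z : E) : R := Num.max (sup_dnorm Omega (dot_pow d form) z.1)
  (lambda^-1 * sup_dnorm Omega form z.2).
have l0 : 0 < lambda^-1 by rewrite invr_gt0.
have FS : F `<=` S by move=> [g phi] [].
have subS : subspace_set S.
  split; first by split; exact: continuous_on_cst.
  by move=> a x y [x1 x2] [y1 y2]; split; exact: continuous_on_lin.
have subF : subspace_set F.
  split; first exact: C1_0.
  by move=> a x y Fx Fy; exact: C1_lin.
have flin : linear_in F f.
  by move=> a x y [cx _ _] [cy _ _]; exact: vintegral_lin.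
have N_ge0 z : S z -> 0 <= N z.
  by move=> [z1 _]; rewrite le_max (sup_dnorm_ge0 cptO O0 z1).
have N_le z (B : R) : 0 <= B -> (forall x, Omega x -> dnorm (dot_pow d form) (z.1 x) <= B) ->
    (forall x, Omega x -> dnorm form (z.2 x) <= lambda * B) -> N z <= B.
  move=> B0 z1 z2; rewrite ge_max sup_dnorm_le//=.
  by rewrite ler_pdivrMl//; exact: sup_dnorm_le.
have ND x y : S x -> S y -> N (x + y) <= N x + N y.
  move=> [x1 x2] [y1 y2]; rewrite ge_max; apply/andP; split.
    apply: le_trans (sup_dnormD cptO O0 x1 y1) _.
    by apply: lerD; rewrite le_max lexx.
  apply: le_trans (_ : lambda^-1 * (sup_dnorm Omega form x.2 + sup_dnorm Omega form y.2) <= _).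
    by apply: ler_wpM2l; [exact: ltW|exact: sup_dnormD].
  by rewrite mulrDr; apply: lerD; rewrite le_max lexx orbT.
have NZ (a : R) x : 0 <= a -> S x -> N (a *: x) = a * N x.
  move=> a0 [x1 x2]; rewrite /N maxr_pMr//; congr Num.max; first exact: (sup_dnormZ cptO O0 a0 x1).
  by rewrite (sup_dnormZ cptO O0 a0 x2 : sup_dnorm Omega form (a *: x).2 = _) mulrCA.
(* Rescaling by 1/B makes the function feasible for the dual value. A bound B > 0 replaces [N z],
   which may vanish; [fp] then lets B decrease to [N z]. *)
have fN z (B : R) : F z -> 0 < B -> N z <= B -> f z <= D * B.
  move=> Fz B0; have [Sz1 Sz2] := FS _ Fz; rewrite ge_max => /andP[z1 z2].
  suff : vintegral e (fun x => B^-1 *: z.2 x) (vm_sub nu mu) <= D.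
    by rewrite vintegralZ// ler_pdivrMl// mulrC.
  rewrite -lee_fin -DE; apply: ereal_sup_ubound; exists (fun x => B^-1 *: z.2 x) => //.
  exists (fun x => B^-1 *: z.1 x).
    have := C1_lin B^-1 Fz C1_0; congr C1; by apply/funext => x; rewrite addr0.
  move=> x Ox; rewrite !dnormZ gtr0_norm ?invr_gt0// !ler_pdivrMl// mulr1; split.
    by apply: le_trans z1; exact: dnorm_le_sup.
  by rewrite mulrC -ler_pdivrMl//; apply: le_trans z2; rewrite ler_pM2l//; exact: dnorm_le_sup.
have fp z : F z -> f z <= D * N z.
  move=> Fz; apply/ler_addgt0Pr => eps eps0.
  have t0 : 0 < eps / (D + 1) by rewrite divr_gt0// ltr_wpDl.
  apply: le_trans (fN z (N z + eps / (D + 1)) Fz _ _) _.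
  - by rewrite ltr_wpDl// N_ge0//; exact: FS.
  - by rewrite lerDl ltW.
  by rewrite mulrDr lerD2l mulrCA ger_pMr// ler_pdivrMr ?ltr_wpDl// mul1r lerDl.
have [L [Llin Lf LN]] : exists L : E -> R,
    [/\ linear_in S L, (forall x, F x -> L x = f x) & forall x, S x -> L x <= D * N x].
  apply: hahn_banach => // [x y Sx Sy|a x a0 Sx].
    by rewrite -mulrDr ler_wpM2l// ND.
  by rewrite NZ// mulrCA.
have Sg g : contd g -> S (g, fun=> 0) by move=> cg; split => //; exact: continuous_on_cst.
have Sphi phi : cont phi -> S (fun=> 0, phi) by move=> cp; split => //; exact: continuous_on_cst.
have LB z (B : R) : 0 <= B -> S z -> N z <= B -> L z <= D * B.
  by move=> B0 Sz zB; apply: le_trans (LN _ Sz) _; exact: ler_wpM2l.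
(* The domination bounds L from above only; the lower bound is the upper bound at the opposite
   pair. *)
have LNabs z (B : R) : 0 <= B -> S z -> N z <= B -> N ((-1) *: z) <= B -> `|L z| <= D * B.
  move=> B0 Sz zB zB'; have S0 : S 0 by case: subS.
  have L0 := linear_in0 subS Llin.
  have SN : S ((-1) *: z) by rewrite -[_ *: _]addr0; apply: (proj2 subS).
  have LZ : L ((-1) *: z) = - L z by have := Llin (-1) z 0 Sz S0; rewrite addr0 L0 addr0 mulN1r.
  by rewrite ler_norml lerNl -LZ !LB.
have [sigma sigmaP] : exists sigma : Md, forall g, contd g ->
    vintegral (basis_pow d e) g sigma = L (g, fun=> 0).
  apply: (@vector_riesz _ _ _ _ _ cptO _ (expand_basis_pow expand_e)
    (ortho_basis_pow ortho_e) (uniq_basis_pow d ortho_e uniq_e) (fun g => L (g, fun=> 0)) D) => //.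
    move=> a g h cg ch; rewrite -Llin; [|exact: Sg|exact: Sg].
    by congr L; congr pair; apply/funext => x /=; rewrite scaler0 addr0.
  move=> g B B0 cg gB; apply: LNabs => //; first exact: Sg.
    by apply: N_le => // x Ox /=; rewrite dnorm0 mulr_ge0// ltW.
  apply: N_le => // x Ox /=; first by rewrite scaleN1r Defs.dnormN; exact: gB.
  by rewrite [_ x]scaler0 dnorm0 mulr_ge0// ltW.
have Dl0 : 0 <= D * lambda^-1 by rewrite mulr_ge0// ltW.
have [delta deltaP] : exists delta : M, forall phi, cont phi ->
    vintegral e phi delta = L (fun=> 0, phi).
  apply: (@vector_riesz _ _ _ _ _ cptO _ expand_e ortho_e uniq_e
    (fun phi => L (fun=> 0, phi)) (D * lambda^-1)) => //.
    move=> a g h cg ch; rewrite -Llin; [|exact: Sphi|exact: Sphi].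
    by congr L; congr pair; apply/funext => x /=; rewrite scaler0 addr0.
  move=> phi B B0 cphi phiB; rewrite -mulrA.
  have B0' : 0 <= lambda^-1 * B by rewrite mulr_ge0// ltW.
  apply: LNabs => //; first exact: Sphi.
    by apply: N_le => // x Ox /=; [rewrite dnorm0|rewrite mulVKf ?gt_eqF//; exact: phiB].
  apply: N_le => // x Ox /=; first by rewrite [_ x]scaler0 dnorm0.
  by rewrite scaleN1r Defs.dnormN mulVKf ?gt_eqF//; exact: phiB.
have LD g phi : contd g -> cont phi ->
    L (g, phi) = vintegral (basis_pow d e) g sigma + vintegral e phi delta.
  move=> cg cphi; rewrite sigmaP// deltaP//.
  have := Llin 1 _ _ (Sg _ cg) (Sphi _ cphi); rewrite mul1r scale1r => <-.
  by congr L; congr pair; apply/funext => x /=; rewrite ?addr0 ?add0r.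
exists sigma, delta; split.
  move=> phi g C1phi; have [cphi cg _] := C1phi.
  have := Lf (g, phi) C1phi; rewrite LD// /f /vm_sub !(vadd, vopp)//= => h.
  have -> : vintegral (basis_pow d e) g sigma =
    vintegral e phi nu - vintegral e phi mu - vintegral e phi delta by rewrite -h addrK.
  by ring.
rewrite DE; have tv1 := tv_norm_fin cptO (basis_pow d e) sigma.
have tv2 := tv_norm_fin cptO e delta.
rewrite -(fineK tv1) -(fineK tv2) -EFinM -EFinD lee_fin.
(* The pair made of g and lambda phi has norm at most 1 as soon as g and phi separately do, so a
   single use of the domination bounds the sum. Taking suprema over phi and then over g,
   independently, produces lambda |delta| and |sigma|. *)
have key g phi : contd g -> cont phi ->
    (forall x, Omega x -> dnorm (dot_pow d form) (g x) <= 1) ->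
    (forall x, Omega x -> dnorm form (phi x) <= 1) ->
    vintegral (basis_pow d e) g sigma + lambda * vintegral e phi delta <= D.
  move=> cg cphi g1 phi1; rewrite -vintegralZ// -LD//; last exact: continuous_on_scale.
  rewrite -[D]mulr1; apply: LB => //; first by split => //; exact: continuous_on_scale.
  apply: N_le => // x Ox /=.
  by rewrite dnormZ gtr0_norm// ler_pM2l//; exact: phi1.
rewrite -lerBrDl -ler_pdivlMl// -lee_fin fineK//.
apply: ub_ereal_sup => _ [phi [cphi phi1] <-]; rewrite lee_fin ler_pdivlMl// lerBrDl -lerBrDr.
rewrite -lee_fin fineK//; apply: ub_ereal_sup => _ [g [cg g1] <-].
by rewrite lee_fin lerBrDr; exact: key.
Qed.

End duality.

Theorem mainTheorem3 (R : realType) (d : nat) (Omega : set 'rV[R]_d)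
    (n : nat) (V : vectType R) (form : {dot V for idfun}) (e : n.-tuple V)
    (lambda : R)
    (mu nu : vmeasure Omega form) :
  compact Omega -> @convex_set R 'rV[R]_d Omega -> Omega° !=set0 ->
  basis_of fullv e -> orthonormal form e ->
  0 < lambda ->
  exists (sigma : vmeasure Omega (dot_pow d form)) (delta : vmeasure Omega form),
    [/\ div_eq e sigma (vm_add (vm_sub mu nu) delta),
        T11 e lambda mu nu =
          (tv_norm (basis_pow d e) sigma
           + lambda%:E * tv_norm e delta)%E &
        forall (sigma' : vmeasure Omega (dot_pow d form))
               (delta' : vmeasure Omega form),
          div_eq e sigma' (vm_add (vm_sub mu nu) delta') ->
          (T11 e lambda mu nu <=
           tv_norm (basis_pow d e) sigma'
           + lambda%:E * tv_norm e delta')%E].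
Proof.
move=> cptO convO intO be oe lambda0.
have expand_e := expand_orthonormal_basis be oe.
have [uniq_e ortho_e] := orthonormal_uniq oe.
have [sigma [delta [dsigma le_dual]]] :=
  dual_attained cptO intO expand_e ortho_e uniq_e lambda0 mu nu.
have T11_le (sigma' : vmeasure Omega (dot_pow d form)) (delta' : vmeasure Omega form) :
    div_eq e sigma' (vm_add (vm_sub mu nu) delta') ->
    (T11 e lambda mu nu <= tv_norm (basis_pow d e) sigma' + lambda%:E * tv_norm e delta')%E.
  exact: T11_le_transport.
(* The cost of this pair is at most the dual value, which is at most [T11], which is at most the
   cost of any competitor, this pair included. *)
exists sigma, delta; split => //; apply/eqP; rewrite eq_le T11_le//=.
by apply: le_trans le_dual _; exact: dual_value_le_T11.
Qed.
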